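(* Let $K$ be a discrete valuation field of characteristic $p>0$ and let $\varphi\in W_n(K)$. Then $$\min\{m\ge1\mid\varphi\in{}^\flat\mathrm{fil}^F_mW_n(K)\}=1+\max\{s_{K'}(\varphi)\mid K'\in\mathcal{E}_2\},$$ where $\mathcal{E}_2$ is the class of discrete valuation fields $K'\supset K$ with $O_{K'}\cap K=O_K$, $m_{K'}\cap K=m_K$, perfect residue field, and ramification index $e(K'/K)=1$.
   Context: For a discrete valuation field $L$ of characteristic $p$ with normalized valuation $v_L$: $\mathrm{fil}_mW_n(L)=\{(f_{n-1},\dots,f_0)\mid p^jv_L(f_j)\ge-m\ \forall j\}$; ${}^\flat\mathrm{fil}_mW_n(L)$ consists of those elements of $\mathrm{fil}_mW_n(L)$ such that, if $i=\mathrm{ord}_p(m)<n$, then $p^iv_L(f_i)>-m$; $F$ is the componentwise $p$-th power; $\mathrm{fil}^F_m=\sum_{j\ge0}F^j(\mathrm{fil}_m)$, ${}^\flat\mathrm{fil}^F_m=\sum_{j\ge0}F^j({}^\flat\mathrm{fil}_m)$; $s_L(\varphi)=\min\{m\in\mathbb{N}\mid\varphi\in\mathrm{fil}^F_mW_n(L)\}$. *)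

(* Defs.v *)
From HB Require Import structures.
From mathcomp Require Import all_boot all_order all_algebra.
From mathcomp Require Import mpoly.
Set Implicit Arguments. Unset Strict Implicit. Unset Printing Implicit Defensive.
Import Order.TTheory GRing.Theory Num.Theory.
Local Open Scope ring_scope.

Section WittPoly.
Variables (p n : nat).

Definition wX (k : nat) : {mpoly int[n + n]} :=
  match insub k with Some i => 'X_(lshift n i) | None => 0 end.
Definition wY (k : nat) : {mpoly int[n + n]} :=
  match insub k with Some i => 'X_(rshift n i) | None => 0 end.

Definition ghost (Z : nat -> {mpoly int[n + n]}) (i : nat) : {mpoly int[n + n]} :=
  \sum_(k < i.+1) (p ^ k)%:R * Z k ^+ (p ^ (i - k)).

(* exact coefficientwise integer division (used only where it is exact) *)
Definition mdivz (q : {mpoly int[n + n]}) (d : int) : {mpoly int[n + n]} :=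
  \sum_(m <- msupp q) ((q@_m %/ d)%Z *: 'X_[m]).

(* S_i determined by  w_i(S) = w_i(X) + w_i(Y) *)
Definition witt_next (s : seq {mpoly int[n + n]}) : {mpoly int[n + n]} :=
  let i := size s in
  mdivz (ghost wX i + ghost wY i
         - \sum_(k < i) (p ^ k)%:R * (nth 0 s k) ^+ (p ^ (i - k)))
        (p ^ i)%:Z.

Fixpoint witt_S_list (i : nat) : seq {mpoly int[n + n]} :=
  if i is i'.+1 then rcons (witt_S_list i') (witt_next (witt_S_list i')) else [::].

Definition witt_S (i : nat) : {mpoly int[n + n]} := nth 0 (witt_S_list n) i.

End WittPoly.

(* W_n(L) as n-tuples of standard Witt coordinates *)
Definition witt (n : nat) (L : comNzRingType) := {ffun 'I_n -> L}.

Definition witt_add (p n : nat) (L : comNzRingType) (a b : witt n L) : witt n L :=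
  [ffun i : 'I_n =>
     mmap (fun z : int => z%:~R)
          (fun j : 'I_(n + n) => match split j with inl k => a k | inr k => b k end)
          (witt_S p n i)].

Definition witt0 (n : nat) (L : comNzRingType) : witt n L := [ffun=> 0].

Definition wittF (p n : nat) (L : comNzRingType) (a : witt n L) : witt n L :=
  [ffun i => a i ^+ p].

Definition witt_map (n : nat) (K L : comNzRingType) (f : K -> L) (a : witt n K) : witt n L :=
  [ffun i => f (a i)].

(* Kato's indexing (f_{n-1}, ..., f_0): f_j is standard coordinate n-1-j *)
Definition wcoord (n : nat) (L : comNzRingType) (a : witt n L) (j : nat) : L :=
  if (j < n)%N then
    match insub (n.-1 - j)%N with Some i => a i | None => 0 end
  else 0.

(* Normalized discrete valuations. v : L -> int; v 0 is irrelevant      *)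
(* (0 is treated as having valuation +oo everywhere below).            *)
Definition is_ndval (L : fieldType) (v : L -> int) : Prop :=
  [/\ exists t : L, t != 0 /\ v t = 1,
      forall x y : L, x != 0 -> y != 0 -> v (x * y) = v x + v y
    & forall x y : L, x != 0 -> y != 0 -> x + y != 0 ->
        Num.min (v x) (v y) <= v (x + y)].

Definition inO (L : fieldType) (v : L -> int) (x : L) : bool := (x == 0) || (0 <= v x).
Definition inM (L : fieldType) (v : L -> int) (x : L) : bool := (x == 0) || (0 < v x).

Definition perfect_residue (p : nat) (L : fieldType) (v : L -> int) : Prop :=
  forall a : L, inO v a -> exists2 b : L, inO v b & inM v (a - b ^+ p).

Definition in_fil (p n : nat) (L : fieldType) (v : L -> int) (m : nat) (a : witt n L) : bool :=
  [forall j : 'I_n, (wcoord a j == 0) || (- (m%:Z) <= (p ^ j)%:Z * v (wcoord a j))].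

Definition in_flat_fil (p n : nat) (L : fieldType) (v : L -> int) (m : nat) (a : witt n L) : bool :=
  in_fil p v m a &&
  ((0 < m)%N && (logn p m < n)%N ==>
     (wcoord a (logn p m) == 0) ||
     (- (m%:Z) < (p ^ logn p m)%:Z * v (wcoord a (logn p m)))).

(* sum_{j>=0} F^j(P): the (finite) Witt sums of elements F^j(x), x in P *)
Definition in_sumF (p n : nat) (L : comNzRingType) (P : witt n L -> bool) (a : witt n L) : Prop :=
  exists s : seq (nat * witt n L),
    all (fun jx => P jx.2) s /\
    a = foldr (fun jx acc => witt_add p (iter jx.1 (@wittF p n L) jx.2) acc) (witt0 n L) s.

Definition in_filF (p n : nat) (L : fieldType) (v : L -> int) (m : nat) (a : witt n L) : Prop :=
  in_sumF p (in_fil p v m) a.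

Definition in_flat_filF (p n : nat) (L : fieldType) (v : L -> int) (m : nat) (a : witt n L) : Prop :=
  in_sumF p (in_flat_fil p v m) a.

Definition swan_is (p n : nat) (L : fieldType) (v : L -> int) (a : witt n L) (m : nat) : Prop :=
  in_filF p v m a /\ forall k : nat, (k < m)%N -> ~ in_filF p v k a.

Definition in_E2 (p : nat) (K : fieldType) (v : K -> int)
    (K' : fieldType) (v' : K' -> int) (iota : {rmorphism K -> K'}) : Prop :=
  [/\ is_ndval v',
      forall x : K, inO v' (iota x) = inO v x,
      forall x : K, inM v' (iota x) = inM v x,
      perfect_residue p v'
    & forall x : K, x != 0 -> v' (iota x) = v x].       (* e(K'/K) = 1 *)

(* Main.v *)
Require Import Defs.
From HB Require Import structures.
From mathcomp Require Import all_boot all_order all_algebra.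
From mathcomp Require Import mpoly.
From mathcomp Require Import zify ring.
From mathcomp Require boolp classical_sets.
Import Order.TTheory GRing.Theory Num.Theory.
Local Open Scope ring_scope.
Set Implicit Arguments.
Unset Strict Implicit.
Unset Printing Implicit Defensive.

(* A vector [x] lies in [fil_m] iff [F^(n-1) x] is the Teichmueller vector of [pi ^ (- m)] times
   a vector with integral coordinates; reducing the latter gives an additive symbol
   [sym m : fil_m -> W_n(k)], [k] the residue field, with kernel [fil_(m-1)].

   If the residue field is perfect, every coordinate of [sym m x] at a slope divisible by [p] is
   a [p]-th power, so it can be removed by subtracting an element [F y]: hence
   flat [fil_m] is contained in [fil^F_(m-1)], which bounds all [s_(K')] from above.

   Conversely let [x] in flat [fil_m W_n(K)] not lie in flat [fil_(m-1)] plus [F W_n(K)]; we need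
   [K'] with [x] outside [fil_(m-2) W_n(K') + F W_n(K')].  Either the symbol of [x] at level
   [m - 1] survives at a coordinate of slope prime to [p], and then every [K'] works, or some
   leading coefficient [b] has a residue that is not a [p]-th power.  Inside the perfect closure
   of [K] Zorn's lemma yields an extension [L] with [e = 1] whose residue field has [p]-basis
   [b], and then, for [t = 0, 1], an extension [K'_t] in [E_2] of [L] in which [b - t * pi]
   becomes a [p]-th power.  If [x] were in [fil_(m-2) + F W_n] over both, comparing the first
   order terms of [t = 0] and [t = 1] would give a relation
   [sum_(j, s) s * (c_(j,s) ^ p * b ^ s) ^ (p ^ j) = 0] in the residue field, which forces the
   residue of [b] to be a [p]-th power.

   A decomposition [phi = x + F y] is unique up to [fil_(m / p)], so the statement for [phi]
   follows by treating its components one after the other. *)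

(** * Witt vectors *)

(** Passing to integral Witt vectors avoids estimates on the addition polynomials: [fil] is additive
    because an identity of Witt vectors can be added. The price is that leading coefficients appear
    raised to the power [p ^ (n - 1)], which is harmless because this power map is additive and
    injective on a field of characteristic [p].

    Two values of [t] are compared because the part of [x] in fil_(m-1) contributes an unknown
    leading coefficient at level [m - 1]. It is the same for every [t], so the difference of the two
    relations isolates the derivative with respect to [b]. This derivative is blind to [p]-th
    powers. That is why all coefficients must first be expanded along a [p]-basis consisting of [b]
    alone, over a field where the residue of [b] is still not a [p]-th power.

    Completeness is nowhere asked of the fields of [E_2], so all extensions can be cut out of a
    perfect closure: [p]-th roots exist there, the valuation extends uniquely, and subfields form a
    set to which Zorn's lemma applies. Adjoining a [p]-th root of an element whose residue is not a
    [p]-th power keeps [e = 1]. *)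

Section Congruence.
Variable R : comNzRingType.
Implicit Types (x y z : R) (d : nat).

Definition cong d x y := exists z, x = y + d%:R * z.

Lemma cong_refl d x : cong d x x.
Proof. by exists 0; rewrite mulr0 addr0. Qed.

Lemma cong_sym d x y : cong d x y -> cong d y x.
Proof. by case=> z ->; exists (- z); rewrite mulrN addrK. Qed.

Lemma cong_trans d x y z : cong d x y -> cong d y z -> cong d x z.
Proof. by case=> u -> [w ->]; exists (w + u); rewrite mulrDr addrA. Qed.

Lemma congD d x y x' y' : cong d x x' -> cong d y y' -> cong d (x + y) (x' + y').
Proof. by case=> u -> [w ->]; exists (u + w); ring. Qed.

Lemma congM d x y x' y' : cong d x x' -> cong d y y' -> cong d (x * y) (x' * y').
Proof.
by case=> u -> [w ->]; exists (x' * w + u * y' + d%:R * u * w); ring.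
Qed.

Lemma congX d n x y : cong d x y -> cong d (x ^+ n) (y ^+ n).
Proof.
move=> h; elim: n => [|n ih]; first exact: cong_refl.
by rewrite !exprS; apply: congM.
Qed.

Lemma cong_sum d (I : Type) (s : seq I) (P : pred I) (F G : I -> R) :
  (forall i, P i -> cong d (F i) (G i)) ->
  cong d (\sum_(i <- s | P i) F i) (\sum_(i <- s | P i) G i).
Proof.
move=> h; apply: (big_ind2 (cong d)) => //; first exact: cong_refl.
by move=> *; apply: congD.
Qed.

Lemma cong_prod d (I : Type) (s : seq I) (P : pred I) (F G : I -> R) :
  (forall i, P i -> cong d (F i) (G i)) ->
  cong d (\prod_(i <- s | P i) F i) (\prod_(i <- s | P i) G i).
Proof.
move=> h; apply: (big_ind2 (cong d)) => //; first exact: cong_refl.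
by move=> *; apply: congM.
Qed.

Lemma cong_natl d e x y : cong d x y -> cong (e * d) (e%:R * x) (e%:R * y).
Proof. by case=> z ->; exists z; rewrite natrM; ring. Qed.

Variable p : nat.
Hypothesis pr_p : prime p.

(** The cofactor of [x - y] in [x ^+ p - y ^+ p] is a sum of [p] terms, all congruent to [y ^+ p.-1]
    modulo [p]; it is therefore divisible by [p] and supplies the extra power. *)
Lemma cong_lift k x y : cong (p ^ k.+1) x y -> cong (p ^ k.+2) (x ^+ p) (y ^+ p).
Proof.
move=> cxy.
have cp : cong p x y.
  by case: cxy => z ->; exists ((p ^ k)%:R * z); rewrite expnS natrM mulrA.
have [w hw] : cong p (\sum_(i < p) x ^+ (p.-1 - i) * y ^+ i) 0.
  apply: (@cong_trans _ _ (\sum_(i < p) y ^+ p.-1)).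
    apply: cong_sum => i _.
    rewrite -[in X in cong _ _ X](@subnK i p.-1) ?exprD; last first.
      by rewrite -ltnS prednK ?prime_gt0.
    by apply: congM; [apply: congX | apply: cong_refl].
  by rewrite sumr_const card_ord; exists (y ^+ p.-1); rewrite add0r mulr_natl.
case: cxy => z hz; exists (z * w).
apply/eqP; rewrite addrC -subr_eq subrXX hw hz; apply/eqP.
by rewrite (expnSr _ k.+1) natrM; ring.
Qed.

Lemma cong_liftX k j x y :
  cong (p ^ k.+1) x y -> cong (p ^ (k + j).+1) (x ^+ (p ^ j)) (y ^+ (p ^ j)).
Proof.
elim: j => [|j ih] h; first by rewrite addn0 !expr1.
by rewrite addnS (expnSr p j) !exprM; apply/cong_lift/ih.
Qed.

Lemma cong_expD x y : cong p ((x + y) ^+ p) (x ^+ p + y ^+ p).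
Proof.
rewrite exprDn; case: p pr_p => // q pr_q.
rewrite big_ord_recr big_ord_recl /= subn0 bin0 expr0 mulr1 subnn expr0 mul1r binn.
rewrite !mulr1n addrAC -[X in cong _ _ X]addr0; apply: congD; first exact: cong_refl.
apply: (big_ind (fun z => cong q.+1 z 0)) => [|u w hu hw|i _].
- exact: cong_refl.
- by rewrite -[0]addr0; apply: congD.
have /dvdnP[e ->] : (q.+1 %| 'C(q.+1, bump 0 i))%N.
  by apply: prime_dvd_bin => //; case: i => i /= hi; rewrite /bump /=; lia.
by exists (e%:R * (x ^+ (q.+1 - bump 0 i) * y ^+ bump 0 i));
   rewrite add0r -mulr_natl natrM; ring.
Qed.

Lemma cong_fermat (c : int) : cong p ((c%:~R : R) ^+ p) c%:~R.
Proof.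
have hn (n : nat) : cong p ((n%:R : R) ^+ p) n%:R.
  elim: n => [|n ih]; first by rewrite expr0n gtn_eqF ?prime_gt0 //; apply: cong_refl.
  rewrite -natr1; apply: cong_trans (cong_expD _ _) _.
  by rewrite expr1n; apply: congD => //; apply: cong_refl.
case: c => n; first exact: hn.
rewrite NegzE mulrNz -pmulrn; set x : R := n.+1%:R.
apply: (@cong_trans _ _ (- x ^+ p)); last first.
  by case: (hn n.+1) => z hz; exists (- z); rewrite hz -/x; ring.
(* Expanding [(x + - x) ^+ p] avoids the sign rule for odd exponents, so that [p = 2] is covered. *)
have := cong_expD x (- x); rewrite subrr expr0n gtn_eqF ?prime_gt0 // => -[z hz].
exists (- z); apply/eqP; rewrite -subr_eq0; apply/eqP.
by transitivity (x ^+ p + (- x) ^+ p + p%:R * z); [ring | rewrite -hz].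
Qed.

End Congruence.

(** * Lift of Frobenius to integer polynomials *)

Section MpolyFrobenius.
Variables (p : nat) (N : nat).
Hypothesis pr_p : prime p.
Local Notation A := {mpoly int[N]}.

(** This ring endomorphism reduces to the [p]-th power map modulo [p]. Dwork's congruence compares
    the ghost component of index [i.+1] with its image of the one of index [i]. *)
Definition frob_lift : A -> A := mmap intr (fun i => 'X_i ^+ p).
HB.instance Definition _ := GRing.RMorphism.copy frob_lift (mmap intr (fun i => 'X_i ^+ p)).

Lemma frob_liftX i : frob_lift 'X_i = 'X_i ^+ p.
Proof. by rewrite /frob_lift mmapX mmap1U. Qed.

Lemma cong_frob_lift (f : A) : cong p (f ^+ p) (frob_lift f).
Proof.
elim/mpolyind: f => [|c m f _ _ ih].
  by rewrite rmorph0 expr0n gtn_eqF ?prime_gt0 //; apply: cong_refl.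
apply: cong_trans (cong_expD pr_p _ _) _; rewrite rmorphD /=.
apply: congD => //; rewrite -mul_mpolyC exprMn rmorphM /=; apply: congM.
  rewrite /frob_lift mmapC.
  have -> : c%:MP_[N] = c%:~R by rewrite -{1}[c]intz rmorph_int.
  exact: cong_fermat.
rewrite /frob_lift mmapX -mmap1_id /mmap1 -prodrXl; apply: cong_prod => i _.
by rewrite -!exprM mulnC; apply: cong_refl.
Qed.

End MpolyFrobenius.

(** * Integrality of the Witt addition polynomials *)

Section GhostIdentity.
Variables (p n : nat).
Hypothesis pr_p : prime p.

Definition gh (R : comNzRingType) (a : nat -> R) (i : nat) : R :=
  \sum_(k < i.+1) (p ^ k)%:R * a k ^+ (p ^ (i - k)).

Lemma gh_recr (R : comNzRingType) (a : nat -> R) (i : nat) :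
  gh a i = \sum_(k < i) (p ^ k)%:R * a k ^+ (p ^ (i - k)) + (p ^ i)%:R * a i.
Proof. by rewrite /gh big_ord_recr /= subnn expr1. Qed.

Lemma gh_morph (R S : comNzRingType) (f : {rmorphism R -> S}) (a : nat -> R) i :
  f (gh a i) = gh (f \o a) i.
Proof.
rewrite rmorph_sum; apply: eq_bigr => k _.
by rewrite rmorphM rmorph_nat rmorphXn.
Qed.

Lemma eq_gh (R : comNzRingType) (a b : nat -> R) i :
  (forall k, (k <= i)%N -> a k = b k) -> gh a i = gh b i.
Proof. by move=> h; apply: eq_bigr => k _; rewrite h // -ltnS. Qed.

Local Notation A := {mpoly int[n + n]}.

Lemma mcoeff_mdivz (q : A) (d : int) m : (mdivz q d)@_m = (q@_m %/ d)%Z.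
Proof.
rewrite /mdivz raddf_sum /=.
have [hm|hm] := boolP (m \in msupp q).
  rewrite (bigD1_seq m) ?msupp_uniq //= mcoeffZ mcoeffX eqxx mulr1 big1 ?addr0 //.
  by move=> m' /negbTE h; rewrite mcoeffZ mcoeffX h mulr0.
rewrite (memN_msupp_eq0 hm) div0z big1_seq // => m' /= h.
rewrite mcoeffZ mcoeffX; case: eqP => [e|]; last by rewrite mulr0.
by rewrite -e h in hm.
Qed.

Lemma mdivzK (g : A) (d : nat) : (0 < d)%N -> mdivz (d%:R * g) d%:Z = g.
Proof.
move=> d0; apply/mpolyP => m; rewrite mcoeff_mdivz mulr_natl mcoeffMn.
by rewrite -mulr_natr natz mulzK // eqz_nat -lt0n.
Qed.

Lemma size_witt_S_list i : size (witt_S_list p n i) = i.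
Proof. by elim: i => //= i ih; rewrite size_rcons ih. Qed.

Lemma nth_witt_S_list i j k : (k < i)%N -> (i <= j)%N ->
  nth 0 (witt_S_list p n j) k = nth 0 (witt_S_list p n i) k.
Proof.
move=> ki; elim: j => [|j ih]; first by lia.
rewrite leq_eqVlt => /orP[/eqP <- //|ij] /=.
by rewrite nth_rcons size_witt_S_list ifT ?ih //; lia.
Qed.

Lemma witt_S_rec i : (i < n)%N ->
  witt_S p n i = mdivz (gh (@wX n) i + gh (@wY n) i
         - \sum_(k < i) (p ^ k)%:R * witt_S p n k ^+ (p ^ (i - k))) (p ^ i)%:Z.
Proof.
move=> lt_in; rewrite /witt_S (@nth_witt_S_list i.+1) //=.
rewrite nth_rcons size_witt_S_list ltnn eqxx /witt_next size_witt_S_list.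
congr (mdivz (_ - _) _); apply: eq_bigr => k _.
by rewrite (@nth_witt_S_list i n) // ltnW.
Qed.

Lemma frob_lift_wX k : frob_lift p (wX n k) = wX n k ^+ p.
Proof.
rewrite /wX; case: insub => [i|]; first exact: frob_liftX.
by rewrite rmorph0 expr0n gtn_eqF ?prime_gt0.
Qed.

Lemma frob_lift_wY k : frob_lift p (wY n k) = wY n k ^+ p.
Proof.
rewrite /wY; case: insub => [i|]; first exact: frob_liftX.
by rewrite rmorph0 expr0n gtn_eqF ?prime_gt0.
Qed.

Lemma gh_frob_lift (a : nat -> A) i :
  (forall k, frob_lift p (a k) = a k ^+ p) ->
  gh a i.+1 = frob_lift p (gh a i) + (p ^ i.+1)%:R * a i.+1.
Proof.
move=> ha; rewrite gh_recr gh_morph; congr (_ + _).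
apply: eq_bigr => k _; rewrite /= ha -exprM -expnS subSn //.
by rewrite -ltnS.
Qed.

(* Dwork's congruence: the division by [p ^ i] in the definition of [witt_S] is exact. *)
Lemma gh_witt_S i : (i < n)%N -> gh (witt_S p n) i = gh (@wX n) i + gh (@wY n) i.
Proof.
elim: i => [|i ih] lt_in; rewrite gh_recr witt_S_rec //.
  rewrite !big_ord0 add0r subr0 /= expn0 -[X in mdivz X]mul1r.
  by rewrite [X in mdivz X _](_ : _ = 1%:R * (gh (@wX n) 0 + gh (@wY n) 0)) // mdivzK // mul1r.
set T := \sum_(k < i.+1) _.
suff [z hz] : cong (p ^ i.+1) (gh (@wX n) i.+1 + gh (@wY n) i.+1) T.
  rewrite hz [_ - T]addrAC subrr add0r mdivzK //.
  by rewrite expn_gt0 prime_gt0.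
rewrite !gh_frob_lift; last exact: frob_lift_wX.
  2: exact: frob_lift_wY.
apply: (@cong_trans _ _ _ (frob_lift p (gh (@wX n) i + gh (@wY n) i))).
  by rewrite rmorphD; exists (wX n i.+1 + wY n i.+1); rewrite mulrDr addrACA.
(* By induction the ghost sum at [i] is that of [witt_S]. What remains holds term by term:
   [S_k ^+ p] and [frob_lift S_k] agree modulo [p], hence their powers [p ^ (i - k)] agree modulo
   [p ^ (i - k).+1], and the factor [p ^ k] completes the modulus to [p ^ i.+1]. *)
rewrite -ih ?gh_morph; last by lia.
apply: cong_sym; apply: cong_sum => k _ /=.
have ki : (k <= i)%N by rewrite -ltnS.
have -> : (p ^ i.+1 = p ^ k * p ^ (0 + (i - k)).+1)%N by rewrite -expnD; congr (_ ^ _)%N; lia.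
apply: cong_natl; rewrite (_ : p ^ (i.+1 - k) = p * p ^ (i - k))%N; last by rewrite subSn // expnS.
by rewrite exprM; apply: (@cong_liftX _ p pr_p 0); rewrite expn1; apply: cong_frob_lift.
Qed.

End GhostIdentity.

(** * Group laws deduced from ghost components *)

Section WittAdd.
Variables (p n : nat).
Hypothesis pr_p : prime p.

(* Standard coordinates, extended by [0] beyond [n]. *)
Definition wx (R : comNzRingType) (a : witt n R) (k : nat) : R :=
  if insub k is Some i then a i else 0.

Lemma wx_ord (R : comNzRingType) (a : witt n R) (k : 'I_n) : wx a k = a k.
Proof. by rewrite /wx valK. Qed.

Lemma wx_inj (R : comNzRingType) (a b : witt n R) :
  (forall k, (k < n)%N -> wx a k = wx b k) -> a = b.
Proof. by move=> h; apply/ffunP => k; rewrite -!wx_ord h. Qed.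

Lemma wx_ffun (R : comNzRingType) (f : nat -> R) k : (k < n)%N ->
  @wx R [ffun i : 'I_n => f i] k = f k.
Proof. by move=> hk; rewrite -[k]/(val (Ordinal hk)) wx_ord ffunE. Qed.

Lemma wx_map (R S : comNzRingType) (f : {rmorphism R -> S}) (a : witt n R) k :
  wx (witt_map f a) k = f (wx a k).
Proof. by rewrite /wx; case: insub => [i|]; rewrite ?ffunE ?rmorph0. Qed.

Definition wev (R : comNzRingType) (a b : witt n R) : {mpoly int[n + n]} -> R :=
  mmap intr (fun j : 'I_(n + n) => match split j with inl k => a k | inr k => b k end).
HB.instance Definition _ (R : comNzRingType) (a b : witt n R) :=
  GRing.RMorphism.copy (wev a b)
   (mmap intr (fun j : 'I_(n + n) => match split j with inl k => a k | inr k => b k end)).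

Lemma wev_wX (R : comNzRingType) (a b : witt n R) k : wev a b (wX n k) = wx a k.
Proof.
rewrite /wX /wx; case: insub => [i|]; last by rewrite rmorph0.
by rewrite /wev mmapX mmap1U (unsplitK (inl i)).
Qed.

Lemma wev_wY (R : comNzRingType) (a b : witt n R) k : wev a b (wY n k) = wx b k.
Proof.
rewrite /wY /wx; case: insub => [i|]; last by rewrite rmorph0.
by rewrite /wev mmapX mmap1U (unsplitK (inr i)).
Qed.

Lemma wx_witt_add (R : comNzRingType) (a b : witt n R) k : (k < n)%N ->
  wx (witt_add p a b) k = wev a b (witt_S p n k).
Proof. by move=> hk; rewrite -[k]/(val (Ordinal hk)) wx_ord ffunE. Qed.

Lemma gh_wev (R : comNzRingType) (a b : witt n R) (u : nat -> {mpoly int[n + n]}) i :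
  wev a b (gh p u i) = gh p (fun k => wev a b (u k)) i.
Proof. exact: gh_morph. Qed.

Lemma gh_witt_add (R : comNzRingType) (a b : witt n R) i : (i < n)%N ->
  gh p (wx (witt_add p a b)) i = gh p (wx a) i + gh p (wx b) i.
Proof.
move=> hi; transitivity (wev a b (gh p (witt_S p n) i)).
  rewrite gh_wev; apply: eq_gh => k hk.
  by rewrite wx_witt_add //; apply: leq_ltn_trans hk hi.
rewrite (gh_witt_S pr_p hi).
rewrite (rmorphD (wev a b)) /=.
congr (_ + _).
  rewrite gh_wev.
  apply: eq_gh => k _.
  by rewrite wev_wX.
rewrite gh_wev.
apply: eq_gh => k _.
by rewrite wev_wY.
Qed.

Lemma witt_map_add (R S : comNzRingType) (f : {rmorphism R -> S}) (a b : witt n R) :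
  witt_map f (witt_add p a b) = witt_add p (witt_map f a) (witt_map f b).
Proof.
apply/ffunP => k; rewrite !ffunE /mmap rmorph_sum; apply: eq_bigr => m _.
rewrite rmorphM rmorph_int /mmap1 rmorph_prod; congr (_ * _).
apply: eq_bigr => j _; rewrite rmorphXn.
by case: split => i; rewrite ffunE.
Qed.

Definition torsion_free (R : comNzRingType) :=
  forall (d : nat) (x : R), (0 < d)%N -> d%:R * x = 0 -> x = 0.

Lemma gh_inj (R : comNzRingType) (a b : witt n R) : torsion_free R ->
  (forall i, (i < n)%N -> gh p (wx a) i = gh p (wx b) i) -> a = b.
Proof.
move=> tf h; apply: wx_inj => k; elim/ltn_ind: k => k ih hk.
have /eqP := h k hk; rewrite !gh_recr.
rewrite (eq_bigr (fun l : 'I_k => (p ^ l)%:R * wx b l ^+ (p ^ (k - l)))); last first.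
  by move=> l _; rewrite ih // (ltn_trans _ hk).
rewrite (inj_eq (addrI _)) -subr_eq0 -mulrBr => /eqP /tf.
by rewrite expn_gt0 prime_gt0 // => /(_ isT) /eqP; rewrite subr_eq0 => /eqP.
Qed.

Lemma mpoly_torsion_free N : torsion_free {mpoly int[N]}.
Proof.
move=> d x d0 h; apply/mpolyP => m; rewrite mcoeff0.
move/(congr1 (mcoeff m)): h; rewrite mcoeff0 mulr_natl mcoeffMn => /eqP.
by rewrite mulrn_eq0 gtn_eqF //= => /eqP.
Qed.

(* Identities between Witt vectors only have to be checked over torsion-free rings. *)
Lemma witt_universal (R : comNzRingType) (r : nat) (a : 'I_r -> witt n R) (s : 'I_r -> R) :
  exists (U : comNzRingType) (f : {rmorphism U -> R}) (a' : 'I_r -> witt n U)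
         (s' : 'I_r -> U),
  [/\ torsion_free U, forall c, a c = witt_map f (a' c) & forall c, s c = f (s' c)].
Proof.
pose M := \matrix_(c < r, k < n.+1) oapp (a c) (s c) (unlift ord_max k).
pose h j := mxvec M 0 j.
exists {mpoly int[r * n.+1]}, (mmap intr h),
  (fun c => [ffun k : 'I_n => 'X_(mxvec_index c (lift ord_max k))]),
  (fun c => 'X_(mxvec_index c ord_max)); split.
- exact: mpoly_torsion_free.
- move=> c; apply/ffunP => k; rewrite !ffunE /= mmapX mmap1U /h mxvecE mxE.
  by rewrite liftK.
- by move=> c; rewrite /= mmapX mmap1U /h mxvecE mxE unlift_none.
Qed.

Lemma witt_addC (R : comNzRingType) : commutative (@witt_add p n R).
Proof.
move=> a b.
have [U [f [a' [s' [tf ha _]]]]] :=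
  witt_universal (fun c : 'I_2 => if c == 0 then a else b) (fun=> 0).
have -> : a = witt_map f (a' 0) by rewrite -ha.
have -> : b = witt_map f (a' 1) by rewrite -ha.
rewrite -!witt_map_add; congr witt_map; apply: gh_inj => // i hi.
by rewrite !gh_witt_add // addrC.
Qed.

Lemma witt_addA (R : comNzRingType) : associative (@witt_add p n R).
Proof.
move=> a b c.
have [U [f [a' [s' [tf ha _]]]]] := witt_universal
  (fun i : 'I_3 => if i == 0 then a else if i == 1 then b else c) (fun=> 0).
have -> : a = witt_map f (a' 0) by rewrite -ha.
have -> : b = witt_map f (a' 1) by rewrite -ha.
have -> : c = witt_map f (a' 2%:R) by rewrite -ha.
rewrite -!witt_map_add; congr witt_map; apply: gh_inj => // i hi.
by rewrite !gh_witt_add // addrA.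
Qed.

Lemma gh_witt0 (R : comNzRingType) i : gh p (wx (witt0 n R)) i = 0.
Proof.
rewrite /gh big1 // => k _; rewrite /wx; case: insub => [j|]; rewrite ?ffunE;
by rewrite expr0n gtn_eqF ?mulr0 // expn_gt0 prime_gt0.
Qed.

Lemma witt_add0 (R : comNzRingType) : left_id (witt0 n R) (@witt_add p n R).
Proof.
move=> a.
have [U [f [a' [s' [tf ha _]]]]] := witt_universal (fun c : 'I_1 => a) (fun=> 0).
rewrite (ha 0); have -> : witt0 n R = witt_map f (witt0 n U).
  by apply/ffunP => k; rewrite !ffunE rmorph0.
rewrite -witt_map_add; congr witt_map; apply: gh_inj => // i hi.
by rewrite gh_witt_add // gh_witt0 add0r.
Qed.

(** The addition polynomial of index [k] is [X_k + Y_k] plus a polynomial in the earlier variables.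
    Comparing two pairs of vectors expresses this without exhibiting that polynomial. *)
Lemma witt_add_low (R : comNzRingType) (a b a' b' : witt n R) k :
  (k < n)%N ->
  (forall l, (l < k)%N -> wx a l = wx a' l) ->
  (forall l, (l < k)%N -> wx b l = wx b' l) ->
  wx (witt_add p a b) k - (wx a k + wx b k) = wx (witt_add p a' b') k - (wx a' k + wx b' k).
Proof.
suff tf_case (U : comNzRingType) : torsion_free U -> forall (a b a' b' : witt n U) k,
    (k < n)%N -> (forall l, (l < k)%N -> wx a l = wx a' l) ->
    (forall l, (l < k)%N -> wx b l = wx b' l) ->
    wx (witt_add p a b) k - (wx a k + wx b k)
    = wx (witt_add p a' b') k - (wx a' k + wx b' k).
  move=> hk haa hbb.
  have [U [f [u [s' [tf hu _]]]]] := witt_universal (fun i : 'I_4 =>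
    if i == 0 then a else if i == 1 then b else if i == 2%:R then a' else b') (fun=> 0).
  (* The lifts of [a] and [a'] need not agree below [k] although their images do; [mix] grafts the
     low coordinates of one lift onto the other. *)
  pose mix (x y : witt n U) : witt n U :=
    [ffun i : 'I_n => if (i < k)%N then wx x i else wx y i].
  have mixE x y l : (l < n)%N -> wx (mix x y) l = if (l < k)%N then wx x l else wx y l.
    by move=> hl; rewrite (wx_ffun (fun l => if (l < k)%N then wx x l else wx y l)).
  have hx : a = witt_map f (u 0) by rewrite -hu.
  have hy : b = witt_map f (u 1) by rewrite -hu.
  have hx' : a' = witt_map f (mix (u 0) (u 2%:R)).
    have e : a' = witt_map f (u 2%:R) by rewrite -hu.
    apply: wx_inj => l hl; rewrite wx_map mixE //; case: ifP => hlk.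
      by rewrite -haa // hx wx_map.
    by rewrite e wx_map.
  have hy' : b' = witt_map f (mix (u 1) (u 3%:R)).
    have e : b' = witt_map f (u 3%:R) by rewrite -hu.
    apply: wx_inj => l hl; rewrite wx_map mixE //; case: ifP => hlk.
      by rewrite -hbb // hy wx_map.
    by rewrite e wx_map.
  rewrite hx' hy' [in LHS]hx [in LHS]hy -!witt_map_add !wx_map -!rmorphD -!rmorphB.
  congr (f _); apply: tf_case => // l hl; have hln := ltn_trans hl hk;
  by rewrite mixE // hl.
move=> tf {a b a' b' k} a b a' b'; elim/ltn_ind => k ih hk ha hb.
have low l : (l < k)%N -> wx (witt_add p a b) l = wx (witt_add p a' b') l.
  move=> hl; have hln := ltn_trans hl hk.
  have := ih l hl hln (fun i hi => ha i (ltn_trans hi hl)) (fun i hi => hb i (ltn_trans hi hl)).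
  by rewrite ha // hb // => /addIr.
have sumE (x x' : nat -> U) : (forall l, (l < k)%N -> x l = x' l) ->
   \sum_(l < k) (p ^ l)%:R * x l ^+ (p ^ (k - l)) = \sum_(l < k) (p ^ l)%:R * x' l ^+ (p ^ (k - l)).
  by move=> e; apply: eq_bigr => l _; rewrite e.
have e1 := gh_witt_add a b hk; have e2 := gh_witt_add a' b' hk.
rewrite !gh_recr (sumE _ _ low) (sumE _ _ ha) (sumE _ _ hb) in e1.
rewrite !gh_recr in e2.
set P := (p ^ k)%:R in e1 e2.
apply/eqP; rewrite -subr_eq0; apply/eqP; apply: (tf (p ^ k)%N).
  by rewrite expn_gt0 prime_gt0.
rewrite -/P.
set X := wx _ k in e1 *; set X' := wx _ k in e2 *.
move: e1 e2; set s1 := (\sum_(l < k) _); set s2 := (\sum_(l < k) _); set s3 := (\sum_(l < k) _).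
move=> /eqP e1 /eqP e2; apply/eqP.
move: e1 e2; rewrite -![_ + P * X == _]subr_eq0 -![_ + P * X' == _]subr_eq0.
move=> /eqP e1 /eqP e2; apply/eqP; rewrite -[RHS](subrr 0) -{1}e1 -e2; ring.
Qed.

Lemma witt_add_lt (R : comNzRingType) (a b : witt n R) k :
  (forall l, (l < k)%N -> wx b l = 0) ->
  forall l, (l < k)%N -> wx (witt_add p a b) l = wx a l.
Proof.
move=> hb l hl; have [hln|hln] := ltnP l n; last first.
  by rewrite /wx insubF // ltnNge hln.
have := @witt_add_low _ a b a (witt0 n R) l hln (fun _ _ => erefl).
rewrite witt_addC (witt_addC a) witt_add0 witt_addC hb //.
rewrite (_ : wx (witt0 n R) l = 0); last by rewrite /wx; case: insub => [j|]; rewrite ?ffunE.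
move=> h; apply: (addIr (- (wx a l + 0))); apply: h => i hi.
rewrite hb ?(ltn_trans hi) //.
by rewrite /wx; case: insub => [j|]; rewrite ?ffunE.
Qed.

Lemma witt_add_lead (R : comNzRingType) (a b : witt n R) k : (k < n)%N ->
  (forall l, (l < k)%N -> wx b l = 0) ->
  wx (witt_add p a b) k = wx a k + wx b k.
Proof.
move=> hk hb.
have w0 l : wx (witt0 n R) l = 0 by rewrite /wx; case: insub => [j|]; rewrite ?ffunE.
have := @witt_add_low _ a b a (witt0 n R) k hk (fun _ _ => erefl).
rewrite (witt_addC a (witt0 n R)) witt_add0 w0 addr0 subrr => /(_ _)/eqP.
rewrite subr_eq0 => h; apply/eqP; apply: h => l hl.
by rewrite hb // w0.
Qed.

(** For [p = 2] the opposite is not taken coordinatewise, so it is built by successive correction: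
    changing coordinate [k] by the error there leaves the earlier coordinates of the sum alone. The
    boolean equality is what [xchoose] asks for. *)
Lemma witt_opp_exists (R : comNzRingType) (a : witt n R) :
  exists b, witt_add p b a == witt0 n R.
Proof.
have w0 l : wx (witt0 n R) l = 0 by rewrite /wx; case: insub => [j|]; rewrite ?ffunE.
suff [b hb] : exists b : witt n R, forall l, (l < n)%N -> wx (witt_add p b a) l = 0.
  by exists b; apply/eqP/wx_inj => l hl; rewrite hb // w0.
suff H k : (k <= n)%N ->
    exists b : witt n R, forall l, (l < k)%N -> wx (witt_add p b a) l = 0 by exact: H.
elim: k => [|k ih] hk; first by exists a.
have [b hb] := ih (ltnW hk).
pose b' : witt n R := [ffun i : 'I_n =>
  if i == k :> nat then wx b k - wx (witt_add p b a) k else wx b i].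
have b'E l : (l < n)%N -> wx b' l = if l == k then wx b k - wx (witt_add p b a) k else wx b l.
  by move=> hl; rewrite (wx_ffun (fun i =>
    if i == k then wx b k - wx (witt_add p b a) k else wx b i)).
have bb' l : (l < n)%N -> l != k -> wx b' l = wx b l.
  by move=> hl /negbTE lk; rewrite b'E // lk.
exists b' => l; rewrite ltnS leq_eqVlt => /orP[/eqP ->|hl].
  have := @witt_add_low _ b' a b a k hk _ (fun _ _ => erefl).
  rewrite (b'E k) // eqxx.
  have h i : (i < k)%N -> wx b' i = wx b i.
    by move=> ik; apply: bb'; [apply: ltn_trans hk | rewrite ltn_eqF].
  move=> /(_ h) /eqP; rewrite subr_eq => /eqP ->; ring.
have hln := ltn_trans hl hk.
have h i : (i < l)%N -> wx b' i = wx b i.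
  by move=> il; apply: bb'; [apply: ltn_trans hln | rewrite ltn_eqF // (ltn_trans il)].
have := @witt_add_low _ b' a b a l hln h (fun _ _ => erefl).
by rewrite bb' // ?ltn_eqF // hb // => /addIr.
Qed.

End WittAdd.

Lemma wx0 n (R : comNzRingType) k : wx (witt0 n R) k = 0.
Proof. by rewrite /wx; case: insub => [j|]; rewrite ?ffunE. Qed.

(* The group laws need [p] to be prime, hence the proof carried by the type. *)
Definition wittv (p : nat) (pr_p : prime p) (n : nat) (R : comNzRingType) : Type := witt n R.

Section WittGroup.
Variables (p : nat) (pr_p : prime p) (n : nat) (R : comNzRingType).
Local Notation W := (wittv pr_p n R).

HB.instance Definition _ := Choice.copy W (witt n R).

Definition witt_opp (a : W) : W := xchoose (witt_opp_exists pr_p a).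

Lemma witt_addN : left_inverse (witt0 n R : W) witt_opp (@witt_add p n R).
Proof. by move=> a; apply/eqP/(xchooseP (witt_opp_exists pr_p a)). Qed.

HB.instance Definition _ := GRing.isZmodule.Build W
  (@witt_addA p n pr_p R) (@witt_addC p n pr_p R) (@witt_add0 p n pr_p R) witt_addN.
End WittGroup.

Section WittGroupTheory.
Variables (p : nat) (pr_p : prime p) (n : nat).
Local Notation W R := (wittv pr_p n R).

Lemma wxW_inj (R : comNzRingType) (a b : W R) :
  (forall k, (k < n)%N -> wx a k = wx b k) -> a = b.
Proof. exact: wx_inj. Qed.

Lemma wx_ge (R : comNzRingType) (a : W R) k : (n <= k)%N -> wx a k = 0.
Proof. by move=> h; rewrite /wx insubF // ltnNge h. Qed.

Lemma wx0W (R : comNzRingType) k : wx (0 : W R) k = 0.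
Proof. exact: wx0. Qed.

Definition low (R : comNzRingType) k (a : W R) := forall l, (l < k)%N -> wx a l = 0.

Lemma wxD_lt (R : comNzRingType) k (a b : W R) l :
  low k b -> (l < k)%N -> wx (a + b) l = wx a l.
Proof. by move=> h; apply: witt_add_lt. Qed.

Lemma wxD_lead (R : comNzRingType) k (a b : W R) :
  low k b -> wx (a + b) k = wx a k + wx b k.
Proof.
have [hk|hk] := ltnP k n; last by rewrite !wx_ge // addr0.
by move=> h; apply: witt_add_lead.
Qed.

Lemma wxB_lt (R : comNzRingType) k (a b : W R) l :
  low k b -> (l < k)%N -> wx (a - b) l = wx a l.
Proof. by move=> h hl; rewrite -(wxD_lt (a - b) h hl) subrK. Qed.

Lemma wxB_lead (R : comNzRingType) k (a b : W R) :
  low k b -> wx (a - b) k = wx a k - wx b k.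
Proof. by move=> h; rewrite -{2}[a](subrK b) (wxD_lead _ h) addrK. Qed.

Lemma lowD (R : comNzRingType) k (a b : W R) : low k a -> low k b -> low k (a + b).
Proof. by move=> ha hb l hl; rewrite (wxD_lt _ hb) // ha. Qed.

Lemma low0 (R : comNzRingType) k : low k (0 : W R).
Proof. by move=> l _; apply: wx0W. Qed.

Lemma wx_sum_lead (R : comNzRingType) (I : Type) (s : seq I) (P : pred I)
    (F : I -> W R) k : (forall i, P i -> low k (F i)) ->
  low k (\sum_(i <- s | P i) F i) /\
  wx (\sum_(i <- s | P i) F i) k = \sum_(i <- s | P i) wx (F i) k.
Proof.
move=> h; apply: (big_ind2 (fun (a : W R) x => low k a /\ wx a k = x)).
- by split; [apply: low0 | apply: wx0W].
- move=> a x b y [la <-] [lb <-]; split; first exact: lowD.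
  exact: wxD_lead.
- by move=> i Pi; split=> //; apply: h.
Qed.

Definition wmap (R S : comNzRingType) (f : {rmorphism R -> S}) (a : W R) : W S := witt_map f a.

Lemma wx_wmap (R S : comNzRingType) (f : {rmorphism R -> S}) (a : W R) k :
  wx (wmap f a) k = f (wx a k).
Proof. exact: wx_map. Qed.

Lemma wmap_nmod (R S : comNzRingType) (f : {rmorphism R -> S}) : nmod_morphism (wmap f).
Proof.
split; first by apply: wxW_inj => k _; rewrite wx_wmap !wx0W rmorph0.
by move=> a b; apply: witt_map_add.
Qed.
HB.instance Definition _ (R S : comNzRingType) (f : {rmorphism R -> S}) :=
  GRing.isNmodMorphism.Build (W R) (W S) (wmap f) (wmap_nmod f).

Definition wF (R : comNzRingType) (chR : p \in [pchar R]) (a : W R) : W R := wittF p a.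

Lemma wx_wF (R : comNzRingType) (chR : p \in [pchar R]) (a : W R) k :
  wx (wF chR a) k = wx a k ^+ p.
Proof.
rewrite /wx; case: insub => [i|]; rewrite ?ffunE //.
by rewrite expr0n gtn_eqF ?prime_gt0.
Qed.

Lemma wF_nmod (R : comNzRingType) (chR : p \in [pchar R]) : nmod_morphism (wF chR).
Proof.
suff e a : wF chR a = wmap (pFrobenius_aut chR) a.
  by split=> [|a b]; rewrite !e ?raddf0 ?raddfD.
by apply: wxW_inj => k _; rewrite wx_wF.
Qed.
HB.instance Definition _ (R : comNzRingType) (chR : p \in [pchar R]) :=
  GRing.isNmodMorphism.Build (W R) (W R) (wF chR) (wF_nmod chR).

Lemma wx_iter_wF (R : comNzRingType) (chR : p \in [pchar R]) j (a : W R) k :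
  wx (iter j (wF chR) a) k = wx a k ^+ (p ^ j).
Proof.
elim: j => [|j ih]; first by rewrite /= expn0 expr1.
by rewrite iterS wx_wF ih -exprM -expnSr.
Qed.

Lemma iter_wFD (R : comNzRingType) (chR : p \in [pchar R]) j :
  {morph iter j (wF chR) : a b / a + b}.
Proof. by elim: j => [|j ih] a b //; rewrite !iterS ih raddfD. Qed.

Lemma iter_wF0 (R : comNzRingType) (chR : p \in [pchar R]) j : iter j (wF chR) 0 = 0.
Proof. by elim: j => [|j ih] //; rewrite iterS ih raddf0. Qed.

(** Product with the Teichmueller vector of [r], written in coordinates. *)
Definition wscale (R : comNzRingType) (r : R) (a : W R) : W R :=
  [ffun k : 'I_n => r ^+ (p ^ k) * wx a k].

Lemma wx_wscale (R : comNzRingType) (r : R) (a : W R) k :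
  wx (wscale r a) k = r ^+ (p ^ k) * wx a k.
Proof.
have [hk|hk] := ltnP k n; last by rewrite !wx_ge // mulr0.
by rewrite (wx_ffun (fun k => r ^+ (p ^ k) * wx a k)).
Qed.

Lemma gh_wscale (R : comNzRingType) (r : R) (a : W R) i :
  gh p (wx (wscale r a)) i = r ^+ (p ^ i) * gh p (wx a) i.
Proof.
rewrite mulr_sumr; apply: eq_bigr => k _; rewrite wx_wscale exprMn -exprM -expnD.
by rewrite subnKC; [ring | rewrite -ltnS].
Qed.

Lemma ghD (R : comNzRingType) (a b : W R) i : (i < n)%N ->
  gh p (wx (a + b)) i = gh p (wx a) i + gh p (wx b) i.
Proof. exact: gh_witt_add. Qed.

Lemma wscaleD (R : comNzRingType) (r : R) : {morph wscale r : a b / a + b}.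
Proof.
move=> a b.
have [U [f [a' [s' [tf ha hs]]]]] :=
  @witt_universal n R 2 (fun c : 'I_2 => if c == 0 then a else b) (fun=> r).
have -> : a = wmap f (a' 0) by rewrite /wmap -ha.
have -> : b = wmap f (a' 1) by rewrite /wmap -ha.
have sc (c : W U) : wscale r (wmap f c) = wmap f (wscale (s' 0) c).
  by apply: wxW_inj => k _; rewrite wx_wscale !wx_wmap wx_wscale rmorphM rmorphXn -hs.
rewrite -(raddfD (wmap f)) !sc -(raddfD (wmap f)); congr wmap.
apply: (@gh_inj p n pr_p) => // i hi.
by rewrite gh_wscale !ghD // !gh_wscale mulrDr.
Qed.

(** The vector [V^k [y]], where [V] is Verschiebung and [[y]] the Teichmueller vector. *)
Definition wdelta (R : comNzRingType) (k : nat) (y : R) : W R :=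
  [ffun i : 'I_n => if i == k :> nat then y else 0].

Lemma wx_wdelta (R : comNzRingType) k (y : R) l :
  wx (wdelta k y) l = if (l == k) && (l < n)%N then y else 0.
Proof.
have [hl|hl] := ltnP l n; last by rewrite wx_ge // andbF.
by rewrite (wx_ffun (fun i => if i == k then y else 0)) // andbT.
Qed.

Lemma low_wdelta (R : comNzRingType) k (y : R) : low k (wdelta k y).
Proof. by move=> l hl; rewrite wx_wdelta ltn_eqF. Qed.

Lemma wF_wdelta (R : comNzRingType) (chR : p \in [pchar R]) k (y : R) :
  wF chR (wdelta k y) = wdelta k (y ^+ p).
Proof.
apply: wxW_inj => l _; rewrite wx_wF !wx_wdelta; case: ifP => // _.
by rewrite expr0n gtn_eqF ?prime_gt0.
Qed.

Lemma wmap_wdelta (R S : comNzRingType) (f : {rmorphism R -> S}) k (y : R) :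
  wmap f (wdelta k y) = wdelta k (f y).
Proof.
by apply: wxW_inj => l _; rewrite wx_wmap !wx_wdelta; case: ifP; rewrite ?rmorph0.
Qed.

Lemma gh_low (R : comNzRingType) (a : W R) k i : low k a ->
  gh p (wx a) i = \sum_(l < i.+1 | (k <= l)%N) (p ^ l)%:R * wx a l ^+ (p ^ (i - l)).
Proof.
move=> ha; rewrite [RHS]big_mkcond; apply: eq_bigr => l _.
case: leqP => // hl; rewrite ha // expr0n gtn_eqF ?mulr0 //.
by rewrite expn_gt0 prime_gt0.
Qed.

Lemma gh_wdelta (R : comNzRingType) k (y : R) i : (k < n)%N -> 
  gh p (wx (wdelta k y)) i = if (k <= i)%N then (p ^ k)%:R * y ^+ (p ^ (i - k)) else 0.
Proof.
move=> hk; rewrite /gh.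
have z l : l != k -> (p ^ l)%:R * wx (wdelta k y) l ^+ (p ^ (i - l)) = 0.
  move=> /negbTE hl; rewrite wx_wdelta hl /= expr0n gtn_eqF ?mulr0 //.
  by rewrite expn_gt0 prime_gt0.
case: leqP => hi; last first.
  by rewrite big1 // => l _; apply: z; have := ltn_ord l; rewrite ltnS; lia.
have hi' : (k < i.+1)%N by [].
rewrite (bigD1 (Ordinal hi')) //= big1 ?addr0; last first.
  by move=> l hl; apply: z.
by rewrite wx_wdelta eqxx hk.
Qed.

Lemma exprD_linear (R : comNzRingType) (y h : R) N :
  exists w, (y + h) ^+ N = y ^+ N + (y ^+ N.-1 *+ N) * h + h ^+ 2 * w.
Proof.
elim: N => [|N [w hw]]; first by exists 0; rewrite !expr0 mulr0n; ring.
exists (w * y + w * h + y ^+ N.-1 *+ N); rewrite exprS hw /=.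
have e : y * (y ^+ N.-1 *+ N) = y ^+ N *+ N.
  by case: N {hw} => [|N]; rewrite ?mulr0n ?mulr0 // mulrnAr exprS.
rewrite [y ^+ N.+1]exprS mulrSr; move: e; clear hw.
move: (y ^+ N *+ N) (y ^+ N.-1 *+ N) (y ^+ N) => B A Y <-; ring.
Qed.

Lemma poly_torsion_free (T : comNzRingType) : torsion_free T -> torsion_free {poly T}.
Proof.
move=> tf d x d0 h; apply/polyP => i; rewrite coef0; apply: (tf d) => //.
by move/(congr1 (fun q : {poly T} => q`_i)): h; rewrite coef0 mulr_natl coefMn mulr_natl.
Qed.

Lemma coefE01 (T : comNzRingType) (q : {poly T}) :
  q`_0 = 0 -> q = 'X * ((q`_1)%:P + 'X * drop_poly 2 q).
Proof.
move=> q0; rewrite -{1}(poly_take_drop 2 q) mulrDr mulrA -expr2 ['X^2 * _]mulrC.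
congr (_ + _); apply/polyP => i; rewrite coef_take_poly coefXM coefC.
by case: i => [|[|i]].
Qed.

(* The increment of a Teichmueller vector, to first order in [h]: only the linear term
   [p ^ l * y ^ (p ^ l - 1) * h] of the ghost components survives modulo [h ^ 2]. *)
Lemma wdelta_linear (R : comNzRingType) k (y h : R) : (k < n)%N ->
  exists g, forall l, (l < n)%N -> (k <= l)%N ->
    wx (wdelta k (y + h) - wdelta k y) l = h * (y ^+ (p ^ (l - k)).-1 + h * g l).
Proof.
move=> hk.
have [T [f [_ [s' [tf _ hs]]]]] :=
  @witt_universal n R 1 (fun=> witt0 n R) (fun=> y).
have fy : f (s' 0) = y by rewrite -hs.
set y' := s' 0 in fy.
have tfP := poly_torsion_free tf.
(* With the variable ['X] as increment over a torsion-free ring, the first order term is a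
   coefficient, and the factor [p ^ l] of the ghost components can be cancelled. *)
pose e : W {poly T} := wdelta k (y'%:P + 'X) - wdelta k y'%:P.
have le : low k e.
  by move=> l hl; rewrite (wxB_lt _ (@low_wdelta _ k _)) // low_wdelta.
have ghe i : (i < n)%N -> (k <= i)%N ->
    gh p (wx e) i = (p ^ k)%:R * ((y'%:P + 'X) ^+ (p ^ (i - k)) - y'%:P ^+ (p ^ (i - k))).
  move=> hi ki; apply: (@addIr _ (gh p (wx (wdelta k y'%:P)) i)).
  by rewrite -ghD // subrK !gh_wdelta // ki -mulrDr subrK.
have ecoef l : (l < n)%N -> (k <= l)%N ->
    (wx e l)`_0 = 0 /\ (wx e l)`_1 = y' ^+ (p ^ (l - k)).-1.
  elim/ltn_ind: l => l ih hl kl.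
  have := ghe l hl kl; rewrite gh_recr.
  have [w ->] := exprD_linear y'%:P 'X (p ^ (l - k)).
  (* Each earlier coordinate is divisible by ['X] and is raised to a power [p ^ (l - i)] at least 2,
     so the earlier coordinates do not reach the linear coefficient. *)
  have -> : \sum_(i < l) (p ^ i)%:R * wx e i ^+ (p ^ (l - i)) =
     'X^2 * \sum_(i < l) (p ^ i)%:R * ('X ^+ (p ^ (l - i) - 2) *
         (((wx e i)`_1)%:P + 'X * drop_poly 2 (wx e i)) ^+ (p ^ (l - i))).
    rewrite mulr_sumr; apply: eq_bigr => i _.
    have c0 : (wx e i)`_0 = 0.
      have [hik|hik] := ltnP i k; first by rewrite le // coef0.
      by case: (ih i (ltn_ord i) (ltn_trans (ltn_ord i) hl) hik).
    rewrite {1}(coefE01 c0) exprMn [in RHS]mulrCA; congr (_ * _); rewrite mulrA -exprD subnKC //.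
    apply: leq_trans (prime_gt1 pr_p) _; rewrite -{1}[p]expn1.
    by apply: leq_pexp2l; [apply: prime_gt0 | rewrite subn_gt0].
  set Z := \sum_(i < l) _; move=> hE.
  have {hE}hE : (p ^ l)%:R * (wx e l - (y' ^+ (p ^ (l - k)).-1)%:P * 'X)
                = 'X^2 * ((p ^ k)%:R * w - Z).
    rewrite mulrBr; apply: (@addrI _ ('X^2 * Z)); rewrite addrA hE.
    rewrite polyC_exp -[_ *+ (p ^ (l - k))]mulr_natr.
    have -> : (p ^ l)%:R = (p ^ k)%:R * (p ^ (l - k))%:R :> {poly T}.
      by rewrite -natrM -expnD subnKC.
    move: (y'%:P ^+ (p ^ (l - k))) (y'%:P ^+ (p ^ (l - k)).-1) => Y Y1.
    by move: (p ^ k)%:R (p ^ (l - k))%:R => P P1; ring.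
  have C i : (i < 2)%N -> (wx e l)`_i = ((y' ^+ (p ^ (l - k)).-1)%:P)`_i.-1 *+ (i == 1)%N.
    move=> hi; apply/eqP; rewrite -subr_eq0; apply/eqP; apply: (tf (p ^ l)%N).
      by rewrite expn_gt0 prime_gt0.
    have := congr1 (fun q : {poly T} => q`_i) hE.
    rewrite coefXnM hi mulr_natl coefMn coefB coefMX mulr_natl => h0.
    by rewrite -[RHS]h0; case: i hi {h0} => [|[|]].
  by split; rewrite C // coefC.
pose ev : {rmorphism {poly T} -> R} := horner_eval h \o map_poly f.
have evC c : ev c%:P = f c by rewrite /= map_polyC horner_evalE hornerC.
have evX : ev 'X = h by rewrite /= map_polyX horner_evalE hornerX.
exists (fun l => ev (drop_poly 2 (wx e l))) => l hl lk.
have -> : wdelta k (y + h) - wdelta k y = wmap ev e.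
  by rewrite raddfB /= !wmap_wdelta rmorphD !evC evX fy.
have [c0 c1] := ecoef l hl lk; rewrite wx_wmap.
by rewrite {1}(coefE01 c0) rmorphM rmorphD rmorphM !evX !evC c1 rmorphXn /= fy.
Qed.

Lemma low_wdeltaB (R : comNzRingType) k (x y : R) : low k (wdelta k x - wdelta k y).
Proof. by move=> l hl; rewrite (wxB_lt _ (@low_wdelta _ k _)) // low_wdelta. Qed.

(** The difference is [V^k] of [[x] - [y]], whose coordinate of index [l - k] is homogeneous of
    degree [p ^ (l - k)] in [x] and [y]. The rescaled vector [E] is recognised by its ghost
    components. *)
Lemma wdeltaB_homog (R : comNzRingType) k (x y r : R) l : (k < n)%N -> (k <= l)%N ->
  wx (wdelta k (r * x) - wdelta k (r * y)) l =
  r ^+ (p ^ (l - k)) * wx (wdelta k x - wdelta k y) l.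
Proof.
move=> hk kl; have [hl|hl] := ltnP l n; last by rewrite !wx_ge // mulr0.
have [U [f [_ [s' [tf _ hs]]]]] := @witt_universal n R 3 (fun=> witt0 n R)
  (fun c : 'I_3 => if c == 0 then x else if c == 1 then y else r).
have -> : x = f (s' 0) by rewrite -hs.
have -> : y = f (s' 1) by rewrite -hs.
have -> : r = f (s' 2%:R) by rewrite -hs.
rewrite -!(rmorphM f) -!(wmap_wdelta f) -!(raddfB (wmap f)) !(wx_wmap f) -(rmorphXn f) -(rmorphM f).
congr (f _).
move: (s' 0) (s' 1) (s' 2%:R) => x' y' r'.
pose e := wdelta k x' - wdelta k y'; rewrite -/e.
have le : low k e := low_wdeltaB _ _.
pose E : W U := [ffun l : 'I_n => r' ^+ (p ^ (l - k)) * wx e l].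
have wE i : (i < n)%N -> wx E i = r' ^+ (p ^ (i - k)) * wx e i.
  by move=> hi; rewrite (wx_ffun (fun l => r' ^+ (p ^ (l - k)) * wx e l)).
have lE : low k E.
  move=> i hi; have [hin|hin] := ltnP i n; last by rewrite wx_ge.
  by rewrite wE // le // mulr0.
suff -> : wdelta k (r' * x') - wdelta k (r' * y') = E by rewrite wE.
apply/eqP; rewrite subr_eq addrC; apply/eqP.
apply: (@gh_inj p n pr_p) => // i hi; rewrite ghD // !gh_wdelta //.
have -> : gh p (wx E) i = r' ^+ (p ^ (i - k)) * gh p (wx e) i.
  rewrite (gh_low _ lE) (gh_low _ le) mulr_sumr; apply: eq_bigr => j kj.
  have li : (j <= i)%N by rewrite -ltnS.
  rewrite wE; last exact: leq_ltn_trans hi.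
  rewrite exprMn -exprM -expnD (_ : j - k + (i - j) = i - k)%N; last by lia.
  by ring.
case: leqP => ki; last first.
  rewrite (gh_low _ le) big_pred0 ?mulr0 ?addr0 // => j.
  by apply/negbTE; rewrite -ltnNge (leq_ltn_trans _ ki) // -ltnS.
have -> : gh p (wx e) i = gh p (wx (wdelta k x')) i - gh p (wx (wdelta k y')) i.
  by apply: (addIr (gh p (wx (wdelta k y')) i)); rewrite -ghD // !subrK.
rewrite !gh_wdelta // ki.
rewrite !exprMn; move: (r' ^+ _) (x' ^+ _) (y' ^+ _) => A B C; ring.
Qed.

End WittGroupTheory.

(** * Discrete valuations and the filtration *)

Section Valuation.
Variables (L : fieldType) (v : L -> int).
Hypothesis Hv : is_ndval v.
Implicit Types (x y : L) (c d : int).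

Definition vge c x := (x == 0) || (c <= v x).

Lemma vM x y : x != 0 -> y != 0 -> v (x * y) = v x + v y.
Proof. by case: Hv => _ h _; apply: h. Qed.

Lemma v1 : v 1 = 0.
Proof. by have := @vM 1 1 (oner_neq0 _) (oner_neq0 _); rewrite mulr1; lia. Qed.

Lemma vN x : v (- x) = v x.
Proof.
have [->|x0] := eqVneq x 0; first by rewrite oppr0.
have n1 : (-1 : L) != 0 by rewrite oppr_eq0 oner_eq0.
rewrite -mulN1r vM //; suff -> : v (-1) = 0 by rewrite add0r.
by have := vM n1 n1; rewrite mulrNN mulr1 v1; lia.
Qed.

Lemma vV x : x != 0 -> v x^-1 = - v x.
Proof.
move=> x0; have := @vM x x^-1 x0; rewrite invr_eq0 divff // v1 => /(_ x0); lia.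
Qed.

Lemma vX x n : x != 0 -> v (x ^+ n) = n%:Z * v x.
Proof.
move=> x0; elim: n => [|n ih]; first by rewrite expr0 v1; lia.
by rewrite exprS vM ?expf_neq0 // ih; lia.
Qed.

Lemma vge0 c : vge c 0.
Proof. by rewrite /vge eqxx. Qed.

Lemma vgeE c x : x != 0 -> vge c x = (c <= v x).
Proof. by rewrite /vge => /negbTE ->. Qed.

Lemma vge_le c d x : d <= c -> vge c x -> vge d x.
Proof. by move=> dc /orP[/eqP ->|h]; rewrite /vge ?eqxx // (le_trans dc h) orbT. Qed.

Lemma vgeD c x y : vge c x -> vge c y -> vge c (x + y).
Proof.
have [->|x0] := eqVneq x 0; first by rewrite add0r.
have [->|y0] := eqVneq y 0; first by rewrite addr0.
have [->|s0] := eqVneq (x + y) 0; first by rewrite vge0.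
rewrite !vgeE //; case: Hv => _ _ /(_ x y x0 y0 s0) h hx hy.
by apply: le_trans h; rewrite le_min hx hy.
Qed.

Lemma vgeN c x : vge c (- x) = vge c x.
Proof. by rewrite /vge oppr_eq0 vN. Qed.

Lemma vgeB c x y : vge c x -> vge c y -> vge c (x - y).
Proof. by move=> hx hy; apply: vgeD; rewrite ?vgeN. Qed.

Lemma vgeM c d x y : vge c x -> vge d y -> vge (c + d) (x * y).
Proof.
have [->|x0] := eqVneq x 0; first by rewrite mul0r !vge0.
have [->|y0] := eqVneq y 0; first by rewrite mulr0 !vge0.
rewrite !vgeE ?mulf_neq0 // vM //; lia.
Qed.

Lemma vge_sum c (I : Type) (s : seq I) (P : pred I) (F : I -> L) :
  (forall i, P i -> vge c (F i)) -> vge c (\sum_(i <- s | P i) F i).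
Proof.
move=> h; elim/big_rec: _ => [|i x Pi hx]; first exact: vge0.
by apply: vgeD => //; apply: h.
Qed.

Lemma vgeX c x n : vge c x -> vge (n%:Z * c) (x ^+ n).
Proof.
have [->|x0] := eqVneq x 0 => h.
  case: n => [|n]; last by rewrite expr0n /= vge0.
  by rewrite expr0 mul0r vgeE ?oner_eq0 // v1.
by rewrite vgeE ?expf_neq0 // vX //; rewrite vgeE // in h; nia.
Qed.

Lemma inOE x : inO v x = vge 0 x. Proof. by []. Qed.
Lemma inME x : inM v x = vge 1 x. Proof. by []. Qed.

Lemma inM_inO x : inM v x -> inO v x.
Proof. by rewrite inOE inME; apply: vge_le. Qed.

Lemma inO0 : inO v 0. Proof. by rewrite inOE vge0. Qed.
Lemma inM0 : inM v 0. Proof. by rewrite inME vge0. Qed.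
Lemma inO1 : inO v 1. Proof. by rewrite inOE vgeE ?oner_eq0 // v1. Qed.
Lemma inM1 : ~~ inM v 1. Proof. by rewrite inME vgeE ?oner_eq0 // v1. Qed.
Lemma inOD x y : inO v x -> inO v y -> inO v (x + y). Proof. by rewrite !inOE ?inME; apply: vgeD. Qed.
Lemma inOB x y : inO v x -> inO v y -> inO v (x - y). Proof. by rewrite !inOE ?inME; apply: vgeB. Qed.
Lemma inMD x y : inM v x -> inM v y -> inM v (x + y). Proof. by rewrite !inME; apply: vgeD. Qed.
Lemma inMB x y : inM v x -> inM v y -> inM v (x - y). Proof. by rewrite !inME; apply: vgeB. Qed.
Lemma inOM x y : inO v x -> inO v y -> inO v (x * y). Proof. by rewrite !inOE; apply: vgeM. Qed.
Lemma inOX x n : inO v x -> inO v (x ^+ n).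
Proof. by rewrite !inOE => /(vgeX n); rewrite mulr0. Qed.
Lemma inO_expE x n : (0 < n)%N -> inO v (x ^+ n) = inO v x.
Proof.
move=> n0; have [->|x0] := eqVneq x 0; first by rewrite expr0n gtn_eqF.
by rewrite !inOE !vgeE ?expf_neq0 // vX // pmulr_rge0.
Qed.
Lemma inMMr x y : inO v x -> inM v y -> inM v (x * y). Proof. by rewrite inOE !inME; apply: vgeM. Qed.
Lemma inMMl x y : inM v x -> inO v y -> inM v (x * y). Proof. by rewrite inOE !inME; apply: vgeM. Qed.
Lemma inO_sum (I : Type) (s : seq I) (P : pred I) (F : I -> L) :
  (forall i, P i -> inO v (F i)) -> inO v (\sum_(i <- s | P i) F i).
Proof. by rewrite inOE => h; apply: vge_sum. Qed.
Lemma inO_unit x : inO v x -> ~~ inM v x -> x != 0 /\ v x = 0.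
Proof.
have [->|x0] := eqVneq x 0; first by rewrite inM0.
by rewrite inOE inME !vgeE //; split=> //; lia.
Qed.

End Valuation.

(** * Valuation ring and residue field *)

Definition Opred (L : fieldType) (v : L -> int) (Hv : is_ndval v) : {pred L} :=
  fun x => inO v x.

Section ValuationRing.
Variables (L : fieldType) (v : L -> int) (Hv : is_ndval v).

Fact Opred_subring : subring_closed (Opred Hv).
Proof.
split; first exact: inO1; last by move=> x y; apply: inOM.
by move=> x y; apply: inOB.
Qed.
HB.instance Definition _ := GRing.isSubringClosed.Build L (Opred Hv) Opred_subring.

Record vring := VRing { vval : L; _ : vval \in Opred Hv }.
HB.instance Definition _ := [isSub for vval].
HB.instance Definition _ := [Choice of vring by <:].
HB.instance Definition _ := [SubChoice_isSubComNzRing of vring by <:].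

Definition vvalm : {rmorphism vring -> L} := (\val : vring -> L).

Definition vmax : {pred vring} := fun x => inM v (vval x).

Fact vmax_ideal : idealr_closed vmax.
Proof.
split; first exact: inM0; first exact: inM1.
move=> a x y hx hy; rewrite /vmax unfold_in.
rewrite -[vval _]/(vvalm (a * x + y)) rmorphD rmorphM.
by apply: inMD => //; apply: inMMr => //; case: a.
Qed.

HB.instance Definition _ := isIdealr.Build vring vmax vmax_ideal.

Definition resfield := {ideal_quot vmax}.
HB.instance Definition _ := GRing.ComNzRing.on resfield.

Definition rho (x : vring) : resfield := \pi_({ideal_quot vmax})%qT x.

Fact rho_zmod : zmod_morphism rho.
Proof. exact: (rmorphB (\pi_({ideal_quot vmax})%qT)). Qed.
Fact rho_monoid : monoid_morphism rho.
Proof.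
split; first exact: (rmorph1 (\pi_({ideal_quot vmax})%qT)).
exact: (rmorphM (\pi_({ideal_quot vmax})%qT)).
Qed.
HB.instance Definition _ := GRing.isZmodMorphism.Build vring resfield rho rho_zmod.
HB.instance Definition _ := GRing.isMonoidMorphism.Build vring resfield rho rho_monoid.

Lemma rho_eq0 x : (rho x == 0) = inM v (vval x).
Proof.
rewrite -(rmorph0 rho) /rho.
by rewrite -(Quotient.idealrBE vmax) subr0.
Qed.

Lemma rho_surj (a : resfield) : exists x, rho x = a.
Proof. by exists (repr (a : {ideal_quot vmax})); rewrite /rho reprK. Qed.

Definition rinv (a : resfield) : resfield :=
  if a == 0 then 0 else rho (insubd 0 (vval (repr (a : {ideal_quot vmax})))^-1).

Fact rinv_mul a : a != 0 -> rinv a * a = 1.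
Proof.
move=> a0; rewrite /rinv (negbTE a0); set x := repr _.
have ax : a = rho x by rewrite /rho /x reprK.
have xM : ~~ inM v (vval x) by rewrite -rho_eq0 -ax.
have xO : inO v (vval x) by case: (x).
have [x0 vx0] := inO_unit xO xM.
have VO : (vval x)^-1 \in Opred Hv.
  by rewrite unfold_in /Opred inOE vgeE ?invr_eq0 // (vV Hv) // vx0.
rewrite [X in _ * X]ax -rmorphM -(rmorph1 rho); congr rho; apply: val_inj.
by rewrite (rmorphM vvalm) (rmorph1 vvalm) /vvalm /= (insubdK _ VO) mulVf.
Qed.

Fact rinv0 : rinv 0 = 0. Proof. by rewrite /rinv eqxx. Qed.

HB.instance Definition _ := GRing.ComNzRing_isField.Build resfield rinv_mul rinv0.

(** Total on [L], with default value 0 outside the valuation ring; the rules for sums and products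
    therefore ask for integrality. *)
Definition res (x : L) : resfield := if insub x is Some y then rho y else 0.

Lemma resE (x : L) (xO : x \in Opred Hv) : res x = rho (VRing xO).
Proof. by rewrite /res insubT. Qed.

Lemma res_vval (x : vring) : res (vval x) = rho x.
Proof. by rewrite /res valK. Qed.

Lemma resD (x y : L) : inO v x -> inO v y -> res (x + y) = res x + res y.
Proof.
move=> hx hy; have hs := inOD Hv hx hy.
rewrite (resE hx) (resE hy) (resE hs) -rmorphD; congr rho; exact: val_inj.
Qed.

Lemma resM (x y : L) : inO v x -> inO v y -> res (x * y) = res x * res y.
Proof.
move=> hx hy; have hs := inOM Hv hx hy.
rewrite (resE hx) (resE hy) (resE hs) -rmorphM; congr rho; exact: val_inj.
Qed.

Lemma res0 : res 0 = 0.
Proof. by rewrite (resE (inO0 v)) -(rmorph0 rho); congr rho; apply: val_inj. Qed.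

Lemma res1 : res 1 = 1.
Proof. by rewrite (resE (inO1 Hv)) -(rmorph1 rho); congr rho; apply: val_inj. Qed.

Lemma res_eq0 x : inO v x -> (res x == 0) = inM v x.
Proof. by move=> hx; rewrite (resE hx) rho_eq0. Qed.

Lemma res_inM x : inM v x -> res x = 0.
Proof. by move=> h; apply/eqP; rewrite res_eq0 // inM_inO. Qed.

Lemma resB (x y : L) : inO v x -> inO v y -> res (x - y) = res x - res y.
Proof.
move=> hx hy; apply: (addIr (res y)); rewrite subrK -resD ?subrK //.
exact: inOB.
Qed.

Lemma res_eq x y : inO v x -> inO v y -> (res x == res y) = inM v (x - y).
Proof. by move=> hx hy; rewrite -subr_eq0 -resB // res_eq0 // inOB. Qed.

Lemma resX x m : inO v x -> res (x ^+ m) = res x ^+ m.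
Proof.
move=> hx; elim: m => [|m ih]; first by rewrite !expr0 res1.
by rewrite !exprS resM ?ih // inOX.
Qed.

Lemma res_sum (I : Type) (s : seq I) (P : pred I) (F : I -> L) :
  (forall i, P i -> inO v (F i)) ->
  res (\sum_(i <- s | P i) F i) = \sum_(i <- s | P i) res (F i).
Proof.
move=> h; suff : inO v (\sum_(i <- s | P i) F i) /\
    res (\sum_(i <- s | P i) F i) = \sum_(i <- s | P i) res (F i) by case.
apply: (big_ind2 (fun x y => inO v x /\ res x = y)).
- by rewrite inO0 res0.
- by move=> x _ y _ [hx <-] [hy <-]; rewrite resD // inOD.
- by move=> i Pi; split=> //; apply: h.
Qed.

Lemma res_nat (m : nat) : res m%:R = m%:R.
Proof.
have hO i : inO v i%:R by elim: i => [|i ih]; rewrite ?inO0 // -natr1 inOD ?inO1.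
elim: m => [|m ih]; first by rewrite res0.
by rewrite -!natr1 resD ?ih ?res1 // inO1.
Qed.

Lemma res_surj a : exists2 x, inO v x & res x = a.
Proof. by have [x <-] := rho_surj a; exists (vval x); [case: x | rewrite res_vval]. Qed.

Lemma resfield_pchar p : p \in [pchar L] -> p \in [pchar resfield].
Proof.
move=> /andP[pr_p /eqP p0]; rewrite !inE pr_p -res_nat p0 res0 eqxx //.
Qed.

End ValuationRing.

Section FrobeniusPowers.
Variables (p : nat) (R : comNzRingType).
Hypothesis chR : p \in [pchar R].

Lemma expXpD (x y : R) m : (x + y) ^+ (p ^ m) = x ^+ (p ^ m) + y ^+ (p ^ m).
Proof.
elim: m => [|m ih]; first by rewrite expn0 !expr1.
by rewrite expnSr !exprM ih -!(pFrobenius_autE chR) rmorphD.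
Qed.

Lemma expXpN (x : R) m : (- x) ^+ (p ^ m) = - x ^+ (p ^ m).
Proof.
elim: m => [|m ih]; first by rewrite expn0 !expr1.
by rewrite expnSr !exprM ih -!(pFrobenius_autE chR) rmorphN.
Qed.

Lemma expXpB (x y : R) m : (x - y) ^+ (p ^ m) = x ^+ (p ^ m) - y ^+ (p ^ m).
Proof. by rewrite expXpD expXpN. Qed.

Lemma expXp_sum (I : Type) (s : seq I) (P : pred I) (G : I -> R) m :
  (\sum_(i <- s | P i) G i) ^+ (p ^ m) = \sum_(i <- s | P i) G i ^+ (p ^ m).
Proof.
apply: (big_morph (fun x => x ^+ (p ^ m))) => [x y|]; first exact: expXpD.
by rewrite expr0n gtn_eqF // expn_gt0 prime_gt0 //; case/andP: chR.
Qed.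

End FrobeniusPowers.

Lemma expXp_inj p (F : fieldType) (chF : p \in [pchar F]) m :
  injective (fun x : F => x ^+ (p ^ m)).
Proof.
move=> x y /= h; apply/eqP; rewrite -subr_eq0.
have : (x - y) ^+ (p ^ m) == 0 by rewrite (expXpB chF) h subrr.
by rewrite expf_eq0 => /andP[].
Qed.

(** * The filtration, its symbol and the flat variant *)

Section Filtration.
Variables (p : nat) (pr_p : prime p) (n : nat).
Variables (L : fieldType) (v : L -> int).
Local Notation W := (wittv pr_p n L).
Implicit Types (a b : W) (m : nat).

(* Kato's coordinate [f_j] is the standard coordinate [i = n - 1 - j]. *)
Definition fil m a := forall i, (i < n)%N ->
  (wx a i == 0) || (- m%:Z <= (p ^ (n.-1 - i))%:Z * v (wx a i)).

Lemma wcoordE a j : (j < n)%N -> wcoord (a : witt n L) j = wx a (n.-1 - j).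
Proof. by move=> hj; rewrite /wcoord hj. Qed.

Lemma in_filP m a : reflect (fil m a) (in_fil p v m (a : witt n L)).
Proof.
apply: (iffP forallP) => [h i hi|h j].
  have hj : (n.-1 - i < n)%N by lia.
  have := h (Ordinal hj); rewrite wcoordE //= (_ : n.-1 - (n.-1 - i) = i)%N //; lia.
have hj := ltn_ord j.
have := h (n.-1 - j)%N; rewrite wcoordE // (_ : n.-1 - (n.-1 - j) = j)%N; last by lia.
by apply; lia.
Qed.

Lemma fil_le m m' a : (m <= m')%N -> fil m a -> fil m' a.
Proof. by move=> hm h i hi; have /orP[->//|h'] := h i hi; apply/orP; right; lia. Qed.

Lemma exists_fil a : exists m, fil m a.
Proof.
exists (\max_(i < n) absz ((p ^ (n.-1 - i))%:Z * v (wx a i))%R) => i hi; apply/orP; right.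
have := @leq_bigmax _ (fun i : 'I_n => absz ((p ^ (n.-1 - i))%:Z * v (wx a i))%R) (Ordinal hi).
move: (\max_(_ < _) _)%N => M /=; lia.
Qed.

Hypotheses (Hv : is_ndval v) (chL : p \in [pchar L]).
Variable pi : L.
Hypotheses (pi0 : pi != 0) (vpi : v pi = 1).

(* The coordinates of [F^(n-1) a] relative to the Teichmueller vector of [pi ^ (- m)]; passing
   to [F^(n-1) a] makes all the slopes [m / p ^ j] integral. *)
Definition alpha m a i := wx a i ^+ (p ^ n.-1) * pi ^+ (m * p ^ i).

Lemma alpha_vge m a i (c : int) : (i < n)%N ->
  (wx a i == 0) || ((p ^ i)%:Z * (- m%:Z + c) <= (p ^ i)%:Z * ((p ^ (n.-1 - i))%:Z * v (wx a i)))
  = vge v ((p ^ i)%:Z * c) (alpha m a i).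
Proof.
move=> hi; rewrite /vge /alpha mulf_eq0 !expf_eq0 (negbTE pi0) andbF orbF.
rewrite expn_gt0 prime_gt0 //=; have [//|a0] := eqVneq (wx a i) 0.
rewrite /= (vM Hv) ?expf_neq0 // !(vX Hv) // vpi.
have -> : (p ^ n.-1 = p ^ i * p ^ (n.-1 - i))%N by rewrite -expnD subnKC //; lia.
apply/idP/idP; lia.
Qed.

Lemma fil_alpha m a i : (i < n)%N ->
  (wx a i == 0) || (- m%:Z <= (p ^ (n.-1 - i))%:Z * v (wx a i)) = inO v (alpha m a i).
Proof.
move=> hi; have := @alpha_vge m a i 0 hi; rewrite mulr0 addr0 inOE => <-.
have P0 : (0 < p ^ i)%N by rewrite expn_gt0 prime_gt0.
by congr orb; rewrite ler_pM2l // ltz_nat.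
Qed.

Lemma fil_alpha_lt m a i : (i < n)%N ->
  (wx a i == 0) || (- m%:Z < (p ^ (n.-1 - i))%:Z * v (wx a i)) = inM v (alpha m a i).
Proof.
move=> hi; rewrite inME /vge /alpha mulf_eq0 !expf_eq0 (negbTE pi0) andbF orbF.
rewrite expn_gt0 prime_gt0 //=; have [//|a0] := eqVneq (wx a i) 0.
rewrite /= (vM Hv) ?expf_neq0 // !(vX Hv) // vpi.
have -> : (p ^ n.-1 = p ^ i * p ^ (n.-1 - i))%N by rewrite -expnD subnKC //; lia.
have P0 : (0 < p ^ i)%N by rewrite expn_gt0 prime_gt0.
move: (p ^ i)%N (p ^ (n.-1 - i))%N (v _) P0 => P Q x P0; apply/idP/idP; nia.
Qed.

Definition lifts m a (A : wittv pr_p n (vring Hv)) :=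
  forall i, (i < n)%N -> alpha m a i = vvalm Hv (wx A i).

(** Both sides of this identity are additive in the vectors, which makes [fil m] a subgroup and
    [sym m] additive. *)
Lemma liftsP m a A : lifts m a A <->
  iter n.-1 (wF chL) a = wscale (pi ^- m) (wmap (vvalm Hv) A).
Proof.
have e i : (pi ^- m) ^+ (p ^ i) * pi ^+ (m * p ^ i) = 1.
  by rewrite exprVn -exprM mulVf // expf_neq0.
split=> [h|h i hi].
  apply: wxW_inj => i hi; rewrite wx_iter_wF wx_wscale wx_wmap -h // /alpha.
  by rewrite mulrCA e mulr1.
have := congr1 (fun w : W => wx w i) h; rewrite wx_iter_wF wx_wscale wx_wmap /alpha => ->.
by rewrite mulrAC e mul1r.
Qed.

Lemma fil_lift m a : fil m a -> exists A, lifts m a A.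
Proof.
move=> h; exists [ffun i : 'I_n => insubd 0 (alpha m a i)] => i hi.
rewrite (wx_ffun (fun i => insubd 0 (alpha m a i))) // /vvalm /= insubdK //.
by rewrite -[_ \in _]/(inO v (alpha m a i)) -fil_alpha // h.
Qed.

Lemma lift_fil m a A : lifts m a A -> fil m a.
Proof.
by move=> h i hi; rewrite fil_alpha // h //; case: (wx A i).
Qed.

Lemma liftsD m a b A B : lifts m a A -> lifts m b B -> lifts m (a + b) (A + B).
Proof.
move=> /liftsP ha /liftsP hb; apply/liftsP.
by rewrite iter_wFD ha hb raddfD wscaleD.
Qed.

Lemma lifts0 m : lifts m 0 0.
Proof.
apply/liftsP; rewrite iter_wF0 raddf0; apply: wxW_inj => i _.
by rewrite wx_wscale wx0W mulr0.
Qed.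

Lemma liftsN m a A : lifts m a A -> lifts m (- a) (- A).
Proof.
move=> ha; apply/liftsP; apply: (@addrI _ (iter n.-1 (wF chL) a)).
rewrite -iter_wFD subrr iter_wF0 (liftsP m a A).1 //.
rewrite -wscaleD -(raddfD (wmap (vvalm Hv))) subrr raddf0.
by apply: wxW_inj => i _; rewrite wx_wscale wx0W mulr0.
Qed.

Lemma fil0 m : fil m 0.
Proof. exact: lift_fil (lifts0 m). Qed.

Lemma filD m a b : fil m a -> fil m b -> fil m (a + b).
Proof. by move=> /fil_lift[A hA] /fil_lift[B hB]; apply: lift_fil (liftsD hA hB). Qed.

Lemma filN m a : fil m a -> fil m (- a).
Proof. by move=> /fil_lift[A hA]; apply: lift_fil (liftsN hA). Qed.

Lemma filB m a b : fil m a -> fil m b -> fil m (a - b).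
Proof. by move=> ha hb; apply: filD => //; apply: filN. Qed.

Lemma fil_sum m (I : Type) (s : seq I) (P : pred I) (F : I -> W) :
  (forall i, P i -> fil m (F i)) -> fil m (\sum_(i <- s | P i) F i).
Proof.
move=> h; elim/big_rec: _ => [|i x Pi hx]; first exact: fil0.
by apply: filD => //; apply: h.
Qed.

Definition sym m a : wittv pr_p n (resfield Hv) := [ffun i : 'I_n => res Hv (alpha m a i)].

Lemma wx_sym m a i : (i < n)%N -> wx (sym m a) i = res Hv (alpha m a i).
Proof. by move=> hi; rewrite (wx_ffun (fun i => res Hv (alpha m a i))). Qed.

Lemma sym_lifts m a A : lifts m a A -> sym m a = wmap (@rho L v Hv) A.
Proof.
by move=> h; apply: wxW_inj => i hi; rewrite wx_sym // h // wx_wmap res_vval.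
Qed.

Lemma symD m a b : fil m a -> fil m b -> sym m (a + b) = sym m a + sym m b.
Proof.
move=> /fil_lift[A hA] /fil_lift[B hB].
by rewrite (sym_lifts hA) (sym_lifts hB) (sym_lifts (liftsD hA hB)) raddfD.
Qed.

Lemma sym0 m : sym m 0 = 0.
Proof. by rewrite (sym_lifts (lifts0 m)) raddf0. Qed.

Lemma symB m a b : fil m a -> fil m b -> sym m (a - b) = sym m a - sym m b.
Proof.
move=> ha hb; apply: (addIr (sym m b)); rewrite subrK -symD ?subrK //.
exact: filB.
Qed.

Lemma sym_sum m (I : Type) (s : seq I) (P : pred I) (F : I -> W) :
  (forall i, P i -> fil m (F i)) ->
  sym m (\sum_(i <- s | P i) F i) = \sum_(i <- s | P i) sym m (F i).
Proof.
move=> h; suff : fil m (\sum_(i <- s | P i) F i) /\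
    sym m (\sum_(i <- s | P i) F i) = \sum_(i <- s | P i) sym m (F i) by case.
apply: (big_ind2 (fun x y => fil m x /\ sym m x = y)).
- by split; [apply: fil0 | rewrite sym0].
- by move=> x _ y _ [hx <-] [hy <-]; split; [apply: filD | rewrite symD].
- by move=> i Pi; split=> //; apply: h.
Qed.

Lemma sym_eq0 m a i : (i < n)%N -> fil m a ->
  (wx (sym m a) i == 0) = (wx a i == 0) || (- m%:Z < (p ^ (n.-1 - i))%:Z * v (wx a i)).
Proof.
move=> hi ha; rewrite wx_sym // res_eq0; last by rewrite -fil_alpha // ha.
by rewrite fil_alpha_lt.
Qed.

Lemma fil_sym0 m a : fil m.+1 a -> sym m.+1 a = 0 -> fil m a.
Proof.
move=> ha h i hi; have := sym_eq0 hi ha; rewrite h wx0W eqxx => /esym.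
by case/orP => [->//|h']; apply/orP; right; lia.
Qed.

Lemma sym_fil m a : fil m a -> sym m.+1 a = 0.
Proof.
move=> ha; have ha' := fil_le (leqnSn m) ha; apply: wxW_inj => i hi; apply/eqP.
rewrite wx0W sym_eq0 //; have /orP[->//|h] := ha i hi; apply/orP; right; lia.
Qed.

Lemma expp_gt0 i : (0 < p ^ i)%N.
Proof. by rewrite expn_gt0 prime_gt0. Qed.

Lemma pfactor_log m j : (0 < m)%N -> (p ^ j %| m)%N = (j <= logn p m)%N.
Proof. by move=> m0; rewrite pfactor_dvdn. Qed.

(** A nonzero symbol at [l] means equality in the defining bound, and then [p ^ (n.-1 - l)] divides
    [m] because valuations are integers. *)
Lemma low_sym m a : (0 < m)%N -> fil m a -> low (n.-1 - logn p m) (sym m a).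
Proof.
move=> m0 ha l hl; have hln : (l < n)%N by lia.
apply/eqP; rewrite sym_eq0 //.
have /orP[->//|h] := ha l hln; apply/orP; right; rewrite lt_neqAle h andbT.
apply/eqP => e.
have : (p ^ (n.-1 - l) %| m)%N.
  apply/dvdnP; exists `|v (wx a l)|%N.
  have := expp_gt0 (n.-1 - l); move: (p ^ (n.-1 - l))%N e => P e P0; nia.
by rewrite pfactor_log //; lia.
Qed.

(* The subtraction [n - logn p m] is truncated: no condition if [ord_p m >= n]. *)
Definition flat m a := fil m a /\ ((0 < m)%N -> low (n - logn p m) (sym m a)).

(** The boolean condition bears on the single coordinate [n.-1 - logn p m]. By [low_sym] the symbol
    already vanishes before it, so the condition adds one index to the vanishing range. The case
    [m = 0] is separate because [logn p 0] is 0 while the order of 0 is infinite. *)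
Lemma in_flatP m a : reflect (flat m a) (in_flat_fil p v m (a : witt n L)).
Proof.
have e : (logn p m < n)%N -> (n - logn p m = (n.-1 - logn p m).+1)%N by lia.
rewrite /in_flat_fil; case: in_filP => [ha|ha] /=; last by constructor; case.
have [m0|m0] := posnP m; first by subst m; apply: ReflectT; split.
have [hl|hl] /= := ltnP (logn p m) n; last first.
  constructor; split=> // _ l; rewrite (eqP (_ : n - logn p m == 0)%N) //.
have hk : (n.-1 - logn p m < n)%N by lia.
rewrite wcoordE // (_ : (p ^ logn p m)%:Z = (p ^ (n.-1 - (n.-1 - logn p m)))%:Z); last first.
  by congr (p ^ _)%:Z; lia.
rewrite -sym_eq0 //; apply: (iffP eqP) => [h|[_ /(_ m0)]].
  split=> // _ l; rewrite e // ltnS leq_eqVlt => /orP[/eqP -> //|]; exact: low_sym.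
by apply; lia.
Qed.

Lemma flatD m a b : flat m a -> flat m b -> flat m (a + b).
Proof.
move=> [ha la] [hb lb]; split; first exact: filD.
by move=> m0; rewrite symD //; apply: lowD; auto.
Qed.

Lemma flat0 m : flat m 0.
Proof. by split=> [|_]; [apply: fil0 | rewrite sym0; apply: low0]. Qed.

Lemma flatN m a : flat m a -> flat m (- a).
Proof.
move=> [ha la]; split; first exact: filN.
move=> m0 l hl; rewrite -[- a]add0r symB ?sym0 //; last exact: fil0.
by rewrite (wxB_lt _ (la m0)) // wx0W.
Qed.

Lemma fil_flat m a : fil m a -> flat m.+1 a.
Proof.
move=> ha; split; first exact: fil_le ha.
by move=> _; rewrite sym_fil //; apply: low0.
Qed.

Local Notation F := (@wF p pr_p n L chL).

Lemma fil_F m a : fil m (F a) -> fil (m %/ p) a.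
Proof.
move=> h i hi; have := h i hi; rewrite wx_wF expf_eq0 prime_gt0 //=.
have [//|a0] := eqVneq (wx a i) 0; rewrite /= (vX Hv) //.
move: (v _) => x; case: (lerP 0 x) => hx h'.
  by rewrite (le_trans (_ : _ <= 0)) ?mulr_ge0 // oppr_le0.
have [u ux] : exists u : nat, x = - u%:Z by exists `|x|%N; lia.
have : (p ^ (n.-1 - i) * u <= m %/ p)%N by rewrite leq_divRL ?prime_gt0 //; subst x; lia.
by subst x; move: (m %/ p)%N => q; lia.
Qed.

(** Horner form [x_0 + F (x_1 + F (...))] of a sum of [F^j x_j], suited to treating the leading
    component and then the tail. It agrees with [in_sumF] when [P] holds at 0 and is closed under
    addition. *)
Inductive Fsum (P : W -> Prop) : W -> Prop :=
| Fsum0 : Fsum P 0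
| FsumS x y : P x -> Fsum P y -> Fsum P (x + F y).

Lemma Fsum_mono (P Q : W -> Prop) a : (forall x, P x -> Q x) -> Fsum P a -> Fsum Q a.
Proof.
move=> h; elim=> [|x y Px _ ih]; first exact: Fsum0.
by apply: FsumS => //; apply: h.
Qed.

Lemma Fsum1 (P : W -> Prop) a : P a -> Fsum P a.
Proof. by move=> h; rewrite -[a]addr0 -(raddf0 F); apply: FsumS => //; apply: Fsum0. Qed.

Lemma Fsum_F (P : W -> Prop) a : P 0 -> Fsum P a -> Fsum P (F a).
Proof. by move=> P0 h; rewrite -[F a]add0r; apply: FsumS. Qed.

Lemma FsumD (P : W -> Prop) a b : (forall x y, P x -> P y -> P (x + y)) ->
  Fsum P a -> Fsum P b -> Fsum P (a + b).
Proof.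
move=> PD ha; elim: ha b => [|x y Px hy ih] b; first by rewrite add0r.
case=> [|x' y' Px' hy']; first by rewrite addr0; apply: FsumS.
by rewrite addrACA -raddfD; apply: FsumS; auto.
Qed.

Lemma in_sumFP (P : W -> Prop) (Pb : witt n L -> bool) a :
  (forall x : W, reflect (P x) (Pb x)) -> P 0 -> (forall x y, P x -> P y -> P (x + y)) ->
  in_sumF p Pb (a : witt n L) <-> Fsum P a.
Proof.
move=> hP P0 PD; split.
  case=> s [hs ->]; elim: s hs => [_|[j x] s ih] /=; first exact: Fsum0.
  move=> /andP[/hP Px /ih hs]; apply: (FsumD (a := iter j F x) PD) => //.
  by elim: j => [|j ihj]; [apply: Fsum1 | rewrite iterS; apply: Fsum_F].
elim=> [|x y /hP Px _ [s [hs ys]]]; first by exists [::].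
exists ((0%N, x : witt n L) :: [seq (jx.1.+1, jx.2) | jx <- s]); split.
  by rewrite /= Px all_map.
rewrite /=; congr (witt_add p x _).
rewrite {}ys; elim: s {hs} => [|[j z] s ih].
  exact: (raddf0 F).
by rewrite /= -ih; apply: (raddfD F).
Qed.

(* [F] is injective and [F w] in [fil m] forces [w] in [fil (m / p)]: the leading term of
   a decomposition is unique up to elements that do not matter. *)
Lemma Fsum_fil_tail m x y : fil m x -> Fsum (fil m) (x + F y) -> Fsum (fil m) y.
Proof.
have fM z : fil m (F z) -> fil m z.
  by move=> /fil_F; apply: fil_le; apply: leq_div.
move=> hx; move E: (x + F y) => a ha; case: ha E => [|x' y' hx' hy'] E.
  apply: Fsum1; apply: fM; rewrite -[F y](addKr x) E addr0; exact: filN.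
rewrite -[y](subrK y'); apply: FsumD => //; first by move=> *; apply: filD.
apply: Fsum1; apply: fM; rewrite raddfB /=.
have -> : F y - F y' = x' - x.
  by apply/eqP; rewrite subr_eq addrAC -E addrAC subrr add0r.
exact: filB.
Qed.

(* In a sum with an [F]-image, the coordinate at which the slope is prime to [p] cannot
   contribute. *)
Lemma sym_F_coprime m z w : (0 < m)%N -> (logn p m < n)%N -> fil m.-1 z -> fil m (z + F w) ->
  wx (sym m (z + F w)) (n.-1 - logn p m) = 0.
Proof.
case: m => // m _ hl hz hx.
have hz' : fil m.+1 z by apply: fil_le hz.
have hw : fil m.+1 (F w) by rewrite -[F w](addKr z) addrC; apply: filB.
have hk : (n.-1 - logn p m.+1 < n)%N by lia.
rewrite symD // (sym_fil hz) add0r; apply/eqP; rewrite sym_eq0 //.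
have [w0|w0] := eqVneq (wx w (n.-1 - logn p m.+1)) 0.
  by rewrite wx_wF w0 expr0n gtn_eqF ?prime_gt0 ?eqxx.
have /orP[->//|] := hw _ hk; rewrite wx_wF (vX Hv) // => h.
apply/orP; right; rewrite lt_neqAle h andbT; apply/eqP => e.
(* In case of equality the valuation of a coordinate of [F w], a multiple of [p], puts one factor
   [p] too many into [m.+1]. *)
have : (p ^ (logn p m.+1).+1 %| m.+1)%N.
  apply/dvdnP; exists `|v (wx w (n.-1 - logn p m.+1))|%N.
  rewrite expnSr; move: e; rewrite (_ : n.-1 - (n.-1 - logn p m.+1) = logn p m.+1)%N; last by lia.
  by move: (p ^ _)%N (v _) => P x e; nia.
by rewrite pfactor_log // ltnn.
Qed.


(* Only meaningful if [p ^ (n - 1 - k)] divides [m]. *)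
Definition lead m a k := wx a k * pi ^+ (m %/ p ^ (n.-1 - k)).

Lemma alpha_lead m a k : (k < n)%N -> (p ^ (n.-1 - k) %| m)%N ->
  alpha m a k = lead m a k ^+ (p ^ n.-1).
Proof.
move=> hk /divnK e; rewrite /alpha /lead exprMn -exprM; congr (_ * _ ^+ _).
rewrite -{1}e -mulnA -expnD; congr (_ * p ^ _)%N; lia.
Qed.

Lemma leadO m a k : (k < n)%N -> (p ^ (n.-1 - k) %| m)%N -> fil m a -> inO v (lead m a k).
Proof.
by move=> hk hd /(_ k hk); rewrite fil_alpha // alpha_lead // inO_expE ?expp_gt0.
Qed.

Lemma sym_lead m a k : (k < n)%N -> (p ^ (n.-1 - k) %| m)%N -> fil m a ->
  wx (sym m a) k = res Hv (lead m a k) ^+ (p ^ n.-1).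
Proof. by move=> hk hd ha; rewrite wx_sym // alpha_lead // resX // leadO. Qed.

Lemma fil_wdelta m k u : (k < n)%N -> (p ^ (n.-1 - k) %| m)%N -> inO v u ->
  fil m (wdelta pr_p n k (u * pi ^- (m %/ p ^ (n.-1 - k)))).
Proof.
move=> hk /divnK e hu l hl; rewrite wx_wdelta hl andbT.
case: (eqVneq l k) => [->|_]; last by rewrite eqxx.
have [->|u0] := eqVneq u 0; first by rewrite mul0r eqxx.
rewrite inOE vgeE // in hu; apply/orP; right.
rewrite (vM Hv) ?invr_eq0 ?expf_neq0 // (vV Hv) ?expf_neq0 // (vX Hv) // vpi.
have := expp_gt0 (n.-1 - k); move: (p ^ _)%N (m %/ _)%N e hu => P E e hu P0; nia.
Qed.

Lemma lead_wdelta m k u : (k < n)%N ->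
  lead m (wdelta pr_p n k (u * pi ^- (m %/ p ^ (n.-1 - k)))) k = u.
Proof. by move=> hk; rewrite /lead wx_wdelta eqxx hk divfK // expf_neq0. Qed.

Lemma sym_wdelta_low m k u : low k (sym m (wdelta pr_p n k u)).
Proof.
move=> l hl; have [hln|hln] := ltnP l n; last by rewrite wx_ge.
rewrite wx_sym // /alpha wx_wdelta ltn_eqF //= expr0n gtn_eqF ?expp_gt0 //.
by rewrite mul0r res0.
Qed.

Lemma wdelta_pth m k c : (k < n)%N -> (p ^ (n.-1 - k).+1 %| m)%N ->
  F (wdelta pr_p n k (c * pi ^- (m %/ p ^ (n.-1 - k).+1))) =
  wdelta pr_p n k (c ^+ p * pi ^- (m %/ p ^ (n.-1 - k))).
Proof.
move=> hk hd; rewrite wF_wdelta exprMn exprVn -exprM; congr (wdelta _ _ _ (_ * _ ^- _)).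
have /dvdnP[d ->] := hd.
by rewrite mulnK ?expp_gt0 // expnS mulnA mulnK ?expp_gt0.
Qed.

(** The slope at [k] is divisible by [p], so the power of [pi] there has a [p]-th root, and the
    one-coordinate vector with leading coefficient [c ^+ p] is an [F]-image. Its symbol cancels that
    of [a] at [k]; carries affect later coordinates only. *)
Lemma remove_lead m a k c : (k < n)%N -> (p ^ (n.-1 - k).+1 %| m)%N ->
  fil m a -> low k (sym m a) -> inO v c -> inM v (lead m a k - c ^+ p) ->
  exists y, [/\ fil (m %/ p) y, fil m (a - F y) & low k.+1 (sym m (a - F y))].
Proof.
move=> hk hd ha la hc hac.
have hd' : (p ^ (n.-1 - k) %| m)%N by apply: dvdn_trans hd; rewrite dvdn_exp2l.
exists (wdelta pr_p n k (c * pi ^- (m %/ p ^ (n.-1 - k).+1))).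
have hy : fil m (F (wdelta pr_p n k (c * pi ^- (m %/ p ^ (n.-1 - k).+1)))).
  by rewrite wdelta_pth //; apply: fil_wdelta => //; apply: inOX.
split; [exact: fil_F | exact: filB | ].
have ly : low k (sym m (F (wdelta pr_p n k (c * pi ^- (m %/ p ^ (n.-1 - k).+1))))).
  by rewrite wF_wdelta; apply: sym_wdelta_low.
move=> l; rewrite ltnS leq_eqVlt symB // => /orP[/eqP ->|hl]; last first.
  by rewrite (wxB_lt _ ly) // la.
rewrite (wxB_lead _ ly) !sym_lead // wdelta_pth // lead_wdelta //.
suff -> : res Hv (lead m a k) = res Hv (c ^+ p) by rewrite subrr.
by apply/eqP; rewrite res_eq //; [apply: leadO | apply: inOX].
Qed.

Lemma low_sym_n m a : low n (sym m a) -> sym m a = 0.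
Proof. by move=> h; apply: wxW_inj => i hi; rewrite h // wx0W. Qed.

Lemma ltn_div_p m : (0 < m)%N -> (m %/ p < m)%N.
Proof. by move=> m0; rewrite ltn_Pdiv // prime_gt1. Qed.

(* Over a perfect residue field every leading coefficient of slope divisible by [p] is
   absorbed by an [F]-image. *)
Lemma flat_Fsum m a : perfect_residue p v -> flat m.+1 a -> Fsum (fil m) a.
Proof.
move=> perf [ha /(_ isT) la].
(* Flatness lets the removal start at [n - logn p m.+1], the first index whose slope is divisible by
   [p]. *)
suff H N k b : (n - k <= N)%N -> (n - logn p m.+1 <= k)%N -> fil m.+1 b ->
    low k (sym m.+1 b) -> Fsum (fil m) b by apply: (H n _ a _ _ ha la); lia.
elim: N k b {a ha la} => [|N ih] k a hN hk ha la.
  apply: Fsum1; apply: (@fil_sym0 m) => //; apply: low_sym_n.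
  by move=> l hl; apply: la; lia.
have [hkn|hkn] := leqP n k.
  apply: Fsum1; apply: (@fil_sym0 m) => //; apply: low_sym_n.
  by move=> l hl; apply: la; lia.
have [e1 e2] : (n - k.+1 <= N)%N /\ (n - logn p m.+1 <= k.+1)%N by clear -hN hk; lia.
have hd : (p ^ (n.-1 - k).+1 %| m.+1)%N by rewrite pfactor_log //; clear -hk hkn; lia.
have hd' : (p ^ (n.-1 - k) %| m.+1)%N by apply: dvdn_trans hd; rewrite dvdn_exp2l.
have [c hc hac] := perf _ (leadO hkn hd' ha).
have [y [hy ha' la']] := remove_lead hkn hd ha la hc hac.
rewrite -[a](subrK (F y)); apply: FsumD; first by move=> *; apply: filD.
  exact: (ih k.+1).
apply: Fsum_F; first exact: fil0.
apply: Fsum1; apply: fil_le hy; have := @ltn_div_p m.+1 isT; lia.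
Qed.

(** One digit [c ^+ p * b ^+ s] of a [p]-basis expansion, placed at coordinate [l] with the extreme
    pole allowed in [fil m]. *)
Definition pterm m l (c b : L) s : W :=
  wdelta pr_p n l (c ^+ p * b ^+ s * pi ^- (m %/ p ^ (n.-1 - l))).

(** The symbol is cleared one coordinate at a time by expanding the current leading coefficient. The
    expansion at the first index [k] is recorded because [b] will be the leading coefficient of [a]
    there. *)
Lemma decompose m (b : L) k a : (0 < m)%N -> inO v b ->
  (forall x, inO v x -> exists2 c : 'I_p -> L, (forall s, inO v (c s)) &
     inM v (x - \sum_(s < p) c s ^+ p * b ^+ s)) ->
  (n - logn p m <= k)%N -> fil m a -> low k (sym m a) ->
  exists c : nat -> 'I_p -> L, [/\ forall l s, inO v (c l s),
    (k < n)%N -> inM v (lead m a k - \sum_(s < p) c k s ^+ p * b ^+ s) &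
    fil m.-1 (a - \sum_(k <= l < n) \sum_(s < p) pterm m l (c l s) b s)].
Proof.
case: m => // m _ hb pbasis.
have [N] : exists N, (n - k <= N)%N by exists n; lia.
elim: N k a => [|N ih] k a hN hk ha la.
  exists (fun _ _ => 0); split=> [l s||]; [exact: inO0 | lia |].
  rewrite big_geq ?subr0; last by lia.
  by apply: (@fil_sym0 m) => //; apply: low_sym_n => l hl; apply: la; lia.
have [hkn|hkn] := leqP n k.
  exists (fun _ _ => 0); split=> [l s||]; [exact: inO0 | lia |].
  rewrite big_geq ?subr0; last by lia.
  by apply: (@fil_sym0 m) => //; apply: low_sym_n => l hl; apply: la; lia.
have [e1 e2] : (n - k.+1 <= N)%N /\ (n - logn p m.+1 <= k.+1)%N by clear -hN hk; lia.
have hd : (p ^ (n.-1 - k) %| m.+1)%N by rewrite pfactor_log //; clear -hk hkn; lia.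
have [ck hck hak] := pbasis _ (leadO hkn hd ha).
pose t := \sum_(s < p) pterm m.+1 k (ck s) b s.
have cb s : inO v (ck s ^+ p * b ^+ s) by apply: inOM => //; apply: inOX.
have ft s : fil m.+1 (pterm m.+1 k (ck s) b s) by apply: fil_wdelta.
have ht : fil m.+1 t by apply: fil_sum.
have [lt st] : low k (sym m.+1 t) /\ wx (sym m.+1 t) k =
    res Hv (\sum_(s < p) ck s ^+ p * b ^+ s) ^+ (p ^ n.-1).
  rewrite /t sym_sum //.
  have [h1 h2] := @wx_sum_lead _ pr_p n _ _ (index_enum 'I_p) xpredT
    (fun s => sym m.+1 (pterm m.+1 k (ck s) b s)) k
    (fun s _ => @sym_wdelta_low _ _ _).
  split=> //; rewrite h2 res_sum //.
  rewrite (expXp_sum (resfield_pchar Hv chL)).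
  by apply: eq_bigr => s _; rewrite sym_lead // lead_wdelta.
have ha' : fil m.+1 (a - t) by apply: filB.
have la' : low k.+1 (sym m.+1 (a - t)).
  move=> l; rewrite ltnS leq_eqVlt symB // => /orP[/eqP ->|hl]; last first.
    by rewrite (wxB_lt _ lt) // la.
  rewrite (wxB_lead _ lt) sym_lead // st.
  suff -> : res Hv (lead m.+1 a k) = res Hv (\sum_(s < p) ck s ^+ p * b ^+ s) by rewrite subrr.
  by apply/eqP; rewrite res_eq //; [apply: leadO | apply: inO_sum].
have [c [hc _ hr]] := ih k.+1 (a - t) e1 e2 ha' la'.
exists (fun l => if l == k then ck else c l); split.
- by move=> l s; case: ifP.
- by rewrite eqxx.
have -> : \sum_(k <= l < n) \sum_(s < p) pterm m.+1 l ((if l == k then ck else c l) s) b s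
    = t + \sum_(k.+1 <= l < n) \sum_(s < p) pterm m.+1 l (c l s) b s.
  rewrite (big_ltn hkn) eqxx; congr (_ + _).
  by apply: eq_big_nat => l /andP[kl _]; rewrite gtn_eqF.
by rewrite opprD addrA.
Qed.

Lemma vvalmK x : inO v x -> exists o : vring Hv, vvalm Hv o = x.
Proof. by move=> h; exists (VRing (h : x \in Opred Hv)). Qed.

Lemma vvalmO (o : vring Hv) : inO v (vvalm Hv o).
Proof. by case: o. Qed.

(* With [b = beta ^ p + t * pi], the [F]-image of the vector built on [c * beta ^ s]
   approximates [pterm], and the error is measured by the first order term. *)
Lemma pterm_approx m l (c b t beta : L) s : (0 < m)%N -> (l < n)%N ->
  (p ^ (n.-1 - l).+1 %| m)%N -> inO v c -> inO v t -> inO v beta ->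
  b = beta ^+ p + t * pi ->
  exists y e, [/\ pterm m l c b s = F y + e, fil m.-1 e &
    wx (sym m.-1 e) n.-1 = res Hv (t * (s%:R * (c ^+ p * b ^+ s.-1) *
       (c ^+ p * b ^+ s) ^+ (p ^ (n.-1 - l)).-1)) ^+ (p ^ n.-1)].
Proof.
move=> m0 hl hd hc ht hbeta bE.
have hd' : (p ^ (n.-1 - l) %| m)%N by apply: dvdn_trans hd; rewrite dvdn_exp2l.
have piO : inO v pi by rewrite inOE vgeE // vpi.
have piM : inM v pi by rewrite inME vgeE // vpi.
have bbO : inO v (beta ^+ p) by apply: inOX.
have bO : inO v b by rewrite bE; apply: inOD => //; apply: inOM.
have resb : res Hv b = res Hv (beta ^+ p).
  by apply/eqP; rewrite res_eq // bE addrC addKr; apply: inMMr.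
(* [Q] is the cofactor of [b - beta ^+ p = t * pi] in [b ^+ s - (beta ^+ p) ^+ s]; its residue is
   the derivative [s * b ^+ s.-1]. *)
pose Q := \sum_(i < s) b ^+ (s.-1 - i) * (beta ^+ p) ^+ i.
have QO : inO v Q by apply: inO_sum => // i _; apply: inOM => //; apply: inOX.
have resQ : res Hv Q = s%:R * res Hv b ^+ s.-1.
  rewrite /Q res_sum; last by move=> i _; apply: inOM => //; apply: inOX.
  rewrite (eq_bigr (fun=> res Hv b ^+ s.-1)); last first.
    move=> i _; rewrite resM ?inOX // (resX Hv _ bO) (resX Hv _ bbO) -resb -exprD subnK //.
    by clear -i; have := ltn_ord i; lia.
  by rewrite sumr_const card_ord mulr_natl.
pose y0 := c ^+ p * (beta ^+ p) ^+ s; pose h := pi * (c ^+ p * t * Q).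
have y0h : c ^+ p * b ^+ s = y0 + h.
  apply/eqP; rewrite addrC -subr_eq /y0 -mulrBr subrXX {1}bE addrC addKr /h.
  by apply/eqP; rewrite /Q; ring.
have y0O : inO v y0 by apply: inOM => //; apply: inOX.
have cpO : inO v (c ^+ p) by apply: inOX.
have hh : inO v (c ^+ p * t * Q) by do 2?apply: inOM => //.
have hO : inO v h by apply: inOM.
pose r := pi ^- (m %/ p ^ (n.-1 - l)).
pose e := pterm m l c b s - wdelta pr_p n l (y0 * r).
have [oy oyE] := vvalmK y0O; have [oh ohE] := vvalmK hO.
have [og hog] := wdelta_linear pr_p oy oh hl.
pose g i := vvalm Hv (og i).
have eE i : (i < n)%N -> (l <= i)%N ->
    wx e i = r ^+ (p ^ (i - l)) * (h * (y0 ^+ (p ^ (i - l)).-1 + h * g i)).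
  move=> hi li; rewrite /e /pterm y0h -/r ![_ * r]mulrC wdeltaB_homog //; congr (_ * _).
  have -> : wdelta pr_p n l (y0 + h) - wdelta pr_p n l y0 =
      wmap (vvalm Hv) (wdelta pr_p n l (oy + oh) - wdelta pr_p n l oy).
    by rewrite raddfB /= !wmap_wdelta rmorphD oyE ohE.
  by rewrite wx_wmap hog // rmorphM rmorphD rmorphM rmorphXn oyE ohE.
have le : low l e by apply: low_wdeltaB.
have rE i : (l <= i)%N -> (i < n)%N -> (r ^+ (p ^ (i - l)) = pi ^- (m %/ p ^ (n.-1 - i)))%R.
  move=> li hi; rewrite /r exprVn -exprM; congr (_ ^- _).
  have /dvdnP[d ->] := hd'.
  rewrite mulnK ?expp_gt0 // (_ : p ^ (n.-1 - l) = p ^ (i - l) * p ^ (n.-1 - i))%N.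
    by rewrite mulnA mulnK ?expp_gt0.
  by rewrite -expnD; congr (p ^ _)%N; clear -li hi; lia.
have dvi i : (l <= i)%N -> (p ^ (n.-1 - i) %| m)%N.
  by move=> li; apply: dvdn_trans hd'; rewrite dvdn_exp2l //; clear -li; lia.
have ysO i : inO v (y0 ^+ i + h * g i).
  by apply: inOD; [exact: Hv | apply: inOX | apply: inOM => //; apply: vvalmO].
(* The factor [pi] of [h] raises the valuation of coordinate [i] by one, hence the quantity bounded
   in [fil] by [p ^ (n.-1 - i)]. The guaranteed gain is only 1 at [i = n.-1], where the symbol at
   level [m.-1] is then computed. *)
have filE : fil m.-1 e.
  move=> i hi; have [il|li] := ltnP i l; first by rewrite le // eqxx.
  rewrite eE // rE //; set u := h * _; have [->|u0] := eqVneq u 0; first by rewrite mulr0 eqxx.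
  have : inM v u.
    rewrite /u; apply: inMMl => //; first by apply: inMMl.
    by apply: inOD; [exact: Hv | apply: inOX | apply: inOM => //; apply: vvalmO].
  rewrite inME vgeE // => vu; apply/orP; right.
  rewrite (vM Hv) ?invr_eq0 ?expf_neq0 // (vV Hv) ?expf_neq0 // (vX Hv) // vpi.
  have := expp_gt0 (n.-1 - i); have /divnK := dvi i li.
  move: (p ^ _)%N (m %/ _)%N m0 vu => P E m0' vu e1 P0; clear -e1 P0 vu m0'; nia.
exists (wdelta pr_p n l (c * beta ^+ s * pi ^- (m %/ p ^ (n.-1 - l).+1))), e; split=> //.
  by rewrite wdelta_pth // exprMn -exprM mulnC exprM -/y0 -/r /e addrC subrK.
have hn : (n.-1 < n)%N by clear -hl; lia.
have ln : (l <= n.-1)%N by clear -hl; lia.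
rewrite sym_lead ?subnn ?dvd1n //; congr (_ ^+ _).
have -> : lead m.-1 e n.-1 = c ^+ p * t * Q * (y0 ^+ (p ^ (n.-1 - l)).-1 + h * g n.-1).
  rewrite /lead eE // rE // subnn expn0 !divn1 /h.
  rewrite -[in pi ^- m](prednK m0) exprS invfM.
  have X0 : pi ^+ m.-1 != 0 by rewrite expf_neq0.
  move: (y0 ^+ _) (pi ^+ m.-1) X0 => A B B0; field.
  by rewrite pi0 B0.
have yO' i : inO v (y0 ^+ i) by apply: inOX.
have hgO : inO v (h * g n.-1) by apply: inOM => //; apply: vvalmO.
have cbO i : inO v (c ^+ p * b ^+ i) by apply: inOM => //; apply: inOX.
have nO i : inO v i%:R by elim: i => [|i ih]; rewrite ?inO0 // -natr1 inOD ?inO1.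
rewrite resM ?inOD // resD // (_ : res Hv (h * g n.-1) = 0) ?addr0; last first.
  by apply: res_inM; apply: inMMl => //; [apply: inMMl | apply: vvalmO].
rewrite resX // /y0 (resM Hv cpO) ?inOX // [res Hv ((beta ^+ p) ^+ s)]resX // -resb.
rewrite (resM Hv) ?inOM // (resM Hv cpO ht) resQ.
rewrite [RHS]resM ?inOM ?inOX ?nO // [in RHS]resM ?inOM ?inOX ?nO //.
rewrite [res Hv (s%:R * _)]resM ?nO // res_nat [res Hv (_ ^+ (_).-1)]resX //.
rewrite !(resM Hv cpO) ?inOX // !(resX Hv _ bO).
ring.
Qed.

(** The coefficient of [db] in [x ^+ (p ^ j).-1 dx] for [x = c ^+ p * b ^+ s] and [j = n.-1 - l],
    that is, in [F^j d] of the Teichmueller vector of [x]. *)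
Definition pcoef l (c b : L) s : L :=
  s%:R * (c ^+ p * b ^+ s.-1) * (c ^+ p * b ^+ s) ^+ (p ^ (n.-1 - l)).-1.

Lemma pcoefO l (c b : L) s : inO v c -> inO v b -> inO v (pcoef l c b s).
Proof.
move=> hc hb; have nO i : inO v i%:R.
  by elim: i => [|i ih]; rewrite ?inO0 // -natr1 inOD ?inO1.
by apply: inOM => //; [apply: inOM => //; apply: inOM => // | apply: inOX => //;
  apply: inOM => //]; apply: inOX.
Qed.

(** As [p] divides [m], the level [m.-1] is prime to [p], and an [F]-image cannot contribute to the
    last symbol there. After each [pterm] is replaced by its error term, the last symbols of the
    errors and of [rest] must cancel. *)
Lemma pterm_obstruction m k (c : nat -> 'I_p -> L) (b t beta : L) rest z w :
  (0 < n)%N -> (0 < m)%N -> (p %| m)%N -> (n - logn p m <= k)%N ->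
  (forall l s, inO v (c l s)) -> inO v t -> inO v beta -> b = beta ^+ p + t * pi ->
  fil m.-1 rest -> fil m.-2 z ->
  \sum_(k <= l < n) \sum_(s < p) pterm m l (c l s) b s + rest = z + F w ->
  inM v (lead m.-1 rest n.-1 + t * \sum_(k <= l < n) \sum_(s < p) pcoef l (c l s) b s).
Proof.
move=> n0 m0 pm hk hc ht hbeta bE hrest hz E.
have piO : inO v pi by rewrite inOE vgeE // vpi.
have bO : inO v b by rewrite bE; apply: inOD => //; [apply: inOX | apply: inOM].
have hn : (n.-1 < n)%N by rewrite prednK.
have m1 : (0 < m.-1)%N.
  by have := dvdn_leq m0 pm; have := prime_gt1 pr_p; clear; lia.
have l1 : logn p m.-1 = 0%N.
  apply/eqP; rewrite -leqn0 leqNgt -pfactor_log // expn1.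
  apply/negP => h; have : (p %| 1)%N by rewrite -(dvdn_addr 1 h) addn1 prednK.
  by rewrite dvdn1 gtn_eqF // prime_gt1.
have lowe e : fil m.-1 e -> low n.-1 (sym m.-1 e).
  by move=> he; have := low_sym m1 he; rewrite l1 subn0.
pose U l s := res Hv (t * pcoef l (c l s) b s).
(* Modulo [F]-images, [x] lies in [fil m.-1] with last symbol the [p ^ n.-1]-th power of [u]. The
   relation is additive, so the double sum can be treated term by term. *)
pose rel (x : W) u := exists y e, [/\ x = F y + e, fil m.-1 e &
  wx (sym m.-1 e) n.-1 = u ^+ (p ^ n.-1)].
have rel0 : rel 0 0.
  exists 0, 0; rewrite raddf0 addr0; split=> //; first exact: fil0.
  by rewrite sym0 wx0W expr0n gtn_eqF ?expp_gt0.
have relD x u x' u' : rel x u -> rel x' u' -> rel (x + x') (u + u').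
  move=> [y [e [-> he se]]] [y' [e' [-> he' se']]]; exists (y + y'), (e + e').
  rewrite raddfD addrACA symD // (wxD_lead _ (lowe _ he')) se se'.
  by rewrite (expXpD (resfield_pchar Hv chL)); split=> //; apply: filD.
have [y [e [eqe he se]]] : rel (\sum_(k <= l < n) \sum_(s < p) pterm m l (c l s) b s)
    (\sum_(k <= l < n) \sum_(s < p) U l s).
  rewrite !big_seq; apply: (big_ind2 rel) => // l; rewrite mem_index_iota => /andP[kl ln].
  apply: (big_ind2 rel) => // s _.
  apply: (pterm_approx (beta := beta)) => //.
  by rewrite pfactor_log //; clear -kl ln hk; lia.
have E' : e + rest = z + F (w - y).
  by rewrite raddfB /= addrA -E eqe -[F y + e + rest]addrA addrAC subrr add0r.
have hx : fil m.-1 (z + F (w - y)) by rewrite -E'; apply: filD.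
have := sym_F_coprime m1 _ hz hx; rewrite l1 subn0 => /(_ n0).
rewrite -E' symD // (wxD_lead _ (lowe _ hrest)) se sym_lead ?subnn ?dvd1n //.
rewrite -(expXpD (resfield_pchar Hv chL)) => /eqP; rewrite expf_eq0 => /andP[_ /eqP U0].
have lO : inO v (lead m.-1 rest n.-1) by apply: leadO; rewrite ?subnn ?dvd1n.
have tcO l s : inO v (t * pcoef l (c l s) b s) by apply: inOM => //; apply: pcoefO.
have sO : inO v (t * \sum_(k <= l < n) \sum_(s < p) pcoef l (c l s) b s).
  by apply: inOM => //; apply: inO_sum => // l _; apply: inO_sum => // s _; apply: pcoefO.
rewrite -(res_eq0 Hv) ?inOD // resD // addrC -[X in _ == X]U0; apply/eqP; congr (_ + _).
rewrite mulr_sumr res_sum; last first.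
  move=> l _; rewrite mulr_sumr; exact: inO_sum.
by apply: eq_bigr => l _; rewrite mulr_sumr res_sum.
Qed.

End Filtration.

(** * Extensions of ramification index one *)

Definition is_subfield (F : fieldType) (S : F -> Prop) :=
  [/\ S 1, forall x y, S x -> S y -> S (x - y) & forall x y, S x -> S y -> S (x / y)].

(** Zorn's lemma produces subfields as mere propositions; [asbool] makes them boolean so that a
    subtype can be formed. *)
Definition subfield_pred (F : fieldType) (S : F -> Prop) (HS : is_subfield S) : {pred F} :=
  fun x => boolp.asbool (S x).

Section SubfieldType.
Variables (F : fieldType) (S : F -> Prop) (HS : is_subfield S).

Fact subfield_pred_closed : divring_closed (subfield_pred HS).
Proof.
case: (HS) => h1 hB hV; split; first exact/boolp.asboolP.
  by move=> x y /boolp.asboolP hx /boolp.asboolP hy; apply/boolp.asboolP/hB.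
by move=> x y /boolp.asboolP hx /boolp.asboolP hy; apply/boolp.asboolP/hV.
Qed.
HB.instance Definition _ :=
  GRing.isDivringClosed.Build F (subfield_pred HS) subfield_pred_closed.

Record subfieldT := SubfieldT { sfval : F; _ : sfval \in subfield_pred HS }.
HB.instance Definition _ := [isSub for sfval].
HB.instance Definition _ := [Choice of subfieldT by <:].
HB.instance Definition _ := [SubChoice_isSubIntegralDomain of subfieldT by <:].
HB.instance Definition _ := [SubIntegralDomain_isSubField of subfieldT by <:].

Lemma subfield_type : exists (E : fieldType) (f : {rmorphism E -> F}),
  forall x, S x <-> exists y, f y = x.
Proof.
exists subfieldT, (\val : subfieldT -> F) => x; split=> [hx|[y <-]].
  have hx' : x \in subfield_pred HS by apply/boolp.asboolP.
  by exists (SubfieldT hx').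
by case: y => y /= /boolp.asboolP.
Qed.
End SubfieldType.

Section SubfieldTheory.
Variables (F : fieldType) (S : F -> Prop).
Hypothesis HS : is_subfield S.

Lemma sf1 : S 1. Proof. by case: HS. Qed.
Lemma sfB x y : S x -> S y -> S (x - y). Proof. by case: HS => _ h _; apply: h. Qed.
Lemma sfV x : S x -> S x^-1.
Proof. by move=> hx; rewrite -div1r; case: HS => h1 _; apply. Qed.
Lemma sfM x y : S x -> S y -> S (x * y).
Proof. by move=> hx hy; rewrite -[y]invrK; case: HS => _ _; apply => //; apply: sfV. Qed.
End SubfieldTheory.

(** * Adjoining one [p]-th root *)

Section PthRoot.
Variables (p : nat) (F E : fieldType) (f : {rmorphism F -> E}).
Hypothesis chE : p \in [pchar E].
Variables (a : E) (c : F).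
Hypothesis ac : a ^+ p = f c.

Let pr_p : prime p. Proof. by case/andP: chE. Qed.

Lemma pchar_sub : p \in [pchar F].
Proof.
by rewrite inE /= pr_p -(fmorph_eq0 f) rmorph_nat; case/andP: chE.
Qed.

Lemma pth_root_poly : map_poly f ('X^p - c%:P) = ('X - a%:P) ^+ p.
Proof.
rewrite rmorphB /= map_polyXn map_polyC /= -ac.
have chP : p \in [pchar {poly E}] by rewrite pchar_poly.
by rewrite -[RHS](pFrobenius_autE chP) rmorphB /= !pFrobenius_autE polyC_exp.
Qed.

(* [X^p - a^p = (X - a)^p], so a common factor with a polynomial of degree [< p] has
   the form [(X - a)^r] with [0 < r < p], and its subleading coefficient is [- r a]. *)
Lemma pth_root_low_degree (P : {poly F}) : (1 < size P)%N -> (size P <= p)%N ->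
  root (map_poly f P) a -> exists d, f d = a.
Proof.
move=> sP1 sPp rP.
have P0 : P != 0 by rewrite -size_poly_gt0 ltnW.
pose D := gcdp P ('X^p - c%:P).
have mD : map_poly f D = gcdp (map_poly f P) (('X - a%:P) ^+ p).
  by rewrite gcdp_map pth_root_poly.
have rD : root (map_poly f D) a.
  by rewrite mD root_gcd rP -(prednK (prime_gt0 pr_p)) root_exp_XsubC eqxx.
have /dvdp_exp_XsubCP[r rp Dr] : map_poly f D %| ('X - a%:P) ^+ p.
  by rewrite mD dvdp_gcdr.
have D0 : D != 0 by rewrite gcdp_eq0 negb_and P0.
have r0 : (0 < r)%N.
  rewrite lt0n; apply: contraTneq rD => r0; rewrite r0 expr0 in Dr.
  by rewrite (eqp_root Dr) root1.
have rltp : (r < p)%N.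
  have := eqp_size Dr; rewrite size_exp_XsubC size_map_poly => <-.
  by apply: leq_trans sPp; apply: dvdp_leq => //; apply: dvdp_gcdl.
have /eqpfP eD := Dr.
have lX : lead_coef (('X - a%:P) ^+ r) = 1 by rewrite lead_coef_exp lead_coefXsubC expr1n.
have eC : f D`_r.-1 = lead_coef (map_poly f D) * (- (a *+ r)).
  rewrite -coef_map [in LHS]eD lX divr1 coefZ; congr (_ * _).
  have := @coefPn_prod_XsubC E (nseq r a); rewrite size_nseq -lt0n r0 => /(_ isT).
  by rewrite !big_nseq iter_mulr_1 iter_addr_0.
have r1 : r%:R != 0 :> E.
  by rewrite -(dvdn_pcharf chE) gtnNdvd.
exists (- (D`_r.-1 / (lead_coef D * r%:R))).
rewrite rmorphN fmorph_div eC rmorphM rmorph_nat lead_coef_map -mulr_natr.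
have l0 : f (lead_coef D) != 0 by rewrite fmorph_eq0 lead_coef_eq0.
by field; rewrite r1.
Qed.

Definition adjoin_root x := exists P : {poly F}, x = (map_poly f P).[a].

Lemma adjoin_rootP x : adjoin_root x ->
  exists g : 'I_p -> F, x = \sum_(s < p) f (g s) * a ^+ s.
Proof.
case=> P ->; pose T : {poly F} := 'X^p - c%:P.
have sT : size T = p.+1 by rewrite size_XnsubC // prime_gt0.
have T0 : T != 0 by rewrite -size_poly_gt0 sT.
exists (fun s => (P %% T)`_s).
rewrite {1}(divp_eq P T) rmorphD rmorphM /= hornerD hornerM.
rewrite [(map_poly f T).[a]](_ : _ = 0) ?mulr0 ?add0r; last first.
  by rewrite pth_root_poly horner_exp hornerXsubC subrr expr0n gtn_eqF ?prime_gt0.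
rewrite (@horner_coef_wide _ p).
  by apply: eq_bigr => s _; rewrite coef_map.
by rewrite size_map_poly -ltnS -sT ltn_modp.
Qed.

Lemma adjoin_root_base x : adjoin_root (f x).
Proof. by exists x%:P; rewrite map_polyC hornerC. Qed.

Lemma adjoin_root_gen : adjoin_root a.
Proof. by exists 'X; rewrite map_polyX hornerX. Qed.

Lemma sum_pth_power (g : 'I_p -> F) :
  (\sum_(s < p) f (g s) * a ^+ s) ^+ p = f (\sum_(s < p) g s ^+ p * c ^+ s).
Proof.
rewrite -(pFrobenius_autE chE) rmorph_sum rmorph_sum; apply: eq_bigr => s _ /=.
by rewrite pFrobenius_autE exprMn -exprM mulnC exprM ac rmorphM !rmorphXn.
Qed.

(** Inverses exist because the [p]-th power of any element lies in the base field: [y^-1] is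
    [y ^+ p.-1] divided by [y ^+ p]. *)
Lemma adjoin_root_subfield : is_subfield adjoin_root.
Proof.
split; first by rewrite -(rmorph1 f); apply: adjoin_root_base.
  by move=> _ _ [P ->] [Q ->]; exists (P - Q); rewrite rmorphB /= hornerD hornerN.
move=> x y hx hy.
have M u w : adjoin_root u -> adjoin_root w -> adjoin_root (u * w).
  by move=> [P ->] [Q ->]; exists (P * Q); rewrite rmorphM /= hornerM.
apply: (M) => //; have [g hg] := adjoin_rootP hy.
have [->|y0] := eqVneq y 0; first by rewrite invr0 -(rmorph0 f); apply: adjoin_root_base.
have e := sum_pth_power g; rewrite -hg in e.
have -> : y^-1 = y ^+ p.-1 * f (\sum_(s < p) g s ^+ p * c ^+ s)^-1.
  rewrite fmorphV -e -{2}(prednK (prime_gt0 pr_p)) exprS invfM.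
  by rewrite mulrCA mulfV ?mulr1 // expf_neq0.
apply: (M); last exact: adjoin_root_base.
elim: p.-1 => [|m ih]; first by rewrite expr0 -(rmorph1 f); apply: adjoin_root_base.
by rewrite exprS; apply: M.
Qed.

End PthRoot.

Section PIndependence.
Variables (p : nat) (F : fieldType).
Hypothesis chF : p \in [pchar F].
Implicit Types a b c : F.

Let pr_p : prime p. Proof. by case/andP: chF. Qed.
Let Fr : {rmorphism F -> F} := pFrobenius_aut chF.
Let FrE x : Fr x = x ^+ p. Proof. exact: pFrobenius_autE. Qed.

Definition pth a := exists c, a = c ^+ p.

(** Frobenius is viewed as an embedding of [F] in itself: the relation is a polynomial of degree
    below [p] over the subfield of [p]-th powers with root [a]. Were it not constant,
    [pth_root_low_degree] would put [a] in that subfield. *)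
Lemma p_independent a (c : 'I_p -> F) : ~ pth a ->
  \sum_(s < p) c s ^+ p * a ^+ s = 0 -> forall s, c s = 0.
Proof.
move=> npa h; pose P := \poly_(s < p) (if insub s is Some i then c i else 0).
have Pc s : P`_s = if insub s is Some i then c i else 0.
  by rewrite coef_poly; case: ltnP => // hs; rewrite insubF // ltnNge hs.
have sP : (size P <= p)%N by apply: size_poly.
have rP : root (map_poly Fr P) a.
  rewrite /root (@horner_coef_wide _ p) ?size_map_poly // -[X in _ == X]h.
  by apply/eqP; apply: eq_bigr => s _; rewrite coef_map Pc valK.
have [s1|s1] := leqP (size P) 1; last first.
  have [d hd] := pth_root_low_degree (f := Fr) chF (esym (FrE a)) s1 sP rP.
  by case: npa; exists d; rewrite -FrE.
have P0 : P = 0.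
  move: rP; rewrite (size1_polyC s1) map_polyC /root hornerC fmorph_eq0 => /eqP ->.
  by rewrite polyC0.
by move=> s; have := Pc s; rewrite valK P0 coef0.
Qed.

(** The relation, with [b] moved to the constant term, is a polynomial in [a] of degree below [p]
    over [F^p(b)]. If it is not constant, [a] lies in [F^p(b)]; if it is, [b] equals [c 0 ^+ p]. *)
Lemma p_exchange a b (c : 'I_p -> F) : ~ pth b ->
  b = \sum_(s < p) c s ^+ p * a ^+ s ->
  exists d : 'I_p -> F, a = \sum_(s < p) d s ^+ p * b ^+ s.
Proof.
move=> npb hb; pose S := adjoin_root Fr b.
have HS : is_subfield S := adjoin_root_subfield chF (esym (FrE b)).
have [E [f hf]] := subfield_type HS.
have fS x : S x -> exists y, f y = x by move/hf.
have [b' hb'] := fS _ (adjoin_root_gen Fr b).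
have /boolp.choice[c' hc'] : forall s, exists y, f y = c s ^+ p.
  by move=> s; apply: fS; rewrite -FrE; apply: adjoin_root_base.
have [a' ha'] : exists y, f y = a ^+ p.
  by apply: fS; rewrite -FrE; apply: adjoin_root_base.
pose P : {poly E} := \poly_(s < p) (if insub s is Some i then c' i else 0) - b'%:P.
have Pc s : P`_s = (if insub s is Some i then c' i else 0) - (if s == 0%N then b' else 0).
  rewrite coefB coefC coef_poly; case: ltnP => // hs.
  by rewrite [insub s]insubF // ltnNge hs.
have sP : (size P <= p)%N.
  rewrite (leq_trans (size_polyD _ _)) // size_polyN geq_max size_poly.
  by rewrite (leq_trans (size_polyC_leq1 _)) // prime_gt0.
have rP : root (map_poly f P) a.
  rewrite /root rmorphB /= map_polyC hornerD hornerN hornerC /= hb' [X in _ - X]hb subr_eq0.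
  rewrite (@horner_coef_wide _ p) ?size_map_poly ?size_poly //.
  apply/eqP; apply: eq_bigr => s _; rewrite coef_map coef_poly ltn_ord valK.
  by rewrite /= hc'.
suff [d hd] : exists d, f d = a.
  have /adjoin_rootP : S a by rewrite hf; exists d.
  by move=> /(_ _ chF b (esym (FrE b)))[g hg]; exists g; rewrite {1}hg; 
     apply: eq_bigr => s _; rewrite FrE.
have [s1|s1] := leqP (size P) 1; last first.
  exact: (pth_root_low_degree chF (esym ha') s1 sP rP).
case: npb.
have c0 (s : 'I_p) : s != 0%N :> nat -> c s = 0.
  move=> s0; have : P`_s = 0 by apply: nth_default; apply: leq_trans s1 _; rewrite lt0n.
  rewrite Pc valK (negbTE s0) subr0 => h; have := hc' s; rewrite h rmorph0 => /esym/eqP.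
  by rewrite expf_eq0 => /andP[_ /eqP].
have p0 : (0 < p)%N := prime_gt0 pr_p.
exists (c (Ordinal p0)); rewrite hb (bigD1 (Ordinal p0)) //= expr0 mulr1 big1 ?addr0 //.
move=> s hs; have s0 : s != 0%N :> nat by apply: contra hs => /eqP s0; apply/eqP/val_inj.
by rewrite (c0 s s0) expr0n gtn_eqF // mul0r.
Qed.

End PIndependence.

(** * Perfect closure *)

Section PerfectClosure.
Variables (p : nat) (K : fieldType).
Hypothesis chK : p \in [pchar K].
Local Notation D := (nat * K)%type.
Implicit Types x y z : D.

Let p0 m : (0 < p ^ m)%N.
Proof. by rewrite expn_gt0 prime_gt0 //; case/andP: chK. Qed.

(* [(m, a)] stands for the [p ^ m]-th root of [a]. *)
Definition peq x y := x.2 ^+ (p ^ y.1) == y.2 ^+ (p ^ x.1).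

Lemma peq_refl : reflexive peq. Proof. by move=> x; rewrite /peq. Qed.
Lemma peq_sym : ssrbool.symmetric peq. Proof. by move=> x y; rewrite /peq eq_sym. Qed.
Lemma peq_trans : transitive peq.
Proof.
move=> y x z /eqP xy /eqP yz; apply/eqP; apply: (expXp_inj chK (m := y.1)) => /=.
rewrite -!exprM -!expnD addnC expnD exprM xy -exprM -expnD addnC expnD exprM yz.
by rewrite -exprM -expnD addnC.
Qed.

Canonical peq_equiv := EquivRel peq peq_refl peq_sym peq_trans.
Definition perf := {eq_quot peq}%qT.
HB.instance Definition _ : EqQuotient _ peq perf := EqQuotient.on perf.
HB.instance Definition _ := Choice.on perf.

Local Notation pc := (\pi_perf)%qT.

Lemma pcP x y : reflect (pc x = pc y) (peq x y).
Proof. by apply: (iffP idP) => [/eqmodP|/eqmodP]. Qed.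

Lemma pc_shift m j (a : K) : pc (m, a) = pc ((m + j)%N, a ^+ (p ^ j)).
Proof. by apply/pcP; rewrite /peq /= -!exprM -!expnD addnC. Qed.

Lemma pc_common (u w : perf) : exists m a b, u = pc (m, a) /\ w = pc (m, b).
Proof.
elim/quotW: u => -[m a]; elim/quotW: w => -[l b].
exists (m + l)%N, (a ^+ (p ^ l)), (b ^+ (p ^ m)).
by rewrite (pc_shift m l a) (pc_shift l m b) (addnC l m).
Qed.

Lemma pc_common3 (u w t : perf) : exists m a b c,
  [/\ u = pc (m, a), w = pc (m, b) & t = pc (m, c)].
Proof.
have [m [a [b [-> ->]]]] := pc_common u w; elim/quotW: t => -[l c].
exists (m + l)%N, (a ^+ (p ^ l)), (b ^+ (p ^ l)), (c ^+ (p ^ m)).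
by rewrite (pc_shift m l a) (pc_shift m l b) (pc_shift l m c) (addnC l m).
Qed.

Lemma pc_inj m : injective (fun a => pc (m, a)).
Proof. by move=> a b /pcP /eqP /expXp_inj; apply. Qed.

Definition padd (u w : perf) : perf :=
  let x := repr u in let y := repr w in
  pc ((x.1 + y.1)%N, x.2 ^+ (p ^ y.1) + y.2 ^+ (p ^ x.1)).
Definition pmul (u w : perf) : perf :=
  let x := repr u in let y := repr w in
  pc ((x.1 + y.1)%N, x.2 ^+ (p ^ y.1) * y.2 ^+ (p ^ x.1)).
Definition popp (u : perf) : perf := let x := repr u in pc (x.1, - x.2).
Definition pinv (u : perf) : perf := let x := repr u in pc (x.1, x.2^-1).

Lemma repr_pc m (a : K) : let x := repr (pc (m, a)) in x.2 ^+ (p ^ m) = a ^+ (p ^ x.1).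
Proof. by apply/eqP; change (peq (repr (pc (m, a))) (m, a)); apply/pcP; rewrite reprK. Qed.

Lemma paddE m (a b : K) : padd (pc (m, a)) (pc (m, b)) = pc (m, a + b).
Proof.
rewrite /padd; move: (repr_pc m a) (repr_pc m b) => /=.
case: (repr _) => i x; case: (repr _) => j y /= hx hy; apply/pcP; rewrite /peq /=.
rewrite !(expXpD chK) -!exprM -!expnD; apply/eqP; congr (_ + _).
  by rewrite addnC expnD exprM hx -exprM -expnD.
by rewrite (addnC i m) expnD exprM hy -exprM -expnD (addnC j).
Qed.

Lemma pmulE m (a b : K) : pmul (pc (m, a)) (pc (m, b)) = pc (m, a * b).
Proof.
rewrite /pmul; move: (repr_pc m a) (repr_pc m b) => /=.
case: (repr _) => i x; case: (repr _) => j y /= hx hy; apply/pcP; rewrite /peq /=.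
rewrite !exprMn -!exprM -!expnD; apply/eqP; congr (_ * _).
  by rewrite addnC expnD exprM hx -exprM -expnD.
by rewrite (addnC i m) expnD exprM hy -exprM -expnD (addnC j).
Qed.

Lemma poppE m (a : K) : popp (pc (m, a)) = pc (m, - a).
Proof.
rewrite /popp; move: (repr_pc m a) => /=; case: (repr _) => i x /= hx.
by apply/pcP; rewrite /peq /= !(expXpN chK) hx.
Qed.

Lemma pinvE m (a : K) : pinv (pc (m, a)) = pc (m, a^-1).
Proof.
rewrite /pinv; move: (repr_pc m a) => /=; case: (repr _) => i x /= hx.
by apply/pcP; rewrite /peq /= !exprVn hx.
Qed.

Definition pin (a : K) : perf := pc (0%N, a).

Lemma pin0E m : pin 0 = pc (m, 0).
Proof. by rewrite /pin (pc_shift 0 m) add0n expr0n gtn_eqF. Qed.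
Lemma pin1E m : pin 1 = pc (m, 1).
Proof. by rewrite /pin (pc_shift 0 m) add0n expr1n. Qed.

Lemma paddA : associative padd.
Proof.
move=> u w t; have [m [a [b [c [-> -> ->]]]]] := pc_common3 u w t.
by rewrite !paddE addrA.
Qed.
Lemma paddC : commutative padd.
Proof. by move=> u w; have [m [a [b [-> ->]]]] := pc_common u w; rewrite !paddE addrC. Qed.
Lemma padd0 : left_id (pin 0) padd.
Proof.
by move=> u; have [m [a [_ [-> _]]]] := pc_common u u; rewrite (pin0E m) paddE add0r.
Qed.
Lemma paddN : left_inverse (pin 0) popp padd.
Proof.
move=> u; have [m [a [_ [-> _]]]] := pc_common u u.
by rewrite (pin0E m) poppE paddE addNr.
Qed.
HB.instance Definition _ := GRing.isZmodule.Build perf paddA paddC padd0 paddN.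

Lemma pmulA : associative pmul.
Proof.
move=> u w t; have [m [a [b [c [-> -> ->]]]]] := pc_common3 u w t.
by rewrite !pmulE mulrA.
Qed.
Lemma pmulC : commutative pmul.
Proof. by move=> u w; have [m [a [b [-> ->]]]] := pc_common u w; rewrite !pmulE mulrC. Qed.
Lemma pmul1 : left_id (pin 1) pmul.
Proof.
by move=> u; have [m [a [_ [-> _]]]] := pc_common u u; rewrite (pin1E m) pmulE mul1r.
Qed.
Lemma pmulDl : left_distributive pmul padd.
Proof.
move=> u w t; have [m [a [b [c [-> -> ->]]]]] := pc_common3 u w t.
by rewrite !(paddE, pmulE) mulrDl.
Qed.
Lemma pone_neq0 : pin 1 != 0.
Proof. by apply/eqP => /pc_inj /eqP; rewrite oner_eq0. Qed.
HB.instance Definition _ :=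
  GRing.Zmodule_isComNzRing.Build perf pmulA pmulC pmul1 pmulDl pone_neq0.

Lemma pmulV (u : perf) : u != 0 -> pinv u * u = 1.
Proof.
have [m [a [_ [-> _]]]] := pc_common u u => h.
have a0 : a != 0 by apply: contra h => /eqP ->; apply/eqP/esym/pin0E.
by rewrite pinvE [LHS]pmulE mulVf // -pin1E.
Qed.
Lemma pinv0 : pinv 0 = 0.
Proof. by rewrite -[LHS]/(pinv (pin 0)) /pin pinvE invr0. Qed.
HB.instance Definition _ := GRing.ComNzRing_isField.Build perf pmulV pinv0.

Lemma pin_zmod : zmod_morphism pin.
Proof. by move=> a b; rewrite /pin -[RHS]/(padd _ (popp _)) poppE paddE. Qed.
Lemma pin_monoid : monoid_morphism pin.
Proof. by split=> // a b; rewrite /pin -[RHS]/(pmul _ _) pmulE. Qed.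
HB.instance Definition _ := GRing.isZmodMorphism.Build K perf pin pin_zmod.
HB.instance Definition _ := GRing.isMonoidMorphism.Build K perf pin pin_monoid.

Lemma pcX m (a : K) l : (pc (m, a) : perf) ^+ l = pc (m, a ^+ l).
Proof.
elim: l => [|l ih]; first by rewrite !expr0 -pin1E.
by rewrite !exprS ih [LHS]pmulE.
Qed.

Lemma perfect_closure : exists (E : fieldType) (f : {rmorphism K -> E}),
  forall x : E, exists y : E, y ^+ p = x.
Proof.
exists perf, pin => x; have [m [a [_ [-> _]]]] := pc_common x x.
by exists (pc (m.+1, a)); rewrite pcX (pc_shift m 1) addn1 expn1.
Qed.

End PerfectClosure.

(** Ramification index one only: the residue extension is arbitrary, and the adjunction of [p]-th
    roots makes it inseparable. *)
Definition unramified (K : fieldType) (v : K -> int) (L : fieldType) (w : L -> int)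
    (iota : {rmorphism K -> L}) : Prop :=
  is_ndval w /\ forall x, x != 0 -> w (iota x) = v x.

Lemma unramified_vge (K : fieldType) (v : K -> int) (L : fieldType) (w : L -> int)
    (iota : {rmorphism K -> L}) : unramified v w iota ->
  forall c x, vge w c (iota x) = vge v c x.
Proof.
case=> _ h c x; rewrite /vge fmorph_eq0; have [//|x0] := eqVneq x 0.
by rewrite h.
Qed.

Lemma unramified_comp (K L E : fieldType) (v : K -> int) (w : L -> int) (u : E -> int)
    (f : {rmorphism K -> L}) (g : {rmorphism L -> E}) :
  unramified v w f -> unramified w u g -> unramified v u (g \o f).
Proof.
move=> [_ hf] [hu hg]; split=> // x x0 /=.
by rewrite hg ?fmorph_eq0 // hf.
Qed.

Lemma unramified_E2 (p : nat) (K : fieldType) (v : K -> int) (L : fieldType) (w : L -> int)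
    (iota : {rmorphism K -> L}) :
  unramified v w iota -> perfect_residue p w -> in_E2 p v w iota.
Proof.
move=> hu hp; split=> //; try by case: hu.
- by move=> x; rewrite !inOE (unramified_vge hu).
- by move=> x; rewrite !inME (unramified_vge hu).
Qed.

Lemma E2_unramified (p : nat) (K : fieldType) (v : K -> int) (L : fieldType) (w : L -> int)
    (iota : {rmorphism K -> L}) : in_E2 p v w iota -> unramified v w iota.
Proof. by case. Qed.

(** For an integral [b]: its residue is not a [p]-th power, said without the residue field. *)
Definition nonpth (p : nat) (L : fieldType) (w : L -> int) (b : L) :=
  forall c, inO w c -> ~~ inM w (b - c ^+ p).

Section ResiduePth.
Variables (p : nat) (L : fieldType) (w : L -> int) (Hw : is_ndval w).
Hypothesis chL : p \in [pchar L].

Let pr_p : prime p. Proof. by case/andP: chL. Qed.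

Lemma nonpth_res b : inO w b -> nonpth p w b -> ~ pth p (res Hw b).
Proof.
move=> hb nb [c hc]; have [c' hc' e] := res_surj c.
move: hc; rewrite -e -resX // => /eqP; rewrite res_eq //; last exact: inOX.
by apply/negP; apply: nb.
Qed.

(** Dividing by a coefficient of least valuation leaves a sum whose residue is nonzero by
    [p_independent]. The valuation is thus a multiple of [p], so a [p]-th root of the sum has an
    integral valuation. *)
Lemma min_val (a : L) (c : 'I_p -> L) : inO w a -> nonpth p w a ->
  (exists s, c s != 0) ->
  exists z, [/\ \sum_(s < p) c s ^+ p * a ^+ s != 0,
    w (\sum_(s < p) c s ^+ p * a ^+ s) = p%:Z * z & forall s, vge w z (c s)].
Proof.
move=> ha na [s1 cs1].
have [s0 cs0 smin] : exists2 s0, c s0 != 0 & forall s, c s != 0 -> w (c s0) <= w (c s).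
  by case: (@Order.TotalTheory.arg_minP _ int _ s1 (fun s => c s != 0) (fun s => w (c s)) cs1)
     => s0 h1 h2; exists s0.
have hz s : vge w (w (c s0)) (c s).
  by rewrite /vge; case: eqVneq => //= h; apply: smin.
pose d s := c s / c s0.
have hd s : inO w (d s).
  rewrite inOE -(subrr (w (c s0))); apply: (vgeM Hw) => //.
  by rewrite vgeE ?invr_eq0 // (vV Hw).
have hda s : inO w (d s ^+ p * a ^+ s) by apply: inOM => //; apply: inOX.
have dO : inO w (\sum_(s < p) d s ^+ p * a ^+ s) by apply: inO_sum.
have dM : ~~ inM w (\sum_(s < p) d s ^+ p * a ^+ s).
  rewrite -(res_eq0 Hw) // res_sum //; apply/eqP.
  rewrite (eq_bigr (fun s : 'I_p => res Hw (d s) ^+ p * res Hw a ^+ s)); last first.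
    by move=> s _; rewrite resM ?resX // inOX.
  move=> /(p_independent (resfield_pchar Hw chL) (nonpth_res ha na))/(_ s0).
  by rewrite /d divff // res1 => /eqP; rewrite oner_eq0.
have [d0 vd] := inO_unit dO dM.
have e : \sum_(s < p) c s ^+ p * a ^+ s = c s0 ^+ p * \sum_(s < p) d s ^+ p * a ^+ s.
  rewrite mulr_sumr; apply: eq_bigr => s _.
  by rewrite mulrA -exprMn /d [c s0 * _]mulrC divfK.
exists (w (c s0)); rewrite e mulf_neq0 ?expf_neq0 //; split=> //.
by rewrite (vM Hw) ?expf_neq0 // vd (vX Hw) // addr0.
Qed.

End ResiduePth.

(** * Extensions with [e = 1] inside a perfect field *)

Section Extensions.
Variables (p : nat) (K : fieldType) (v : K -> int) (Hv : is_ndval v).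
Hypothesis chK : p \in [pchar K].
Variables (E : fieldType) (f : {rmorphism K -> E}).
Hypothesis perfE : forall x : E, exists y : E, y ^+ p = x.

Let pr_p : prime p. Proof. by case/andP: chK. Qed.
Let p0 m : (0 < p ^ m)%N. Proof. by rewrite expn_gt0 prime_gt0. Qed.
Let chE : p \in [pchar E]. Proof. exact: (rmorph_pchar f). Qed.

(* The valuation of [E] extending [v] is not integral; only its integral values matter. *)
Definition isval (x : E) (z : int) := exists m a, x ^+ (p ^ m) = f a /\ v a = (p ^ m)%:Z * z.

Lemma isval_det x z m a : x != 0 -> isval x z -> x ^+ (p ^ m) = f a -> v a = (p ^ m)%:Z * z.
Proof.
move=> x0 [l [b [hb vb]]] ha.
have nz i y : x ^+ (p ^ i) = f y -> y != 0.
  by move=> h; rewrite -(fmorph_eq0 f) -h expf_neq0.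
have e : f (a ^+ (p ^ l)) = f (b ^+ (p ^ m)).
  by rewrite !rmorphXn -ha -hb -!exprM mulnC.
have /(congr1 v) := fmorph_inj f e.
have a0 := nz m a ha; have b0 := nz l b hb; rewrite !(vX Hv) // vb.
have := p0 l; have := p0 m; move: (p ^ l)%N (p ^ m)%N => P Q; nia.
Qed.

Lemma isval_f a : isval (f a) (v a).
Proof. by exists 0%N, a; rewrite expn0 expr1; split=> //; lia. Qed.

Lemma isval_uniq x z z' : x != 0 -> isval x z -> isval x z' -> z = z'.
Proof.
move=> x0 h [m [a [ha va]]]; have := isval_det x0 h ha; rewrite va.
have := p0 m; nia.
Qed.

Lemma isval_root x z : isval (x ^+ p) (p%:Z * z) -> isval x z.
Proof.
case=> m [a [ha va]]; exists m.+1, a; split; first by rewrite expnS exprM.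
by rewrite va expnS; lia.
Qed.

Lemma isval_common x y z z' : x != 0 -> y != 0 -> isval x z -> isval y z' ->
  exists m a b, [/\ x ^+ (p ^ m) = f a, y ^+ (p ^ m) = f b,
    v a = (p ^ m)%:Z * z & v b = (p ^ m)%:Z * z'].
Proof.
move=> x0 y0 hx hy; case: (hx) => m [a [ha va]]; case: (hy) => l [b [hb vb]].
exists (m + l)%N, (a ^+ (p ^ l)), (b ^+ (p ^ m)).
have e1 : x ^+ (p ^ (m + l)) = f (a ^+ (p ^ l)) by rewrite expnD exprM ha rmorphXn.
have e2 : y ^+ (p ^ (m + l)) = f (b ^+ (p ^ m)) by rewrite addnC expnD exprM hb rmorphXn.
by split=> //; [apply: (isval_det x0 hx e1) | apply: (isval_det y0 hy e2)].
Qed.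

Lemma isvalM x y z z' : x != 0 -> y != 0 -> isval x z -> isval y z' -> isval (x * y) (z + z').
Proof.
move=> x0 y0 hx hy; have [m [a [b [ha hb va vb]]]] := isval_common x0 y0 hx hy.
exists m, (a * b); split; first by rewrite exprMn ha hb rmorphM.
by rewrite (vM Hv) ?va ?vb ?mulrDr //; rewrite -(fmorph_eq0 f) -?ha -?hb expf_neq0.
Qed.

Lemma isvalD x y z z' z'' : x != 0 -> y != 0 -> x + y != 0 ->
  isval x z -> isval y z' -> isval (x + y) z'' -> Num.min z z' <= z''.
Proof.
move=> x0 y0 s0 hx hy hs; have [m [a [b [ha hb va vb]]]] := isval_common x0 y0 hx hy.
have e : (x + y) ^+ (p ^ m) = f (a + b) by rewrite (expXpD chE) ha hb rmorphD.
have := isval_det s0 hs e; case: Hv => _ _ /(_ a b).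
rewrite -!(fmorph_eq0 f) -e -ha -hb !expf_neq0 // => /(_ isT isT isT) h vs.
move: h; rewrite vs va vb !ge_min; have := p0 m; move: (p ^ m)%N => P; nia.
Qed.

(** Intermediate fields of ramification index one: integrality of all values says that the value
    group has not grown. *)
Definition good (S : E -> Prop) :=
  [/\ is_subfield S, forall a, S (f a) & forall x, S x -> x != 0 -> exists z, isval x z].

Definition realises (S : E -> Prop) (L : fieldType) (w : L -> int) (g : {rmorphism L -> E}) :=
  [/\ is_ndval w, forall x, S x <-> exists y, g y = x & forall y, y != 0 -> isval (g y) (w y)].

Lemma good_type S : good S -> exists (L : fieldType) (w : L -> int)
  (g : {rmorphism L -> E}) (iota : {rmorphism K -> L}),
  [/\ realises S w g, unramified v w iota & forall a, g (iota a) = f a].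
Proof.
case=> HS Sf Sv; have [L [g hg]] := subfield_type HS.
have /boolp.choice[w hw] : forall y : L, exists z, y != 0 -> isval (g y) z.
  move=> y; have [->|y0] := eqVneq y 0; first by exists 0.
  have Sy : S (g y) by apply/hg; exists y.
  have gy0 : g y != 0 by rewrite fmorph_eq0.
  have [z hz] := Sv _ Sy gy0.
  by exists z.
have /boolp.choice[h hh] : forall a, exists y, g y = f a by move=> a; apply/hg.
have h1 : zmod_morphism h.
  by move=> a b; apply: (fmorph_inj g); rewrite rmorphB !hh rmorphB.
have h2 : monoid_morphism h.
  split; first by apply: (fmorph_inj g); rewrite hh !rmorph1.
  by move=> a b; apply: (fmorph_inj g); rewrite rmorphM !hh rmorphM.
pose A := GRing.isZmodMorphism.Build K L h h1.
pose B := GRing.isMonoidMorphism.Build K L h h2.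
pose iota : {rmorphism K -> L} := HB.pack h A B.
have g0 y : y != 0 -> g y != 0 by rewrite fmorph_eq0.
have wf x : x != 0 -> w (iota x) = v x.
  move=> x0; have x0' : iota x != 0 by rewrite fmorph_eq0.
  apply: (isval_uniq (g0 _ x0') (hw _ x0')).
  by rewrite [g _]hh; apply: isval_f.
have Hw : is_ndval w.
  split.
  - case: Hv => -[t [t0 vt]] _ _; exists (iota t); split; last by rewrite wf.
    by rewrite fmorph_eq0.
  - move=> x y x0 y0; have xy0 := mulf_neq0 x0 y0.
    apply: (isval_uniq (g0 _ xy0) (hw _ xy0)); rewrite rmorphM.
    by apply: isvalM; auto.
  - move=> x y x0 y0 s0; apply: (isvalD (g0 _ x0) (g0 _ y0)); auto; rewrite -rmorphD; auto.
by exists L, w, g, iota; split=> //; split.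
Qed.

Lemma good_base : good (fun x => exists a, f a = x).
Proof.
split; last 2 first.
- by move=> a; exists a.
- by move=> _ [a <-] _; exists (v a); apply: isval_f.
split; first by exists 1; rewrite rmorph1.
  by move=> _ _ [a <-] [b <-]; exists (a - b); rewrite rmorphB.
by move=> _ _ [a <-] [b <-]; exists (a / b); rewrite fmorph_div.
Qed.

(** The [p]-th power of a nonzero element of [L(x)] is a combination of the [a ^+ s] with [p]-th
    powers as coefficients, whose valuation is a multiple of [p] by [min_val]. *)
Lemma good_adjoin S (L : fieldType) (w : L -> int) (g : {rmorphism L -> E}) (a : L) (x : E) :
  good S -> realises S w g -> inO w a -> nonpth p w a -> x ^+ p = g a ->
  good (adjoin_root g x).
Proof.
move=> [HS Sf Sv] [Hw Sg gw] ha na hx.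
have chL : p \in [pchar L] := pchar_sub g chE.
split; first exact: (adjoin_root_subfield chE hx).
  by move=> c; have /Sg[y <-] := Sf c; apply: adjoin_root_base.
move=> y hy y0; have [c hc] := adjoin_rootP chE hx hy.
have e := sum_pth_power chE hx c; rewrite -hc in e.
have [|z [z0 hz _]] := min_val Hw chL ha na (c := c).
  apply/existsP; apply: contraR y0 => /existsPn h; rewrite hc big1 // => s _.
  by have := h s; rewrite negbK => /eqP ->; rewrite rmorph0 mul0r.
by exists z; apply: isval_root; rewrite e -hz; apply: gw.
Qed.

Lemma good_zorn (q : E -> Prop) S0 : good S0 -> (forall x, S0 x -> q x) ->
  exists S, [/\ good S, forall x, S0 x -> S x, forall x, S x -> q x &
    forall S', good S' -> (forall x, S x -> S' x) -> (forall x, S' x -> q x) ->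
      forall x, S' x -> S x].
Proof.
move=> g0 q0.
pose P (A : classical_sets.set E) := (forall x, ~ A x) \/
  [/\ good A, forall x, S0 x -> A x & forall x, A x -> q x].
have [|A [PA Amax]] := @classical_sets.Zorn_bigcup E P.
  move=> C CP Ctot.
  have [[X CX [x Xx]]|none] := boolp.pselect (exists2 X, C X & exists x, X x); last first.
    by left=> x [X CX Xx]; apply: none; exists X => //; exists x.
  have nice Y y : C Y -> Y y -> [/\ good Y, forall x, S0 x -> Y x & forall x, Y x -> q x].
    by move=> CY Yy; have [h|//] := CP Y CY; case: (h y).
  have common y z : classical_sets.bigcup C id y -> classical_sets.bigcup C id z ->
      exists Y, [/\ C Y, Y y & Y z].
    move=> [Y CY Yy] [Z CZ Zz]; have [h|h] := Ctot Y Z CY CZ.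
      by exists Z; split=> //; apply: h.
    by exists Y; split=> //; apply: h.
  have [[sX fX vX] XS0 Xq] := nice X x CX Xx.
  right; split.
  - split.
    + split; first by exists X => //; case: sX.
        move=> y z hy hz; have [Y [CY Yy Yz]] := common _ _ hy hz.
        by have [[sY _ _] _ _] := nice Y y CY Yy; exists Y => //; apply: (sfB sY).
      move=> y z hy hz; have [Y [CY Yy Yz]] := common _ _ hy hz.
      have [[sY _ _] _ _] := nice Y y CY Yy; exists Y => //.
      by apply: (sfM sY) => //; apply: (sfV sY).
    + by move=> a; exists X.
    + by move=> y [Y CY Yy]; have [[_ _ vY] _ _] := nice Y y CY Yy; apply: vY.
  - by move=> y hy; exists X => //; apply: XS0.
  - by move=> y [Y CY Yy]; have [_ _ qY] := nice Y y CY Yy; apply: qY.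
have P0 : P S0 by right.
have S01 : S0 1 by case: g0 => h _ _; apply: (sf1 h).
case: PA => [Aempty|[gA AS0 Aq]].
  exfalso; apply: (Amax S0) => //; split; first by move=> x /Aempty.
  by move=> /(_ 1 S01); apply: Aempty.
exists A; split=> // S' gS' AS' qS' x S'x; apply: boolp.contrapT => nAx.
apply: (Amax S'); last by right; split=> // y hy; apply/AS'/AS0.
by split=> // /(_ x S'x).
Qed.

(** A maximal good subfield has a perfect residue field: if the residue of [a] were not a [p]-th
    power, [good_adjoin] would allow a root of [a] to be adjoined. By maximality that root is
    already present, a contradiction. *)
Lemma unramified_perfect : exists (L : fieldType) (w : L -> int) (iota : {rmorphism K -> L}),
  unramified v w iota /\ perfect_residue p w.
Proof.
have [S [gS _ _ Smax]] := @good_zorn (fun=> True) _ good_base (fun _ _ => I).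
have [L [w [g [iota [hr hu _]]]]] := good_type gS.
exists L, w, iota; split=> // a ha; apply: boolp.contrapT => na.
have na' : nonpth p w a by move=> c hc; apply/negP => h; apply: na; exists c.
have [x hx] := perfE (g a).
case: (hr) => Hw Sg gw.
have base y : S y -> adjoin_root g x y by move/Sg => [u <-]; apply: adjoin_root_base.
have /Sg[y gy] := Smax _ (good_adjoin gS hr ha na' hx) base (fun _ _ => I) x
  (adjoin_root_gen g x).
have ay : a = y ^+ p.
  by apply: (fmorph_inj g); rewrite rmorphXn gy hx.
have yO : inO w y by rewrite -(inO_expE Hw _ (prime_gt0 pr_p)) -ay.
by move: (na' y yO); rewrite ay subrr inM0.
Qed.

Lemma unramified_root (b : K) : inO v b -> nonpth p v b ->
  exists (L : fieldType) (w : L -> int) (iota : {rmorphism K -> L}),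
  unramified v w iota /\ exists y, iota b = y ^+ p.
Proof.
move=> hb nb; have [x hx] := perfE (f b).
have hr : realises (fun x => exists a, f a = x) v f.
  by split=> // y _; apply: isval_f.
have gS := good_adjoin good_base hr hb nb hx.
have [L [w [g [iota [[_ Sg _] hu hg]]]]] := good_type gS.
exists L, w, iota; split=> //; have /Sg[y hy] := adjoin_root_gen f x.
by exists y; apply: (fmorph_inj g); rewrite hg rmorphXn hy.
Qed.

(** Take a good subfield maximal among those where the residue of [b] is not a [p]-th power. If the
    residue of [a] is not one either, adjoining a root of [a] must make that of [b] a [p]-th power,
    so [b] is residually a combination of the [a ^+ s]; [p_exchange] reverses the roles. *)
Lemma unramified_pbasis (b : K) : inO v b -> nonpth p v b ->
  exists (L : fieldType) (w : L -> int) (iota : {rmorphism K -> L}),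
  [/\ unramified v w iota, nonpth p w (iota b) &
   forall a, inO w a -> exists2 c : 'I_p -> L, (forall s, inO w (c s)) &
     inM w (a - \sum_(s < p) c s ^+ p * iota b ^+ s)].
Proof.
move=> hb nb.
(* [q y] says that [y ^+ p] is not congruent to [b] modulo the maximal ideal. It is phrased inside
   [E], so that it does not depend on the subfield containing [y]. *)
pose q (y : E) := ~ (f b - y ^+ p = 0 \/ exists2 z, 0 < z & isval (f b - y ^+ p) z).
have qE (L : fieldType) (w : L -> int) (g : {rmorphism L -> E}) (iota : {rmorphism K -> L}) y u :
    (forall y, y != 0 -> isval (g y) (w y)) -> (forall a, g (iota a) = f a) -> y ^+ p = g u ->
    q y <-> ~~ inM w (iota b - u).
  move=> gw hg hy; rewrite /q /inM.
  have -> : f b - y ^+ p = g (iota b - u) by rewrite rmorphB hg hy.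
  have [->|d0] := eqVneq (iota b - u) 0; first by split=> // h; exfalso; apply: h; left; rewrite rmorph0.
  split=> [h|/negP h]; first by apply/negP => h'; apply: h; right; exists (w (iota b - u)); auto.
  case=> [/eqP|[z z0 hz]]; first by rewrite fmorph_eq0 (negbTE d0).
  have gd0 : g (iota b - u) != 0 by rewrite fmorph_eq0.
  by apply: h; rewrite /= (isval_uniq gd0 (gw _ d0) hz).
have [|S [gS S0S Sq Smax]] := @good_zorn q _ good_base.
  move=> _ [c <-].
  have -> := @qE K v f idfun (f c) (c ^+ p) (fun y _ => isval_f y) (fun=> erefl) (esym (rmorphXn f p c)).
  have [hc|hc] := boolP (inO v c); first exact: nb.
  apply/negP => h; move/negP: hc; apply.
  have cO : inO v (c ^+ p) by rewrite -[c ^+ p](subKr b); apply: inOB => //; apply: inM_inO h.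
  by rewrite -(inO_expE Hv _ (prime_gt0 pr_p)).
have [L [w [g [iota [hr hu hg]]]]] := good_type gS.
case: (hr) => Hw Sg gw.
have chL : p \in [pchar L] := pchar_sub g chE.
have nib : nonpth p w (iota b).
  move=> c hc; have [h _] := @qE L w g iota (g c) (c ^+ p) gw hg (esym (rmorphXn g p c)).
  by apply/h/Sq/Sg; exists c.
have ibO : inO w (iota b) by rewrite inOE (unramified_vge hu).
exists L, w, iota; split=> // a ha.
have p_gt0 := prime_gt0 pr_p.
have [[c hc hac]|na] := boolp.pselect (exists2 c, inO w c & inM w (a - c ^+ p)).
  exists (fun s => if s == Ordinal p_gt0 then c else 0).
    by move=> s; case: ifP => // _; apply: inO0.
  rewrite (bigD1 (Ordinal p_gt0)) //= expr0 mulr1 big1 ?addr0 // => s /negbTE ->.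
  by rewrite expr0n gtn_eqF // mul0r.
have na' : nonpth p w a by move=> c hc; apply/negP => h; apply: na; exists c.
have [x hx] := perfE (g a).
have base y : S y -> adjoin_root g x y by move/Sg => [u <-]; apply: adjoin_root_base.
have [c hcM] : exists c : 'I_p -> L, inM w (iota b - \sum_(s < p) c s ^+ p * a ^+ s).
  apply: boolp.contrapT => none.
  have hq y : adjoin_root g x y -> q y.
    move=> /(adjoin_rootP chE hx)[c hc].
    have e := sum_pth_power chE hx c; rewrite -hc in e.
    by apply/(qE L w g iota y _ gw hg e); apply/negP => h; apply: none; exists c.
  have := Smax _ (good_adjoin gS hr ha na' hx) base hq x (adjoin_root_gen g x).
  move=> /Sg[y gy]; have ay : a = y ^+ p.
    by apply: (fmorph_inj g); rewrite rmorphXn gy hx.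
  have yO : inO w y by rewrite -(inO_expE Hw _ p_gt0) -ay.
  by move: (na' y yO); rewrite ay subrr inM0.
have sO : inO w (\sum_(s < p) c s ^+ p * a ^+ s).
  rewrite -[X in inO w X](subKr (iota b)); apply: inOB => //; exact: inM_inO.
(* The sum is integral and by [min_val] its valuation is [p] times a lower bound for those of the
   coefficients. *)
have cO s : inO w (c s).
  have [h|h] := boolp.pselect (exists s, c s != 0); last first.
    suff -> : c s = 0 by apply: inO0.
    by apply/eqP; apply: boolp.contrapT => h'; apply: h; exists s; apply/negP.
  have [z [s0 hz cz]] := min_val Hw chL ha na' h.
  move: sO; rewrite inOE vgeE // hz => z0.
  by apply: vge_le (cz s); rewrite pmulr_rge0 in z0.
have e : res Hw (iota b) = \sum_(s < p) res Hw (c s) ^+ p * res Hw a ^+ s.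
  apply/eqP; rewrite -subr_eq0.
  rewrite (eq_bigr (fun s : 'I_p => res Hw (c s ^+ p * a ^+ s))); last first.
    by move=> s _; rewrite resM ?resX // inOX.
  rewrite -res_sum; last by move=> s _; apply: inOM => //; apply: inOX.
  by rewrite subr_eq0 res_eq.
have [d hd] := p_exchange (resfield_pchar Hw chL) (nonpth_res ibO nib) e.
have /boolp.choice[d' hd'] : forall s, exists x, inO w x /\ res Hw x = d s.
  by move=> s; have [y hy <-] := res_surj (d s); exists y.
have dO s : inO w (d' s) by case: (hd' s).
exists d' => //; rewrite -(res_eq Hw) //; last first.
  by apply: inO_sum => // s _; apply: inOM => //; apply: inOX.
rewrite res_sum; last by move=> s _; apply: inOM => //; apply: inOX.
apply/eqP; rewrite {1}hd; apply: eq_bigr => s _.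
by rewrite resM ?resX // ?inOX //; case: (hd' s) => _ ->.
Qed.

End Extensions.

(** * The obstruction to lowering the conductor *)

Section UnramifiedExtensions.
Variables (p : nat) (K : fieldType) (v : K -> int).
Hypotheses (Hv : is_ndval v) (chK : p \in [pchar K]).

Lemma exists_perfect : exists (L : fieldType) (w : L -> int) (iota : {rmorphism K -> L}),
  unramified v w iota /\ perfect_residue p w.
Proof. by have [E [f hf]] := perfect_closure chK; apply: (unramified_perfect Hv chK f). Qed.

Lemma exists_root (b : K) : inO v b -> nonpth p v b ->
  exists (L : fieldType) (w : L -> int) (iota : {rmorphism K -> L}),
  unramified v w iota /\ exists y, iota b = y ^+ p.
Proof. by have [E [f hf]] := perfect_closure chK; apply: (unramified_root Hv chK f). Qed.

Lemma exists_pbasis (b : K) : inO v b -> nonpth p v b ->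
  exists (L : fieldType) (w : L -> int) (iota : {rmorphism K -> L}),
  [/\ unramified v w iota, nonpth p w (iota b) &
   forall a, inO w a -> exists2 c : 'I_p -> L, (forall s, inO w (c s)) &
     inM w (a - \sum_(s < p) c s ^+ p * iota b ^+ s)].
Proof. by have [E [f hf]] := perfect_closure chK; apply: (unramified_pbasis Hv chK f). Qed.

End UnramifiedExtensions.

(* The leading coefficients of a vector form a Witt vector over the residue field whose
   image under [F^(n-1) d] is this sum; it vanishes only on [F]-images. *)
Lemma p_independent_tower p (F : fieldType) (chF : p \in [pchar F]) (B : F) J
    (C : nat -> 'I_p -> F) : ~ pth p B ->
  \sum_(j < J) \sum_(s < p) s%:R * (C j s ^+ p * B ^+ s) ^+ (p ^ j) = 0 ->
  forall j (s : 'I_p), (j < J)%N -> s != 0%N :> nat -> C j s = 0.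
Proof.
have pr_p : prime p by case/andP: chF.
move=> nB; elim: J C => [|J ih] C //.
rewrite big_ord_recl /=.
pose Y := \sum_(j < J) \sum_(s < p) s%:R * (C j.+1 s ^+ p * B ^+ s) ^+ (p ^ j).
have -> : \sum_(j < J) \sum_(s < p) s%:R * (C (bump 0 j) s ^+ p * B ^+ s) ^+ (p ^ bump 0 j)
    = Y ^+ p.
  rewrite -(pFrobenius_autE chF) rmorph_sum; apply: eq_bigr => j _.
  rewrite rmorph_sum; apply: eq_bigr => s _.
  by rewrite rmorphM rmorph_nat /= pFrobenius_autE -exprM -expnSr.
move=> h; have p0 := prime_gt0 pr_p.
(* The term [s = 0] of index [j = 0] carries the factor 0, which frees the place of [B ^+ 0] for
   [Y ^+ p], the sum of all terms with [j > 0]. The factors [s%:R] are their own [p]-th powers. *)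
pose d (s : 'I_p) := if s == Ordinal p0 then Y else s%:R * C 0%N s.
have hd : \sum_(s < p) d s ^+ p * B ^+ s = 0.
  rewrite -[RHS]h (bigD1 (Ordinal p0)) //= [in RHS](bigD1 (Ordinal p0)) //= {1}/d eqxx.
  rewrite !expr0 mulr1 mul0r add0r addrC; congr (_ + _).
  apply: eq_bigr => s /negbTE s0; rewrite /d s0 exprMn expn0 expr1 -mulrA.
  by rewrite -(pFrobenius_autE chF s%:R) rmorph_nat.
have d0 := p_independent chF nB hd.
have sN0 (s : 'I_p) : s != 0%N :> nat -> (s == Ordinal p0) = false.
  by move=> s0; apply/negbTE; apply: contra s0 => /eqP ->.
move=> [|j] s hj s0.
  have := d0 s; rewrite /d sN0 // => /eqP; rewrite mulf_eq0 => /orP[|/eqP //].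
  by rewrite -(dvdn_pcharf chF) gtnNdvd // lt0n.
apply: (ih (fun j => C j.+1)) => //.
by have := d0 (Ordinal p0); rewrite /d eqxx.
Qed.

(** * Base change along an extension with [e = 1] *)

Section Transfer.
Variables (p : nat) (pr_p : prime p) (n : nat).
Variables (K : fieldType) (v : K -> int) (Hv : is_ndval v) (chK : p \in [pchar K]).
Variables (L : fieldType) (w : L -> int) (Hw : is_ndval w) (chL : p \in [pchar L]).
Variable iota : {rmorphism K -> L}.
Hypothesis hu : unramified v w iota.
Variable pi : K.
Hypotheses (pi0 : pi != 0) (vpi : v pi = 1).
Implicit Types (a : wittv pr_p n K) (m k : nat).

Let ipi0 : iota pi != 0. Proof. by rewrite fmorph_eq0. Qed.
Let wpi : w (iota pi) = 1. Proof. by case: hu => _ ->. Qed.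

Lemma wmap_cond (P : int -> bool) a k :
  (wx (wmap iota a) k == 0) || P (w (wx (wmap iota a) k)) = (wx a k == 0) || P (v (wx a k)).
Proof.
rewrite wx_wmap fmorph_eq0; have [//|a0] := eqVneq (wx a k) 0.
by case: hu => _ ->.
Qed.

Lemma fil_wmap m a : fil v m a -> fil w m (wmap iota a).
Proof.
move=> h i hi; have := h i hi.
by rewrite (wmap_cond (fun z => - m%:Z <= (p ^ (n.-1 - i))%:Z * z)).
Qed.

Lemma sym_wmap_eq0 m a k : (k < n)%N -> fil v m a ->
  (wx (sym Hw (iota pi) m (wmap iota a)) k == 0) = (wx (sym Hv pi m a) k == 0).
Proof.
move=> hk ha; have ha' := fil_wmap ha.
rewrite (sym_eq0 Hv chK pi0 vpi) // (sym_eq0 Hw chL ipi0 wpi) //.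
exact: (wmap_cond (fun z => - m%:Z < (p ^ (n.-1 - k))%:Z * z)).
Qed.

Lemma low_sym_wmap m a k : fil v m a -> low k (sym Hv pi m a) ->
  low k (sym Hw (iota pi) m (wmap iota a)).
Proof.
move=> ha la l hl; have [hln|hln] := ltnP l n; last by rewrite wx_ge.
by apply/eqP; rewrite sym_wmap_eq0 // la.
Qed.

Lemma flat_wmap m a : flat Hv pi m a -> flat Hw (iota pi) m (wmap iota a).
Proof.
move=> [ha la]; split; first exact: fil_wmap.
by move=> m0; apply: low_sym_wmap; auto.
Qed.

Lemma lead_wmap m a k : lead (iota pi) m (wmap iota a) k = iota (lead pi m a k).
Proof. by rewrite /lead wx_wmap rmorphM rmorphXn. Qed.

Lemma pterm_wmap m l c b s :
  wmap iota (pterm pr_p n pi m l c b s) = pterm pr_p n (iota pi) m l (iota c) (iota b) s.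
Proof. by rewrite /pterm wmap_wdelta !rmorphM fmorphV !rmorphXn. Qed.

Lemma pcoef_rmorph l c b s : iota (pcoef p n l c b s) = pcoef p n l (iota c) (iota b) s.
Proof. by rewrite /pcoef !rmorphM rmorph_nat !rmorphXn rmorphM !rmorphXn. Qed.

Lemma wmap_wF a : wmap iota (wF chK a) = wF chL (wmap iota a).
Proof. by apply: wxW_inj => i _; rewrite wx_wmap !wx_wF wx_wmap rmorphXn. Qed.

End Transfer.

Lemma big_nat_rev_ord (V : nmodType) k n (G : nat -> V) :
  \sum_(k <= l < n) G l = \sum_(j < n - k) G (n.-1 - j)%N.
Proof.
rewrite big_nat_rev -[X in index_iota X n]add0n big_addn big_mkord.
by apply: eq_bigr => j _; congr G; have := ltn_ord j; lia.
Qed.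

(** * A leading coefficient whose residue is not a [p]-th power *)

Section Obstruction.
Variables (p : nat) (pr_p : prime p) (n : nat).
Variables (K : fieldType) (v : K -> int) (Hv : is_ndval v) (chK : p \in [pchar K]).
Variable pi : K.
Hypotheses (pi0 : pi != 0) (vpi : v pi = 1).
Local Notation W := (wittv pr_p n K).
Implicit Types (a x y : W) (m k : nat).

(** No bound is imposed on [w], so the notion depends on [a] only modulo [F]-images over [K]. *)
Definition obstructed m a := exists (K' : fieldType) (v' : K' -> int) (iota : {rmorphism K -> K'}),
  in_E2 p v v' iota /\
  forall (ch' : p \in [pchar K']) z w, fil v' m.-2 z -> wmap iota a <> z + wF ch' w.

Lemma obstructed_subF m a y : obstructed m (a - wF chK y) -> obstructed m a.
Proof.
case=> K' [v' [iota [hE h]]]; exists K', v', iota; split=> // ch' z w hz E.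
apply: (h ch' z (w - wmap iota y) hz).
by rewrite !raddfB /= E addrA (wmap_wF chK ch').
Qed.

Lemma obstructed_nonpth m a k : (0 < m)%N -> (k < n)%N -> (n - logn p m <= k)%N ->
  fil v m a -> low k (sym Hv pi m a) -> nonpth p v (lead pi m a k) -> obstructed m a.
Proof.
(* Without an obstruction a decomposition exists over every field of [E_2], in particular over the
   two fields to be compared. *)
move=> m0 hk hkm ha la nb; apply: boolp.contrapT => nobs.
have n0 : (0 < n)%N by apply: leq_ltn_trans hk.
have hd : (p ^ (n.-1 - k).+1 %| m)%N by rewrite pfactor_log //; clear -hk hkm; lia.
have hd' : (p ^ (n.-1 - k) %| m)%N by apply: dvdn_trans hd; rewrite dvdn_exp2l.
have pm : (p %| m)%N by apply: dvdn_trans hd; rewrite expnS dvdn_mulr.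
have b0O := leadO Hv chK pi0 vpi hk hd' ha; set b0 := lead pi m a k in nb b0O.
have [L [w [iota [hu nib pbasis]]]] := exists_pbasis Hv chK b0O nb.
have [Hw _] := hu; have chL : p \in [pchar L] := rmorph_pchar iota chK.
set b := iota b0 in nib pbasis.
have bO : inO w b by rewrite inOE (unramified_vge hu).
have ipi0 : iota pi != 0 by rewrite fmorph_eq0.
have wpi : w (iota pi) = 1 by case: hu => _ ->.
have ha' := fil_wmap hu ha.
have la' : low k (sym Hw (iota pi) m (wmap iota a)) by apply: low_sym_wmap la.
have [c [cO hck hrest]] := decompose (Hv := Hw) chL ipi0 wpi m0 bO pbasis hkm ha' la'.
set S := \sum_(k <= l < n) _ in hrest.
set rest := _ - S in hrest.
have obs t : inO w t -> inM w (lead (iota pi) m.-1 rest n.-1 +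
    t * \sum_(k <= l < n) \sum_(s < p) pcoef p n l (c l s) b s).
  move=> tO.
  have tpM : inM w (t * iota pi) by apply: inMMr => //; rewrite inME vgeE // wpi.
  have btO : inO w (b - t * iota pi) by apply: inOB => //; apply: inM_inO.
  (* The shift by [t * pi] does not change the residue, so a [p]-th root can be adjoined with
     [e = 1]. *)
  have nbt : nonpth p w (b - t * iota pi).
    move=> d hd0; apply: contra (nib d hd0) => h.
    have -> : b - d ^+ p = b - t * iota pi - d ^+ p + t * iota pi by ring.
    exact: inMD.
  have [L1 [w1 [iota1 [hu1 [beta hbeta]]]]] := exists_root Hw chL btO nbt.
  have [Hw1 _] := hu1; have chL1 : p \in [pchar L1] := rmorph_pchar iota1 chL.
  have [K' [v' [iota2 [hu2 perf]]]] := exists_perfect Hw1 chL1.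
  have [Hv' _] := hu2; have ch' : p \in [pchar K'] := rmorph_pchar iota2 chL1.
  pose j : {rmorphism L -> K'} := iota2 \o iota1.
  have huj : unramified w v' j := unramified_comp hu1 hu2.
  have hE : in_E2 p v v' (j \o iota) by apply: unramified_E2 (unramified_comp hu huj) perf.
  have [z [u [hz E]]] : exists z u, fil v' m.-2 z /\ wmap (j \o iota) a = z + wF ch' u.
    apply: boolp.contrapT => none; apply: nobs; exists K', v', (j \o iota).
    by split=> // ch'' z u hz E; apply: none; exists z, u.
  have jpi0 : j (iota pi) != 0 by rewrite fmorph_eq0.
  have vjpi : v' (j (iota pi)) = 1 by case: huj => _ ->.
  have jO (x : L) : inO v' (j x) = inO w x by rewrite !inOE (unramified_vge huj).
  have bE : j b = iota2 beta ^+ p + j t * j (iota pi).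
    rewrite -rmorphXn -hbeta -[iota2 (iota1 _)]/(j _) rmorphB rmorphM.
    by rewrite subrK.
  have betaO : inO v' (iota2 beta).
    rewrite -(inO_expE Hv' _ (prime_gt0 pr_p)) -rmorphXn -hbeta -[iota2 (iota1 _)]/(j _).
    by rewrite jO.
  have Erest : \sum_(k <= l < n) \sum_(s < p)
      pterm pr_p n (j (iota pi)) m l (j (c l s)) (j b) s + wmap j rest = z + wF ch' u.
    rewrite -E.
    have -> : wmap (j \o iota) a = wmap j S + wmap j rest.
      rewrite -raddfD /= /rest addrC subrK.
      by apply: wxW_inj => i _; rewrite !wx_wmap.
    congr (_ + _); rewrite /S raddf_sum; apply: eq_bigr => l _.
    by rewrite raddf_sum; apply: eq_bigr => s _; rewrite /= pterm_wmap.
  have := pterm_obstruction Hv' jpi0 vjpi n0 m0 pm hkm _ _ betaO bE (fil_wmap huj hrest)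
    hz Erest.
  rewrite jO lead_wmap => /(_ (fun l s => _) tO) h.
  have {}h := h (fun l s => etrans (jO (c l s)) (cO l s)).
  rewrite inME -(unramified_vge huj) rmorphD rmorphM rmorph_sum.
  rewrite [X in _ + _ * X](_ : _ = \sum_(k <= l < n) \sum_(s < p)
     pcoef p n l (j (c l s)) (j b) s) //.
  by apply: eq_bigr => l _; rewrite rmorph_sum; apply: eq_bigr => s _; apply: pcoef_rmorph.
have M0 := obs 0 (inO0 w); rewrite mul0r addr0 in M0.
have M1 := obs 1 (inO1 Hw); rewrite mul1r in M1.
(* The contribution of [rest] is common to [t = 0] and [t = 1] and cancels. *)
have {M0 M1}MS : inM w (\sum_(k <= l < n) \sum_(s < p) pcoef p n l (c l s) b s).
  by rewrite -[X in inM w X](addKr (lead (iota pi) m.-1 rest n.-1)) addrC; apply: inMB.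
have pO l (s : 'I_p) : inO w (pcoef p n l (c l s) b s) by apply: pcoefO.
have cbO l (s : 'I_p) i : inO w (c l s ^+ p * b ^+ i) by apply: inOM => //; apply: inOX.
have nB := nonpth_res (Hw := Hw) bO nib.
have chk := resfield_pchar Hw chL.
have pcoefE l (s : 'I_p) : res Hw (pcoef p n l (c l s) b s) * res Hw b =
    s%:R * (res Hw (c l s) ^+ p * res Hw b ^+ s) ^+ (p ^ (n.-1 - l)).
  have nO i : inO w i%:R by elim: i => [|i ih]; rewrite ?inO0 // -natr1 inOD ?inO1.
  rewrite /pcoef resM ?inOM ?inOX ?nO // resM ?nO // res_nat resX //.
  rewrite !resM ?inOX // !resX // -[in RHS](prednK (expp_gt0 pr_p (n.-1 - l))) exprS.
  case: (nat_of_ord s) => [|i]; first by rewrite !mul0r.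
  by rewrite /= (exprS _ i); move: (_ ^+ _.-1) => A; ring.
(* Multiplying by the residue of [b] turns [d/db] into [b d/db], the shape needed for
   [p_independent_tower]. *)
have h0 : \sum_(j < n - k) \sum_(s < p)
    s%:R * (res Hw (c (n.-1 - j)%N s) ^+ p * res Hw b ^+ s) ^+ (p ^ j) = 0.
  have /res_inM := MS => /(_ Hw)/(congr1 (fun u => u * res Hw b)); rewrite mul0r => h; rewrite -[RHS]h.
  rewrite res_sum; last by move=> l _; apply: inO_sum.
  rewrite big_nat_rev_ord mulr_suml; apply: eq_bigr => j _.
  rewrite res_sum // mulr_suml; apply: eq_bigr => s _; rewrite pcoefE.
  by congr (_ * _ ^+ (p ^ _)); have := ltn_ord j; clear -hk; lia.
have hC := p_independent_tower (C := fun j s => res Hw (c (n.-1 - j)%N s)) chk nB h0.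
have p0 := prime_gt0 pr_p.
(* Only the digit [s = 0] survives at index [k], where the coefficient expanded is [b] itself; its
   residue would be a [p]-th power. *)
have := nib (c k (Ordinal p0)) (cO _ _); rewrite -(res_eq Hw) //; last exact: inOX.
have := hck hk; rewrite lead_wmap -/b0 -/b -(res_eq Hw) //; last first.
  by apply: inO_sum => // s _.
move=> /eqP ->; rewrite res_sum // (bigD1 (Ordinal p0)) //= expr0 mulr1 big1 ?addr0 ?eqxx //.
move=> s hs; have s0 : s != 0%N :> nat by apply: contra hs => /eqP s0; apply/eqP/val_inj.
rewrite resM ?inOX // resX //.
have := hC (n.-1 - k)%N s; rewrite (_ : n.-1 - (n.-1 - k) = k)%N; last by clear -hk; lia.
move=> -> //; last by clear -hk; lia.
by rewrite expr0n gtn_eqF // mul0r.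
Qed.

End Obstruction.

(** * Lowering the level by one, or finding a field that forbids it *)

Section Dichotomy.
Variables (p : nat) (pr_p : prime p) (n : nat).
Variables (K : fieldType) (v : K -> int) (Hv : is_ndval v) (chK : p \in [pchar K]).
Variable pi : K.
Hypotheses (pi0 : pi != 0) (vpi : v pi = 1).
Local Notation W := (wittv pr_p n K).
Local Notation F := (wF chK).
Implicit Types (a x y : W) (m k : nat).

Lemma flat_or_obstructed m a : (1 < m)%N -> fil v m.-1 a -> flat Hv pi m.-1 a \/ obstructed v m a.
Proof.
move=> m1 ha; have [hf|nf] := boolp.pselect (flat Hv pi m.-1 a); [by left | right].
have m0 : (0 < m.-1)%N by lia.
have la : low (n.-1 - logn p m.-1) (sym Hv pi m.-1 a) by apply: low_sym.
have hln : (logn p m.-1 < n)%N.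
  rewrite ltnNge; apply/negP => h; apply: nf; split=> // _ l.
  by rewrite (eqP (_ : n - logn p m.-1 == 0)%N).
have hk : (n.-1 - logn p m.-1 < n)%N by lia.
have s0 : wx (sym Hv pi m.-1 a) (n.-1 - logn p m.-1) != 0.
  apply/eqP => h; apply: nf; split=> // _ l.
  rewrite (_ : n - logn p m.-1 = (n.-1 - logn p m.-1).+1)%N; last by lia.
  by rewrite ltnS leq_eqVlt => /orP[/eqP -> //|]; apply: la.
have [K' [v' [iota [hu perf]]]] := exists_perfect Hv chK.
have [Hv' _] := hu; exists K', v', iota; split; first exact: unramified_E2.
move=> ch' z w hz E.
have ipi0 : iota pi != 0 by rewrite fmorph_eq0.
have vipi : v' (iota pi) = 1 by case: hu => _ ->.
have hE : fil v' m.-1 (z + wF ch' w) by rewrite -E; apply: (fil_wmap hu ha).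
have := sym_F_coprime Hv' ipi0 vipi m0 hln hz hE; rewrite -E => /eqP.
by rewrite (sym_wmap_eq0 Hv chK Hv' ch' hu pi0 vpi hk ha) (negbTE s0).
Qed.

(** Each coefficient met from index [n - logn p m] on either has a [p]-th power as residue and is
    removed, or obstructs by [obstructed_nonpth]. Once all are removed the vector lies in
    [fil m.-1], and [flat_or_obstructed] decides. *)
Lemma flat_reduce m a : (1 < m)%N -> flat Hv pi m a ->
  (exists y, fil v (m %/ p) y /\ flat Hv pi m.-1 (a - F y)) \/ obstructed v m a.
Proof.
move=> m1 [ha0 la0]; have m0 : (0 < m)%N := ltnW m1.
suff H N k b : (n - k <= N)%N -> (n - logn p m <= k)%N -> fil v m b ->
    low k (sym Hv pi m b) ->
    (exists y, fil v (m %/ p) y /\ fil v m.-1 (b - F y)) \/ obstructed v m b.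
  have [[y [hy ha]]|] := H n (n - logn p m)%N a (leq_subr _ _) (leqnn _) ha0 (la0 m0); last by right.
  have [hf|hb] := flat_or_obstructed m1 ha; first by left; exists y.
  by right; apply: obstructed_subF hb.
elim: N k b {a ha0 la0} => [|N ih] k a hN hk ha la; have [hkn|hkn] := leqP n k; try by lia.
- left; exists 0; rewrite raddf0 subr0; split; first exact: (fil0 pr_p Hv chK pi0 vpi).
  case: m m1 m0 hk ha la => // m _ _ hk ha la; apply: (fil_sym0 chK pi0 vpi ha).
  by apply: low_sym_n => l hl; apply: la; lia.
- left; exists 0; rewrite raddf0 subr0; split; first exact: (fil0 pr_p Hv chK pi0 vpi).
  case: m m1 m0 hk ha la ih => // m _ _ hk ha la _; apply: (fil_sym0 chK pi0 vpi ha).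
  by apply: low_sym_n => l hl; apply: la; lia.
have [[c cO hc]|nc] := boolp.pselect (exists2 c, inO v c & inM v (lead pi m a k - c ^+ p)); last first.
  right; apply: obstructed_nonpth ha la _ => // c cO; apply/negP => h; apply: nc; by exists c.
have hd : (p ^ (n.-1 - k).+1 %| m)%N by rewrite pfactor_log //; clear -hk hkn; lia.
have [y [hy ha' la']] := remove_lead chK pi0 vpi hkn hd ha la cO hc.
have [||[y' [hy' ha'']]|hb] := ih k.+1 (a - F y) _ _ ha' la'; first by clear -hN; lia.
- by clear -hk; lia.
- left; exists (y + y'); split; first exact: (filD Hv chK pi0 vpi hy hy').
  by rewrite raddfD opprD addrA.
- by right; apply: obstructed_subF hb.
Qed.

(** For minimal [m] the first alternative is excluded; the second then says that some field of [E_2]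
    has invariant at least [m.-1]. *)
Definition descends_or_ramifies m a := Fsum chK (flat Hv pi m.-1) a \/
  exists (K' : fieldType) (v' : K' -> int) (iota : {rmorphism K -> K'}) (ch' : p \in [pchar K']),
    in_E2 p v v' iota /\ ~ Fsum ch' (fil v' m.-2) (wmap iota a).

(** Every [Fsum] over [K'] has the form [z + F w] with [z] in [fil m.-2], so an obstruction on the
    leading component is decisive whatever the tail [y] is. *)
Lemma obstructed_descends m x y : obstructed v m x -> descends_or_ramifies m (x + F y).
Proof.
case=> K' [v' [iota [hE h]]]; right.
have ch' : p \in [pchar K'] := rmorph_pchar iota chK.
exists K', v', iota, ch'; split=> // hF.
have [Hv' _ _ _ hv] := hE.
have ipi0 : iota pi != 0 by rewrite fmorph_eq0.
have vipi : v' (iota pi) = 1 by rewrite hv.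
suff [z [w [hz E]]] : exists z w, fil v' m.-2 z /\ wmap iota (x + F y) = z + wF ch' w.
  apply: (h ch' z (w - wmap iota y) hz).
  by rewrite raddfB /= addrA -E raddfD /= (wmap_wF chK ch') addrK.
case: hF => [|z w hz _]; last by exists z, w.
by exists 0, 0; rewrite raddf0 addr0; split=> //; apply: (fil0 pr_p Hv' ch' ipi0 vipi).
Qed.

Lemma flat_Fsum_E2 m (K' : fieldType) (v' : K' -> int) (iota : {rmorphism K -> K'})
    (ch' : p \in [pchar K']) a :
  in_E2 p v v' iota -> Fsum chK (flat Hv pi m.+1) a -> Fsum ch' (fil v' m) (wmap iota a).
Proof.
move=> hE; have [Hv' _ _ perf hv] := hE; have hu := E2_unramified hE.
have ipi0 : iota pi != 0 by rewrite fmorph_eq0.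
have vipi : v' (iota pi) = 1 by rewrite hv.
elim=> [|x y hx _ ih]; first by rewrite raddf0; apply: Fsum0.
rewrite raddfD /= (wmap_wF chK ch'); apply: FsumD.
- by move=> *; apply: (filD Hv' ch' ipi0 vipi).
- apply: (flat_Fsum (Hv := Hv') ch' ipi0 vipi) => //.
  exact: (flat_wmap (Hv := Hv)).
- by apply: Fsum_F => //; apply: (fil0 pr_p Hv' ch' ipi0 vipi).
Qed.

(** Over [K'] the component [x], flat at level [m.-1], already lies in [Fsum] of [fil m.-2]. It can
    be subtracted, and [Fsum_fil_tail] then strips the [F] from what remains. *)
Lemma descends_or_ramifies_F m x y : (1 < m)%N -> flat Hv pi m.-1 x -> descends_or_ramifies m y -> descends_or_ramifies m (x + F y).
Proof.
move=> m1 hx [hy|[K' [v' [iota [ch' [hE h]]]]]]; first by left; apply: FsumS.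
right; exists K', v', iota, ch'; split=> // hF; apply: h.
have [Hv' _ _ perf hv] := hE.
have ipi0 : iota pi != 0 by rewrite fmorph_eq0.
have vipi : v' (iota pi) = 1 by rewrite hv.
have f0 : fil v' m.-2 (0 : wittv pr_p n K') by apply: (fil0 pr_p Hv' ch' ipi0 vipi).
apply: (Fsum_fil_tail Hv' ipi0 vipi f0); rewrite add0r.
rewrite -(wmap_wF chK ch') -[F y](addKr x) raddfD; apply: FsumD => //.
  by move=> *; apply: (filD Hv' ch' ipi0 vipi).
case: m m1 hx {hF f0} => [|[|m]] // _ hx; apply: (flat_Fsum_E2 _ hE).
by apply: Fsum1; apply: flatN.
Qed.

Lemma Fsum_descends m a : (1 < m)%N -> Fsum chK (flat Hv pi m) a -> descends_or_ramifies m a.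
Proof.
move=> m1 hF; have dm : (m %/ p <= m.-1)%N by have := @ltn_div_p p pr_p m (ltnW m1); lia.
have ff (u : W) : fil v (m %/ p) u -> fil v m.-1 u by apply: fil_le.
(* [u] is a carry: reducing one component subtracts some [F u1], and [u1] is added to the next
   component. It lies in [fil (m %/ p)], hence is again flat at level [m]. *)
suff H (u : W) : flat Hv pi m u -> descends_or_ramifies m (a + u) by rewrite -[a]addr0; apply: H; apply: flat0.
elim: hF u => [|x y hx _ ih] u hu.
  rewrite add0r; have [[u1 [hu1 hx]]|hb] := flat_reduce m1 hu; last first.
    by rewrite -[u]addr0 -(raddf0 F); apply: obstructed_descends.
  rewrite -[u](subrK (F u1)); apply: descends_or_ramifies_F => //.
  have [h|h] := flat_or_obstructed m1 (ff _ hu1); first by left; apply: Fsum1.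
  by rewrite -[u1]addr0 -(raddf0 F); apply: obstructed_descends.
rewrite addrAC; have [[u1 [hu1 h]]|hb] := flat_reduce m1 (flatD chK pi0 vpi hx hu); last first.
  exact: obstructed_descends.
rewrite -[x + u](subrK (F u1)) -addrA -raddfD addrC [u1 + y]addrC addrC.
apply: descends_or_ramifies_F => //; apply: ih.
by rewrite -(prednK (ltnW m1)); apply: fil_flat => //; apply: ff.
Qed.

End Dichotomy.

Theorem theorem8p7 (p : nat) (K : fieldType) (v : K -> int) (n : nat) (phi : witt n K) :
  p \in [pchar K] -> is_ndval v ->
  exists M : nat,
    [/\ (* M = max{ s_{K'}(phi) | K' in E_2 } *)
        (exists (K' : fieldType) (v' : K' -> int) (iota : {rmorphism K -> K'}),
            in_E2 p v v' iota /\ swan_is p v' (witt_map iota phi) M),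
        (forall (K' : fieldType) (v' : K' -> int) (iota : {rmorphism K -> K'}) (s : nat),
            in_E2 p v v' iota -> swan_is p v' (witt_map iota phi) s -> (s <= M)%N),
        (* M + 1 = min{ m >= 1 | phi in flat fil^F_m W_n(K) } *)
        in_flat_filF p v M.+1 phi
      & forall m : nat, (1 <= m)%N -> in_flat_filF p v m phi -> (M.+1 <= m)%N].
Proof.
move=> chK Hv; have pr_p : prime p by case/andP: chK.
have [[pi [pi0 vpi]] _ _] := Hv.
have flatE m (a : wittv pr_p n K) : in_flat_filF p v m a <-> Fsum chK (flat Hv pi m) a.
  apply: (@in_sumFP p pr_p n K chK) => [x||x y]; first exact: in_flatP.
    exact: flat0.
  exact: flatD.
have filE (K' : fieldType) (v' : K' -> int) (Hv' : is_ndval v') (ch' : p \in [pchar K']) m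
    (a : wittv pr_p n K') : in_filF p v' m a <-> Fsum ch' (fil v' m) a.
  have [[t [t0 vt]] _ _] := Hv'.
  apply: (@in_sumFP p pr_p n K' ch') => [x||x y]; first exact: in_filP.
    exact: (fil0 pr_p Hv' ch' t0 vt).
  exact: (filD Hv' ch' t0 vt).
pose P m := boolp.asbool ((1 <= m)%N /\ in_flat_filF p v m phi).
have exP : exists m, P m.
  have [m hm] := exists_fil v (phi : wittv pr_p n K).
  exists m.+1; apply/boolp.asboolP; split=> //; apply/flatE; apply: Fsum1.
  exact: fil_flat.
have [m0 /boolp.asboolP[m0_gt0 hm0] m0_min] := ex_minnP exP.
case: m0 m0_gt0 hm0 m0_min => // M _ hM Mmin.
have Fup (K' : fieldType) (v' : K' -> int) (iota : {rmorphism K -> K'}) :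
    in_E2 p v v' iota -> in_filF p v' M (witt_map iota phi).
  move=> hE; have [Hv' _ _ _ _] := hE; have ch' : p \in [pchar K'] := rmorph_pchar iota chK.
  by apply/(filE _ _ Hv' ch'); apply: (flat_Fsum_E2 pi0 vpi ch' hE); apply/flatE.
exists M; split=> //.
(* For [M = 0] no lower bound is to be proved, and any field of [E_2] attains the maximum. Otherwise
   [M.+1 > 1], and the dichotomy at that level applies. *)
- have [M0|M0] := posnP M.
    have [K' [v' [iota [hu perf]]]] := exists_perfect Hv chK.
    have hE := unramified_E2 hu perf.
    exists K', v', iota; split=> //; split; first exact: Fup.
    by rewrite M0.
  have /flatE := hM => /(Fsum_descends pi0 vpi (M0 : 1 < M.+1)%N)[].
    move=> /flatE hM'; have : P M by apply/boolp.asboolP.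
    by move/Mmin; rewrite ltnn.
  case=> K' [v' [iota [ch' [hE h]]]]; exists K', v', iota; split=> //.
  have [Hv' _ _ _ _] := hE; split; first exact: Fup.
  move=> k hk /(filE _ _ Hv' ch') hF; apply: h; apply: Fsum_mono hF => x.
  by apply: fil_le; rewrite /= -ltnS prednK.
- move=> K' v' iota s hE [_ hs]; rewrite leqNgt; apply/negP => /hs; apply.
  exact: Fup.
- by move=> m m1 hm; apply: Mmin; apply/boolp.asboolP.
Qed.
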